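(* The lifted interpolation polynomials are well-defined, with coefficients in $\mathbb F(s,T)$: there is a unique family of (inhomogeneous) symmetric functions $\tilde P^*_\lambda(;q,t,T;s)$, indexed by partitions $\lambda$, with coefficients in $\mathbb F(s,T)$, such that $\tilde P^*_\lambda(;q,t,T;s)=m_\lambda+{}$a linear combination of $m_\mu$ with $\mu<\lambda$, and $\tilde P^*_\lambda(\langle\mu\rangle_{q,t,T;s};q,t,T;s)=0$ for all $\mu<\lambda$. For every $n\ge1$ they have the property that $$\tilde P^*_\lambda(x_1,x_1^{-1},x_2,x_2^{-1},\dots,x_n,x_n^{-1};q,t,t^n;s)=\begin{cases}\bar P^{*(n)}_\lambda(x_1,\dots,x_n;q,t,s)&\ell(\lambda)\le n\\0&\ell(\lambda)>n.\end{cases}$$ Moreover, $\tilde P^*_\lambda(\langle\mu\rangle_{q,t,T;s};q,t,T;s)=0$ unless $\lambda\subset\mu$, and $$\tilde P^*_\lambda(\langle\lambda\rangle_{q,t,T;s};q,t,T;s)=(qsT/t)^{-|\lambda|}\,t^{n(\lambda)}q^{-2n(\lambda')}\,C^-_\lambda(q;q,t)\,C^+_\lambda((sT/t)^2;q,t).$$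
   Context: $\mathbb F=\mathbb Q(q,t)$; $s,T$ are indeterminates. For a partition $\lambda$: $\lambda'$ is the conjugate, $\ell(\lambda)$ the number of nonzero parts, $n(\lambda)=\sum_i(i-1)\lambda_i$; $(i,j)\in\lambda$ means $1\le i$, $1\le j\le\lambda_i$; $\lambda\subset\mu$ means $\lambda_i\le\mu_i$ for all $i$. Dominance: $\mu\le\lambda$ iff $\mu_1+\dots+\mu_k\le\lambda_1+\dots+\lambda_k$ for all $k\ge1$ (sizes may differ). $C^-_\lambda(x;q,t)=\prod_{(i,j)\in\lambda}(1-q^{\lambda_i-j}t^{\lambda'_j-i}x)$, $C^+_\lambda(x;q,t)=\prod_{(i,j)\in\lambda}(1-q^{\lambda_i+j-1}t^{2-\lambda'_j-i}x)$. In the definition of $\tilde P^*_\lambda$, $m_\lambda$ is the usual monomial symmetric function in the ring $\Lambda$ of symmetric functions, and for a symmetric function $f$, $f(\langle\mu\rangle_{q,t,T;s})$ is its image under the homomorphism with $$p_k(\langle\mu\rangle_{q,t,T;s})=\sum_{1\le i\le\ell(\mu)}\Bigl((q^{k\mu_i}-1)t^{-ki}(sT)^k+(q^{-k\mu_i}-1)t^{ki}(sT)^{-k}\Bigr)+s^k\frac{1-T^k}{1-t^k}+s^{-k}\frac{1-1/T^k}{1-1/t^k},$$ $p_k$ being the power sums. Interpolation polynomials: $BC_n$ is the group of permutations of $x_1,\dots,x_n$ and inversions $x_i\mapsto x_i^{-1}$. For $\ell(\lambda)\le n$, $\bar P^{*(n)}_\lambda(x_1,\dots,x_n;q,t,s)$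 is the unique $BC_n$-symmetric Laurent polynomial with coefficients in $\mathbb F(s)$ equal to the $BC_n$-orbit sum of $\prod_ix_i^{\lambda_i}$ plus a linear combination of $BC_n$-orbit sums of $\prod_ix_i^{\mu_i}$ with $\mu<\lambda$, $\ell(\mu)\le n$, which vanishes at $x_i=q^{\mu_i}t^{n-i}s$ ($1\le i\le n$) for all partitions $\mu<\lambda$ with $\ell(\mu)\le n$ (it then vanishes there whenever $\lambda\not\subset\mu$). *)

(* Defs.v *)
From HB Require Import structures.
From mathcomp Require Import all_boot all_order all_fingroup all_algebra.
From mathcomp Require Import ring.
From mathcomp Require Import boolp.
From mathcomp Require Import freeg mpoly.

Set Implicit Arguments.
Unset Strict Implicit.
Unset Printing Implicit Defensive.

Import GRing.Theory.
Local Open Scope ring_scope.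

Record intpart := IntPart {
  parts :> seq nat;
  partsP : sorted geq parts && (0%N \notin parts) }.

HB.instance Definition _ := [isSub for parts].
HB.instance Definition _ := [Choice of intpart by <:].

(* Rows and columns are numbered from 1: [prow la i] is $\lambda_i$, with value 0
   beyond the length, and [prow (pconj la) j] is $\lambda'_j$. *)
Definition prow (la : seq nat) (i : nat) : nat := nth 0%N la i.-1.

Definition pconj (la : seq nat) : seq nat :=
  [seq count (leq j) la | j <- iota 1 (head 0%N la)].

Definition nstat (la : seq nat) : nat :=
  (\sum_(1 <= i < (size la).+1) (i - 1) * prow la i)%N.

Definition part_sub (la mu : intpart) : Prop :=
  forall i : nat, (0 < i)%N -> (prow la i <= prow mu i)%N.

Definition dom_le (mu la : intpart) : Prop :=
  forall k : nat, (0 < k)%N ->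
    (\sum_(1 <= i < k.+1) prow mu i <= \sum_(1 <= i < k.+1) prow la i)%N.

Definition dom_lt (mu la : intpart) : Prop := dom_le mu la /\ mu <> la.

Section Cpm.
Variables (K : fieldType) (q t : K).
Implicit Types (la : seq nat) (x : K).

Definition Cminus la x : K :=
  \prod_(1 <= i < (size la).+1) \prod_(1 <= j < (prow la i).+1)
    (1 - q ^ ((prow la i)%:Z - j%:Z) * t ^ ((prow (pconj la) j)%:Z - i%:Z) * x).

Definition Cplus la x : K :=
  \prod_(1 <= i < (size la).+1) \prod_(1 <= j < (prow la i).+1)
    (1 - q ^ ((prow la i)%:Z + j%:Z - 1)
           * t ^ (2 - (prow (pconj la) j)%:Z - i%:Z) * x).
End Cpm.

(* [mrestr p] is $p(x_1,\dots,x_n,0)$. *)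
Definition mrestr (K : fieldType) (n : nat) (p : {mpoly K[n.+1]}) :
    {mpoly K[n]} :=
  p \mPo [tuple oapp (fun j : 'I_n => 'X_j) 0 (insub (val i)) | i < n.+1].

Section MRestr.
Variables (K : fieldType) (n : nat).
Implicit Types p q : {mpoly K[n.+1]}.

Lemma mrestrN p : mrestr (- p) = - mrestr p. Proof. exact: comp_mpolyN. Qed.
Lemma mrestrD p q : mrestr (p + q) = mrestr p + mrestr q.
Proof. exact: comp_mpolyD. Qed.
Lemma mrestrM p q : mrestr (p * q) = mrestr p * mrestr q.
Proof. exact: rmorphM. Qed.
Lemma mrestrZ (c : K) p : mrestr (c *: p) = c *: mrestr p.
Proof. exact: comp_mpolyZ. Qed.
End MRestr.

(* $\Lambda$ is the inverse limit, with bounded degree, of the rings of symmetric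
   polynomials in n variables along the maps $x_{n+1}\mapsto 0$. *)
Record symfun (K : fieldType) := SymFun {
  sf : forall n : nat, {mpoly K[n]};
  sf_sym : forall n, sf n \is symmetric;
  sf_restr : forall n, mrestr (sf n.+1) = sf n;
  sf_bound : exists d, forall n, (msize (sf n) <= d)%N }.

Section SymFunRing.
Variable K : fieldType.
Implicit Types f g h : symfun K.

Lemma symfunP f g : (forall n, sf f n = sf g n) -> f = g.
Proof.
case: f g => [f f1 f2 f3] [g g1 g2 g3] /= fg.
have {fg}E : f = g by apply: functional_extensionality_dep.
subst g; congr SymFun; exact: Prop_irrelevance.
Qed.

HB.instance Definition _ := gen_eqMixin (symfun K).
HB.instance Definition _ := gen_choiceMixin (symfun K).

Fact sf0_bound : exists d, forall n, (msize (0 : {mpoly K[n]}) <= d)%N.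
Proof. by exists 0%N => n; rewrite msize0. Qed.

Definition sf0 : symfun K :=
  SymFun (fun n => rpred0 _) (fun n => comp_mpoly0 _) sf0_bound.

Fact sf1_bound : exists d, forall n, (msize (1 : {mpoly K[n]}) <= d)%N.
Proof. by exists 1%N => n; rewrite msize1. Qed.

Definition sf1 : symfun K :=
  SymFun (fun n => rpred1 _) (fun n => comp_mpoly1 _) sf1_bound.

Fact sfopp_restr f n : mrestr (- sf f n.+1) = - sf f n.
Proof. by rewrite mrestrN !sf_restr. Qed.

Fact sfopp_bound f : exists d, forall n, (msize (- sf f n) <= d)%N.
Proof. by case: (sf_bound f) => d fd; exists d => n; rewrite mmeasureN. Qed.

Definition sfopp f : symfun K :=
  SymFun (fun n => rpredNr (sf_sym f n)) (sfopp_restr f) (sfopp_bound f).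

Fact sfadd_restr f g n : mrestr (sf f n.+1 + sf g n.+1) = sf f n + sf g n.
Proof. by rewrite mrestrD !sf_restr. Qed.

Fact sfadd_bound f g : exists d, forall n, (msize (sf f n + sf g n) <= d)%N.
Proof.
case: (sf_bound f) (sf_bound g) => d fd [e ge]; exists (maxn d e) => n.
by rewrite (leq_trans (mmeasureD_le _ _ _)) // geq_max !leq_max fd ge orbT.
Qed.

Definition sfadd f g : symfun K :=
  SymFun (fun n => rpredD (sf_sym f n) (sf_sym g n))
    (sfadd_restr f g) (sfadd_bound f g).

Fact sfmul_restr f g n : mrestr (sf f n.+1 * sf g n.+1) = sf f n * sf g n.
Proof. by rewrite mrestrM !sf_restr. Qed.

Fact sfmul_bound f g : exists d, forall n, (msize (sf f n * sf g n) <= d)%N.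
Proof.
case: (sf_bound f) (sf_bound g) => d fd [e ge]; exists (d + e)%N => n.
have [->|nf] := eqVneq (sf f n) 0; first by rewrite mul0r msize0.
have [->|ng] := eqVneq (sf g n) 0; first by rewrite mulr0 msize0.
by rewrite msizeM // (leq_trans (leq_pred _)) // leq_add.
Qed.

Definition sfmul f g : symfun K :=
  SymFun (fun n => rpredM (sf_sym f n) (sf_sym g n))
    (sfmul_restr f g) (sfmul_bound f g).

Fact sfscale_restr (c : K) f n : mrestr (c *: sf f n.+1) = c *: sf f n.
Proof. by rewrite mrestrZ !sf_restr. Qed.

Fact sfscale_bound (c : K) f : exists d, forall n, (msize (c *: sf f n) <= d)%N.
Proof.
case: (sf_bound f) => d fd; exists d => n.
exact: leq_trans (mmeasureZ_le _ _ _) (fd n).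
Qed.

Definition sfscale (c : K) f : symfun K :=
  SymFun (fun n => rpredZ _ (sf_sym f n)) (sfscale_restr c f) (sfscale_bound c f).

Fact sfaddA : associative sfadd.
Proof. by move=> f g h; apply: symfunP => n /=; rewrite addrA. Qed.
Fact sfaddC : commutative sfadd.
Proof. by move=> f g; apply: symfunP => n /=; rewrite addrC. Qed.
Fact sfadd0 : left_id sf0 sfadd.
Proof. by move=> f; apply: symfunP => n /=; rewrite add0r. Qed.
Fact sfaddN : left_inverse sf0 sfopp sfadd.
Proof. by move=> f; apply: symfunP => n /=; rewrite addNr. Qed.

HB.instance Definition _ :=
  GRing.isZmodule.Build (symfun K) sfaddA sfaddC sfadd0 sfaddN.

Fact sfmulA : associative sfmul.
Proof. by move=> f g h; apply: symfunP => n /=; rewrite mulrA. Qed.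
Fact sfmulC : commutative sfmul.
Proof. by move=> f g; apply: symfunP => n /=; rewrite mulrC. Qed.
Fact sfmul1 : left_id sf1 sfmul.
Proof. by move=> f; apply: symfunP => n /=; rewrite mul1r. Qed.
Fact sfmulD : left_distributive sfmul +%R.
Proof. by move=> f g h; apply: symfunP => n /=; rewrite mulrDl. Qed.
Fact sf1_neq0 : sf1 != 0.
Proof.
apply/eqP => /(congr1 (fun f => sf f 0)) /= /eqP.
by rewrite oner_eq0.
Qed.

HB.instance Definition _ := GRing.Zmodule_isComNzRing.Build (symfun K)
  sfmulA sfmulC sfmul1 sfmulD sf1_neq0.

Fact sfscaleA a b f : sfscale a (sfscale b f) = sfscale (a * b) f.
Proof. by apply: symfunP => n /=; rewrite scalerA. Qed.
Fact sfscale1 : left_id 1 sfscale.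
Proof. by move=> f; apply: symfunP => n /=; rewrite scale1r. Qed.
Fact sfscaleDr : right_distributive sfscale +%R.
Proof. by move=> a f g; apply: symfunP => n /=; rewrite scalerDr. Qed.
Fact sfscaleDl f : {morph sfscale^~ f : a b / a + b}.
Proof. by move=> a b; apply: symfunP => n /=; rewrite scalerDl. Qed.

HB.instance Definition _ := GRing.Zmodule_isLmodule.Build K (symfun K)
  sfscaleA sfscale1 sfscaleDr sfscaleDl.

Fact sfscaleAl (a : K) f g : a *: (f * g) = (a *: f) * g.
Proof. by apply: symfunP => n /=; rewrite scalerAl. Qed.

HB.instance Definition _ :=
  GRing.Lmodule_isLalgebra.Build K (symfun K) sfscaleAl.

Lemma sfE0 n : sf (0 : symfun K) n = 0. Proof. by []. Qed.
Lemma sfE1 n : sf (1 : symfun K) n = 1. Proof. by []. Qed.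
Lemma sfED f g n : sf (f + g) n = sf f n + sf g n. Proof. by []. Qed.
Lemma sfEM f g n : sf (f * g) n = sf f n * sf g n. Proof. by []. Qed.
Lemma sfEZ (c : K) f n : sf (c *: f) n = c *: sf f n. Proof. by []. Qed.

End SymFunRing.

Section MRestrX.
Variables (K : fieldType) (n : nat).

Lemma mrestrXE (i : 'I_n.+1) :
  mrestr ('X_i : {mpoly K[n.+1]}) = oapp (fun j : 'I_n => 'X_j) 0 (insub (val i)).
Proof. by rewrite /mrestr comp_mpolyXU -tnth_nth tnth_mktuple. Qed.

Lemma mrestrX_max : mrestr ('X_ord_max : {mpoly K[n.+1]}) = 0.
Proof. by rewrite mrestrXE insubF //= ltnn. Qed.

Lemma mrestrX_widen (i : 'I_n) :
  mrestr ('X_(widen_ord (leqnSn n) i) : {mpoly K[n.+1]}) = 'X_i.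
Proof.
rewrite mrestrXE /= insubT //= => lt_in; congr 'X_[U_(_)]; exact: val_inj.
Qed.

Lemma mrestrXn p k : mrestr (p ^+ k : {mpoly K[n.+1]}) = mrestr p ^+ k.
Proof. exact: rmorphXn. Qed.

Lemma mrestr_sum I (r : seq I) (P : pred I) (F : I -> {mpoly K[n.+1]}) :
  mrestr (\sum_(i <- r | P i) F i) = \sum_(i <- r | P i) mrestr (F i).
Proof. exact: raddf_sum. Qed.

Lemma mrestr_prod I (r : seq I) (P : pred I) (F : I -> {mpoly K[n.+1]}) :
  mrestr (\prod_(i <- r | P i) F i) = \prod_(i <- r | P i) mrestr (F i).
Proof. exact: rmorph_prod. Qed.

Lemma mrestr_monom (m : 'X_{1..n.+1}) :
  mrestr ('X_[m] : {mpoly K[n.+1]}) =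
  'X_[[multinom m (widen_ord (leqnSn n) i) | i < n]] *+ (m ord_max == 0%N).
Proof.
rewrite mpolyXE_id mrestr_prod big_ord_recr /=.
rewrite mrestrXn mrestrX_max expr0n mulr_natr; congr (_ *+ _).
rewrite mpolyXE_id; apply: eq_bigr => i _.
by rewrite mrestrXn mrestrX_widen mnmE.
Qed.

Lemma mcoeff_mrestr (p : {mpoly K[n.+1]}) (m : 'X_{1..n}) :
  (mrestr p)@_m = p@_(mnmwiden m).
Proof.
rewrite [in LHS](mpolyE p) mrestr_sum raddf_sum /=.
rewrite [in RHS](mpolyE p) raddf_sum /=; apply: eq_bigr => u _.
rewrite mrestrZ !mcoeffZ; congr (_ * _).
rewrite mrestr_monom mcoeffMn !mcoeffX -mulrnA mulnb; congr (_%:R).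
congr nat_of_bool.
apply/andP/eqP => [[/eqP <- /eqP um]|->].
  apply/mnmP => i; case: (unliftP ord_max i) => [j|] ->.
    have -> : fintype.lift ord_max j = widen_ord (leqnSn n) j.
      by apply: val_inj; rewrite /= /bump leqNgt ltn_ord.
    by rewrite mnmwiden_widen mnmE.
  by rewrite mnmwiden_ordmax.
rewrite mnmwiden_ordmax; split=> //.
by apply/eqP/mnmP => i; rewrite mnmE mnmwiden_widen.
Qed.

Lemma mrestrK (p : {mpoly K[n]}) : mrestr (mwiden p) = p.
Proof. by apply/mpolyP => m; rewrite mcoeff_mrestr mwiden_mnmwiden. Qed.

Lemma mrestr_mesym k : mrestr (mesym n.+1 K k) = mesym n K k.
Proof.
case: k => [|k]; first by rewrite !mesym0E /mrestr comp_mpoly1.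
by rewrite mesymSS mrestrD mrestrM mrestrX_max mulr0 addr0 mrestrK.
Qed.

End MRestrX.

Section Monomial.
Variables (K : fieldType) (la : intpart).

(* The sum of all monomials in n variables whose nonzero exponents are the parts
   of [la] in some order; it is 0 if n is less than the length of [la]. *)
Definition mono_sym (n : nat) : {mpoly K[n]} :=
  \sum_(m : 'X_{1..n < (sumn la).+1} | perm_eq [seq k <- m | k != 0%N] la) 'X_[m].

Fact mcoeff_mono_sym n (m : 'X_{1..n}) :
  (mono_sym n)@_m = (perm_eq [seq k <- m | k != 0%N] la)%:R.
Proof.
rewrite raddf_sum /=.
have [Pm|nPm] := boolP (perm_eq _ _); last first.
  rewrite big1 // => u Pu; rewrite mcoeffX; case: eqP => // um.
  by rewrite -um Pu in nPm.
have lt_m : (mdeg m < (sumn la).+1)%N.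
  rewrite ltnS -(perm_sumn Pm) sumnE big_filter /mdeg.
  by rewrite (bigID (fun k => k != 0%N)) /= [X in (_ + X)%N]big1 ?addn0 // => i /negPn /eqP.
rewrite (bigD1 (BMultinom lt_m)) //= mcoeffX eqxx big1 ?addr0 // => u /andP[_ ne_um].
by rewrite mcoeffX; case: eqP => // um; case/eqP: ne_um; apply: val_inj.
Qed.

Fact mono_sym_sym n : mono_sym n \is symmetric.
Proof.
apply/issymP => s; apply/mpolyP => m; rewrite mcoeff_sym !mcoeff_mono_sym.
congr (nat_of_bool _)%:R; apply: (permPl _); apply: perm_filter.
apply/tuple_permP; exists s; congr tval; exact: eq_mktuple.
Qed.

Fact mono_sym_restr n : mrestr (mono_sym n.+1) = mono_sym n.
Proof.
apply/mpolyP => m; rewrite mcoeff_mrestr !mcoeff_mono_sym /mnmwiden /=.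
by rewrite -cats1 filter_cat /= cats0.
Qed.

Fact mono_sym_bound : exists d, forall n, (msize (mono_sym n) <= d)%N.
Proof.
exists (sumn la).+1 => n; apply: (leq_trans (mmeasure_sum _ _ _ _)).
by apply/bigmax_leqP => m _; rewrite msizeX; case: m.
Qed.

Definition mono_fun : symfun K :=
  SymFun mono_sym_sym mono_sym_restr mono_sym_bound.

End Monomial.

Section PowerSum.
Variable K : fieldType.

Definition psum_poly (k n : nat) : {mpoly K[n]} := \sum_(i < n) 'X_i ^+ k.

Lemma psum_polyS k n :
  psum_poly k n.+1 = mwiden (psum_poly k n) + 'X_ord_max ^+ k.
Proof.
rewrite /psum_poly big_ord_recr /= raddf_sum /=; congr (_ + _).
by apply: eq_bigr => i _; rewrite rmorphXn /= mwidenX mnmwiden1.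
Qed.

Fact psum_sym k n : psum_poly k.+1 n \is symmetric.
Proof.
apply/issymP => s; rewrite /psum_poly raddf_sum /=.
rewrite [RHS](reindex_inj (@perm_inj _ s)) /=.
have rm p j : msym s (p ^+ j) = msym s p ^+ j :> {mpoly K[n]} by exact: rmorphXn.
apply: eq_bigr => i _; rewrite rm msymX; congr ('X_[_] ^+ _).
apply/mnmP => j; rewrite !mnmE; congr nat_of_bool.
by apply/eqP/eqP => [->|<-]; rewrite ?permKV ?permK.
Qed.

Fact psum_restr k n : mrestr (psum_poly k.+1 n.+1) = psum_poly k.+1 n.
Proof.
by rewrite psum_polyS mrestrD mrestrK mrestrXn mrestrX_max expr0n addr0.
Qed.

Fact psum_bound k : exists d, forall n, (msize (psum_poly k n) <= d)%N.
Proof.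
exists k.+1 => n; apply: (leq_trans (mmeasure_sum _ _ _ _)).
apply/bigmax_leqP => i _; rewrite mpolyXn msizeX mdegMn mdeg1 mul1n //.
Qed.

(* [psumS k] is the power sum $p_{k+1}$. *)
Definition psumS (k : nat) : symfun K :=
  SymFun (psum_sym k) (psum_restr k) (psum_bound k.+1).

Lemma newton n k :
  k.+1%:R * mesym n K k.+1 =
    \sum_(i < k.+1) (-1) ^+ i * mesym n K (k - i) * psum_poly i.+1 n.
Proof.
elim: n k => [|n IHn] k.
  rewrite mesym_geqnE // mulr0 big1 // => i _.
  by rewrite /psum_poly big_ord0 mulr0.
pose a j := mwiden (mesym n K j); pose x : {mpoly K[n.+1]} := 'X_ord_max.
pose b j := if j is j'.+1 then a j' else 0.
have eE j : mesym n.+1 K j = a j + x * b j.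
  case: j => [|j]; first by rewrite /a /b !mesym0E rmorph1 mulr0 addr0.
  by rewrite mesymSS mulrC.
have IHa j : j.+1%:R * a j.+1 =
    \sum_(i < j.+1) (-1) ^+ i * a (j - i)%N * mwiden (psum_poly i.+1 n).
  rewrite /a -(rmorph_nat (@mwiden n K)) -rmorphM /= IHn raddf_sum /=.
  by apply: eq_bigr => i _; rewrite !mwidenM rmorph_sign.
have IHb : k%:R * a k =
    \sum_(i < k.+1) (-1) ^+ i * b (k - i)%N * mwiden (psum_poly i.+1 n).
  case: k => [|k]; first by rewrite big_ord1 /= mulr0 !mul0r.
  rewrite big_ord_recr /= subnn /= mulr0 mul0r addr0 IHa.
  by apply: eq_bigr => i _; rewrite subSn // -ltnS.
have tele : \sum_(i < k.+1) (-1) ^+ i * (a (k - i)%N + x * b (k - i)%N) * x ^+ i.+1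
    = x * a k.
  under eq_bigr => i _ do rewrite mulrDr mulrDl.
  rewrite big_split /= big_ord_recl [X in _ + X]big_ord_recr /= subnn /=.
  rewrite subn0 !mulr0 mul0r addr0 expr0 mul1r expr1 -addrA -big_split /=.
  rewrite big1 ?addr0 1?mulrC // => i _.
  rewrite /bump /= ?add1n. rewrite -(subnSK (ltn_ord i)) /= !exprS; ring.
rewrite eE /= -/(a k).
under eq_bigr => i _ do
  rewrite eE psum_polyS -/x mulrDr [in X in X + _]mulrDr [in X in X + _]mulrDl.
rewrite !big_split /= tele -IHa.
have -> : \sum_(i < k.+1) (-1) ^+ i * (x * b (k - i)%N) * mwiden (psum_poly i.+1 n)
    = x * (k%:R * a k).
  by rewrite IHb mulr_sumr; apply: eq_bigr => i _; ring.
by rewrite -[k.+1]addn1 natrD; ring.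
Qed.

End PowerSum.

Section Symf.
Variable K : fieldType.

Lemma symf_unique n (p t : {mpoly K[n]}) :
  p = t \mPo [tuple mesym n K i.+1 | i < n] -> symf p = t.
Proof.
move=> pt; apply: msym_fundamental_un; rewrite -symfP //.
rewrite pt; apply: mcomp_sym => i.
by rewrite -tnth_nth tnth_mktuple mesym_sym.
Qed.

Lemma symf_widen n (p : {mpoly K[n.+1]}) : p \is symmetric ->
  (msize p <= n.+1)%N -> symf p = mwiden (symf (mrestr p)).
Proof.
move=> sp szp; pose t := symf p.
have t0 m : m \in msupp t -> m ord_max = 0%N.
  move=> /(mmeasure_mnm_lt (Measure.clone _ (@mnmwgt n.+1) _)) /= m_lt.
  have [t' [t'E wt']] := sym_fundamental sp.
  have tt' : t = t' by apply: symf_unique; rewrite t'E.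
  rewrite -tt' in wt'; move: (leq_trans m_lt (leq_trans wt' szp)).
  rewrite /mnmwgt big_ord_recr /= ltnS.
  case: (m ord_max) => // k le.
  have := leq_trans (leq_addl _ _) le.
  by rewrite mulSn -ltnS ltnNge ltnS leq_addr.
have rp : mrestr p = mrestr t \mPo [tuple mesym n K i.+1 | i < n].
  rewrite [in LHS](symfP sp) -/t comp_mpolyEX mrestr_sum.
  rewrite [in RHS](mpolyE t) mrestr_sum raddf_sum /= !big_seq.
  apply: eq_bigr => m /t0 m0; rewrite !mrestrZ comp_mpolyZ; congr (_ *: _).
  rewrite mrestr_monom m0 eqxx !comp_mpolyX mrestr_prod big_ord_recr /= m0.
  rewrite mrestrXn expr0 mulr1; apply: eq_bigr => i _.
  by rewrite mrestrXn !tnth_mktuple mrestr_mesym mnmE.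
rewrite (symf_unique rp) -/t [in LHS](mpolyE t) [in RHS](mpolyE t).
rewrite mrestr_sum raddf_sum /= !big_seq; apply: eq_bigr => m /t0 m0.
rewrite mrestrZ mwidenZ mrestr_monom m0 eqxx mwidenX; congr (_ *: 'X_[_]).
apply/mnmP => i; case: (unliftP ord_max i) => [j|] ->.
  have -> : fintype.lift ord_max j = widen_ord (leqnSn n) j.
    by apply: val_inj; rewrite /= /bump leqNgt ltn_ord.
  by rewrite mnmwiden_widen mnmE.
by rewrite mnmwiden_ordmax.
Qed.

Lemma meval_mwiden n (v : 'I_n.+1 -> K) (p : {mpoly K[n]}) :
  (mwiden p).@[v] = p.@[fun i => v (widen_ord (leqnSn n) i)].
Proof.
rewrite [in LHS](mpolyE p) (raddf_sum (@mwiden n K)) /= raddf_sum mevalE /=.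
apply: eq_bigr => m _; rewrite mwidenZ mevalZ mwidenX mevalX; congr (_ * _).
rewrite big_ord_recr /= mnmwiden_ordmax expr0 mulr1.
by apply: eq_bigr => i _; rewrite mnmwiden_widen.
Qed.

End Symf.

Section Specialisation.
Variables (K : fieldType) (a : nat -> K).

Fixpoint eps_seq (k : nat) : seq K :=
  if k is k'.+1 then
    k%:R^-1 * (\sum_(i < k) (-1) ^+ i * (eps_seq k')`_i * a i) :: eps_seq k'
  else [:: 1].

Let eps k := head 0 (eps_seq k).

Let eps_nth k i : (i <= k)%N -> (eps_seq k)`_i = eps (k - i)%N.
Proof.
elim: k i => [|k IHk] [|i] ik; rewrite ?subn0 //.
by rewrite subSS -IHk.
Qed.

Let epsS k : eps k.+1 =
  k.+1%:R^-1 * (\sum_(i < k.+1) (-1) ^+ i * eps (k - i)%N * a i).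
Proof.
rewrite /eps /=; congr (_ * _); apply: eq_bigr => i _.
by rewrite eps_nth // -ltnS.
Qed.

Let phi n (p : {mpoly K[n]}) : K := (symf p).@[fun i : 'I_n => eps i.+1].

Let phiD n (p r : {mpoly K[n]}) : p \is symmetric -> r \is symmetric ->
  phi (p + r) = phi p + phi r.
Proof.
move=> sp sr; rewrite /phi -mevalD; congr (_.@[_]); apply: symf_unique.
by rewrite comp_mpolyD -!symfP.
Qed.

Let phiM n (p r : {mpoly K[n]}) : p \is symmetric -> r \is symmetric ->
  phi (p * r) = phi p * phi r.
Proof.
move=> sp sr; rewrite /phi -mevalM; congr (_.@[_]); apply: symf_unique.
by rewrite rmorphM /= -!symfP.
Qed.

Let phiZ n (c : K) (p : {mpoly K[n]}) : p \is symmetric ->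
  phi (c *: p) = c * phi p.
Proof.
move=> sp; rewrite /phi -mevalZ; congr (_.@[_]); apply: symf_unique.
by rewrite comp_mpolyZ -!symfP.
Qed.

Let phi1 n : phi (1 : {mpoly K[n]}) = 1.
Proof.
rewrite /phi -[RHS](meval1 (fun i : 'I_n => eps i.+1)); congr (_.@[_]).
by apply: symf_unique; rewrite comp_mpoly1.
Qed.

Let phi_mesym n k : (k <= n)%N -> phi (mesym n K k) = eps k.
Proof.
case: k => [|k] kn; first by rewrite mesym0E phi1.
rewrite /phi (_ : symf _ = 'X_(Ordinal kn)) ?mevalXU //.
by apply: symf_unique; rewrite comp_mpolyXU -tnth_nth tnth_mktuple.
Qed.

Let phi_restr n (p : {mpoly K[n.+1]}) : p \is symmetric ->
  (msize p <= n.+1)%N -> phi p = phi (mrestr p).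
Proof.
by move=> sp szp; rewrite /phi symf_widen // meval_mwiden.
Qed.

Let deg (f : symfun K) : nat := sval (cid (sf_bound f)).

Let degP f n : (msize (sf f n) <= deg f)%N.
Proof. exact: (svalP (cid (sf_bound f))). Qed.

Definition psum_ev (f : symfun K) : K := phi (sf f (deg f)).

Let evE f n : (deg f <= n)%N -> psum_ev f = phi (sf f n).
Proof.
elim: n => [|n IHn].
  by rewrite leqn0 /psum_ev => /eqP ->.
rewrite leq_eqVlt => /predU1P[<- //|]; rewrite ltnS => le_n.
rewrite IHn // -[in LHS]sf_restr -phi_restr ?sf_sym //.
by rewrite (leq_trans (degP _ _)) // ltnW.
Qed.

Let ev_zmod : zmod_morphism psum_ev.
Proof.
move=> f g; pose N := (deg (f - g)%R + deg f + deg g)%N.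
rewrite !(@evE _ N) /N ?leq_addl ?leq_addr -?addnA ?leq_addr //; last first.
  by rewrite addnCA leq_addr.
rewrite /= phiD ?rpredN ?sf_sym //; congr (_ + _).
by rewrite -[X in phi X]scaleN1r phiZ ?sf_sym // mulN1r.
Qed.

Let ev_monoid : monoid_morphism psum_ev.
Proof.
split; first by rewrite /psum_ev phi1.
move=> f g; pose N := (deg (f * g)%R + deg f + deg g)%N.
rewrite !(@evE _ N) /N ?leq_addl ?leq_addr -?addnA ?leq_addr //; last first.
  by rewrite addnCA leq_addr.
by rewrite /= phiM ?sf_sym.
Qed.

Let ev_scal : scalable_for *%R psum_ev.
Proof.
move=> c f; pose N := (deg (c *: f)%R + deg f)%N.
by rewrite !(@evE _ N) /N ?leq_addl ?leq_addr //= phiZ ?sf_sym.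
Qed.

Let ev_psum (char0 : [pchar K] =i pred0) k : psum_ev (psumS K k) = a k.
Proof.
have nz m : m.+1%:R != 0 :> K by move/pcharf0P: char0 => ->.
pose N := (deg (psumS K k) + k.+1)%N.
rewrite (@evE _ N) ?leq_addr //.
have : (k < N)%N by rewrite leq_addl.
move: N => N; rewrite /=.
elim/ltn_ind: k => k IHk ltkN.
have phi_sum m (F : 'I_m -> {mpoly K[N]}) : (forall i, F i \is symmetric) ->
    phi (\sum_(i < m) F i) = \sum_(i < m) phi (F i).
  move=> Fs; elim: m F Fs => [|m IHm] F Fs.
    by rewrite !big_ord0 -(scale0r 1) phiZ ?rpred1 // mul0r.
  rewrite !big_ord_recr /= phiD ?IHm ?rpred_sum //.
have sgnE m (p : {mpoly K[N]}) : (-1) ^+ m * p = (-1) ^+ m *: p.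
  by rewrite -mul_mpolyC rmorphXn /= rmorphN rmorph1.
have natE m (p : {mpoly K[N]}) : m%:R * p = m%:R *: p.
  by rewrite -mul_mpolyC rmorph_nat.
have symT i m : (-1) ^+ i * mesym N K m * psum_poly K i.+1 N \is symmetric.
  by rewrite sgnE rpredM ?rpredZ ?mesym_sym ?psum_sym.
have := congr1 (@phi N) (newton K N k).
rewrite natE phiZ ?mesym_sym // phi_sum // phi_mesym // epsS mulVKf //.
have phiT i m : (m <= N)%N ->
    phi ((-1) ^+ i * mesym N K m * psum_poly K i.+1 N) =
    (-1) ^+ i * eps m * phi (psum_poly K i.+1 N).
  move=> mN; rewrite sgnE -scalerAl phiZ ?rpredM ?mesym_sym ?psum_sym //.
  by rewrite phiM ?mesym_sym ?psum_sym // phi_mesym // mulrA.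
rewrite !big_ord_recr /= subnn phiT //.
rewrite (eq_bigr (fun i : 'I_k => phi ((-1) ^+ i * mesym N K (k - i)
  * psum_poly K i.+1 N))); last first.
  move=> i _; rewrite phiT ?IHk ?(ltn_trans _ ltkN) //.
  by rewrite (leq_trans (leq_subr _ _)) // ltnW.
have e0 : eps 0 = 1 by [].
by move/addrI => /esym; rewrite e0 !mulr1; apply: mulfI; rewrite signr_eq0.
Qed.

HB.instance Definition _ := GRing.isZmodMorphism.Build (symfun K) K^o psum_ev ev_zmod.
HB.instance Definition _ := GRing.isMonoidMorphism.Build (symfun K) K^o psum_ev ev_monoid.
HB.instance Definition _ := GRing.isScalable.Build K (symfun K) K^o *:%R psum_ev ev_scal.

Lemma psum_spec_exists : [pchar K] =i pred0 ->
  exists phi : {lrmorphism symfun K -> K^o}, forall k, phi (psumS K k) = a k.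
Proof. by move=> char0; exists psum_ev => k; apply: ev_psum. Qed.

End Specialisation.

Section SpecUnique.
Variable K : fieldType.

Fact esym_bound k : exists d, forall n, (msize (mesym n K k) <= d)%N.
Proof.
exists k.+1 => n; rewrite mesymE; apply: (leq_trans (mmeasure_sum _ _ _ _)).
by apply/bigmax_leqP => h /eqP <-; rewrite msizeX mdeg_mesym1.
Qed.

Definition esym_fun (k : nat) : symfun K :=
  SymFun (fun n => mesym_sym n K k) (fun n => mrestr_mesym K n k) (esym_bound k).

Lemma sf_sum I (r : seq I) (F : I -> symfun K) n :
  sf (\sum_(i <- r) F i) n = \sum_(i <- r) sf (F i) n.
Proof. by elim: r => [|i r IHr]; rewrite ?big_nil // !big_cons sfED IHr. Qed.

Lemma sf_prod I (r : seq I) (F : I -> symfun K) n :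
  sf (\prod_(i <- r) F i) n = \prod_(i <- r) sf (F i) n.
Proof. by elim: r => [|i r IHr]; rewrite ?big_nil // !big_cons sfEM IHr. Qed.

Lemma sf_exp (f : symfun K) k n : sf (f ^+ k) n = sf f n ^+ k.
Proof. by elim: k => [|k IHk]; rewrite ?expr0 // !exprS sfEM IHk. Qed.

Lemma symfun_ge (f g : symfun K) d :
  (forall n, (d <= n)%N -> sf f n = sf g n) -> f = g.
Proof.
elim: d => [|d IHd] fg; first by apply: symfunP => n; apply: fg.
apply: IHd => n le_dn; rewrite -sf_restr -[RHS]sf_restr fg //.
Qed.

Lemma symfun_esym (f : symfun K) : exists d (t : {mpoly K[d]}),
  f = \sum_(m <- msupp t) t@_m *: \prod_(i < d) esym_fun i.+1 ^+ m i.
Proof.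
have [d fd] := sf_bound f; exists d, (symf (sf f d)).
pose E k (u : {mpoly K[k]}) n : {mpoly K[n]} :=
  u \mPo [tuple mesym n K i.+1 | i < k].
have EW k u n : E k.+1 (mwiden u) n = E k u n.
  rewrite /E [in LHS](mpolyE u) (raddf_sum (@mwiden k K)) /= raddf_sum /=.
  rewrite [in RHS]comp_mpolyEX; apply: eq_bigr => m _.
  rewrite mwidenZ mwidenX !comp_mpolyZ; congr (_ *: _).
  rewrite !comp_mpolyX big_ord_recr /= mnmwiden_ordmax expr0 mulr1.
  by apply: eq_bigr => i _; rewrite mnmwiden_widen !tnth_mktuple.
have Ef n : (d <= n)%N -> sf f n = E d (symf (sf f d)) n.
  move=> le_dn; rewrite [LHS](symfP (sf_sym f n)) -/(E n _ n).
  have IH : forall j N, E (d + j)%N (symf (sf f (d + j))) N = E d (symf (sf f d)) N.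
    elim=> [|j IHj] N; first by rewrite addn0.
    rewrite addnS symf_widen ?sf_sym //; first by rewrite sf_restr EW.
    by rewrite (leq_trans (fd _)) // -addnS leq_addr.
  by have := IH (n - d)%N n; rewrite subnKC.
apply: (@symfun_ge _ _ d) => n /Ef ->; rewrite sf_sum /E comp_mpolyEX.
apply: eq_bigr => m _; rewrite sfEZ sf_prod comp_mpolyX; congr (_ *: _).
by apply: eq_bigr => i _; rewrite sf_exp tnth_mktuple.
Qed.

Lemma newton_fun k : k.+1%:R *: esym_fun k.+1 =
  \sum_(i < k.+1) (-1) ^+ i *: (esym_fun (k - i) * psumS K i).
Proof.
apply: symfunP => n; rewrite sf_sum sfEZ /= -mul_mpolyC rmorph_nat newton.
apply: eq_bigr => i _.
by rewrite -mul_mpolyC rmorphXn /= rmorphN rmorph1 mulrA.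
Qed.

(* In characteristic 0 the power sums generate $\Lambda$. *)
Lemma psum_spec_unique (phi psi : {lrmorphism symfun K -> K^o}) :
  [pchar K] =i pred0 -> (forall k, phi (psumS K k) = psi (psumS K k)) ->
  phi =1 psi.
Proof.
move=> /pcharf0P char0 pp.
have ee : forall k, phi (esym_fun k) = psi (esym_fun k).
  elim/ltn_ind => [] [|k] IHk.
    have -> : esym_fun 0 = 1 by apply: symfunP => n /=; rewrite mesym0E.
    by rewrite !rmorph1.
  have nz : k.+1%:R != 0 :> K by rewrite char0.
  have lin (chi : {lrmorphism symfun K -> K^o}) : k.+1%:R * chi (esym_fun k.+1) =
      \sum_(i < k.+1) (-1) ^+ i * (chi (esym_fun (k - i)) * chi (psumS K i)).
    transitivity (chi (k.+1%:R *: esym_fun k.+1)); first by rewrite linearZ.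
    by rewrite newton_fun linear_sum; apply: eq_bigr => i _; rewrite linearZ /= rmorphM.
  apply: (mulfI nz); rewrite !lin.
  apply: eq_bigr => i _; rewrite pp IHk //.
  by rewrite ltnS leq_subr.
move=> f; have [d [t ->]] := symfun_esym f.
rewrite !linear_sum; apply: eq_bigr => m _; rewrite !linearZ !rmorph_prod /=.
by congr (_ *: _); apply: eq_bigr => i _; rewrite !rmorphXn /= ee.
Qed.

End SpecUnique.

(* The algebra homomorphism $\Lambda\to K$ sending each $p_{k+1}$ to [a k]. *)
Definition psum_spec (K : fieldType) (char0 : [pchar K] =i pred0)
    (a : nat -> K) : {lrmorphism symfun K -> K^o} :=
  sval (cid (psum_spec_exists a char0)).

Lemma psum_specE (K : fieldType) (char0 : [pchar K] =i pred0) (a : nat -> K) k :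
  psum_spec char0 a (psumS K k) = a k.
Proof. exact: (svalP (cid (psum_spec_exists a char0))). Qed.

Section Lifted.
Variables (K : fieldType) (char0 : [pchar K] =i pred0) (q t s T : K).
Implicit Types (la mu : intpart) (f : symfun K).

Definition bracket_psum mu (k : nat) : K :=
  \sum_(1 <= i < (size mu).+1)
    ((q ^+ (k * prow mu i) - 1) * t ^- (k * i) * (s * T) ^+ k
     + (q ^- (k * prow mu i) - 1) * t ^+ (k * i) * (s * T) ^- k)
  + s ^+ k * ((1 - T ^+ k) / (1 - t ^+ k))
  + s ^- k * ((1 - 1 / T ^+ k) / (1 - 1 / t ^+ k)).

(* $f(\langle\mu\rangle_{q,t,T;s})$ *)
Definition sf_bracket mu f : K :=
  psum_spec char0 (fun k => bracket_psum mu k.+1) f.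

Definition lifted_interp la f : Prop :=
  (exists2 r : seq (K * intpart),
     forall c, c \in r -> dom_lt c.2 la
   & f = mono_fun K la + \sum_(c <- r) c.1 *: mono_fun K c.2)
  /\ (forall mu, dom_lt mu la -> sf_bracket mu f = 0).

End Lifted.

Section Laurent.
Variables (K : fieldType) (n : nat).

(* A Laurent polynomial is a finite formal combination of exponent vectors,
   [<< a >>] standing for the monomial $\prod_i x_i^{a_i}$. *)
Definition laurent := {freeg {ffun 'I_n -> int} / K}.

Definition laurent_eval (L : fieldType) (h : K -> L) (x : 'I_n -> L)
    (g : laurent) : L :=
  \sum_(a <- dom g) h (coeff a g) * \prod_(i < n) x i ^ a i.

(* The pair (w, e) is a permutation of the variables followed by the inversion of
   those marked by e. *)
Definition bc_group := ({perm 'I_n} * {ffun 'I_n -> bool})%type.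

Definition bc_act (w : bc_group) (a : {ffun 'I_n -> int}) :
    {ffun 'I_n -> int} :=
  [ffun i => (-1) ^+ w.2 i * a (w.1 i)].

Definition bc_orbit_sum (a : {ffun 'I_n -> int}) : laurent :=
  \sum_(b <- undup [seq bc_act w a | w : bc_group]) << b >>.

Definition bc_symmetric (g : laurent) : Prop :=
  forall w a, coeff (bc_act w a) g = coeff a g.

Definition part_exp (la : intpart) : {ffun 'I_n -> int} :=
  [ffun i : 'I_n => (prow la i.+1)%:Z].

Definition bc_interp (q t s : K) (la : intpart) (g : laurent) : Prop :=
  [/\ bc_symmetric g,
      exists2 r : seq (K * intpart),
        forall c, c \in r -> dom_lt c.2 la /\ (size c.2 <= n)%N
      & g = bc_orbit_sum (part_exp la)
            + \sum_(c <- r) c.1 *: bc_orbit_sum (part_exp c.2)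
    & forall mu : intpart, dom_lt mu la -> (size mu <= n)%N ->
        laurent_eval id
          (fun i : 'I_n => q ^+ prow mu i.+1 * t ^+ (n - i.+1) * s) g = 0].

(* $K(x_1,\dots,x_n)$, in which Laurent polynomials are compared. *)
Definition ratfunX := {fraction {mpoly K[n]}}.
Definition cstX (c : K) : ratfunX := tofrac c%:MP.
Definition varX (i : 'I_n) : ratfunX := tofrac 'X_i.

Fact half_ord_proof (i : 'I_n.*2) : (i./2 < n)%N.
Proof. by rewrite ltn_half_double. Qed.

(* $f(x_1,x_1^{-1},\dots,x_n,x_n^{-1})$ *)
Definition sf_pm (f : symfun K) : ratfunX :=
  mmap cstX
    (fun i : 'I_n.*2 =>
       let x := varX (Ordinal (half_ord_proof i)) in if odd i then x^-1 else x)
    (sf f n.*2).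

End Laurent.

Definition ratfun (K : fieldType) : fieldType := {fraction {poly K}}.
Definition cst (K : fieldType) (c : K) : ratfun K := tofrac c%:P.
Definition var (K : fieldType) : ratfun K := tofrac ('X : {poly K}).

(* The rational function f is regular at c, with value v. *)
Definition ratfun_at (K : fieldType) (c : K) (f : ratfun K) (v : K) : Prop :=
  exists p r : {poly K},
    [/\ r.[c] != 0, f = tofrac p / tofrac r & v = p.[c] / r.[c]].

(* All the coefficients of f are regular at c, and g is obtained from f by
   evaluating them there. *)
Definition sf_at (K : fieldType) (c : K) (f : symfun (ratfun K)) (g : symfun K) :
    Prop :=
  forall n (m : 'X_{1..n}), ratfun_at c (sf f n)@_m (sf g n)@_m.

Lemma pchar_ratfun (K : fieldType) :
  [pchar K] =i pred0 -> [pchar ratfun K] =i pred0.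
Proof.
move=> char0 p.
by rewrite -(char0 p) (fmorph_pchar (@tofrac {poly K} \o @polyC K)).
Qed.

(* $\mathbb F=\mathbb Q(q)(t)$, $\mathbb F(s)$ and $\mathbb F(s,T)=\mathbb F(s)(T)$;
   [q1], [t1], [s1] lie in the second field and [q2], [t2], [s2], [T2] in the last. *)
Definition Fqt : fieldType := ratfun (ratfun rat).
Definition Fs : fieldType := ratfun Fqt.
Definition FsT : fieldType := ratfun Fs.

Definition q0 : Fqt := cst (var rat).
Definition t0 : Fqt := var (ratfun rat).
Definition q1 : Fs := cst q0.
Definition t1 : Fs := cst t0.
Definition s1 : Fs := var Fqt.
Definition q2 : FsT := cst q1.
Definition t2 : FsT := cst t1.
Definition s2 : FsT := cst s1.
Definition T2 : FsT := var Fs.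

Lemma pchar_FsT : [pchar FsT] =i pred0.
Proof. by do 4!apply: pchar_ratfun; exact: Num.Theory.pchar_num. Qed.

(* Main.v *)
Require Import Defs.
From mathcomp Require Import all_boot all_order all_fingroup all_algebra.
From mathcomp Require Import ring zify.
From mathcomp Require Import boolp.
From mathcomp Require Import freeg mpoly.

(** The triangular family is obtained from interpolation in finitely many variables, in
    which everything can be checked at T = t^n for infinitely many n.

    At T = t^n the bracket at mu evaluates a symmetric function at the points
    x_i = q^mu_i t^(n-i) s and their inverses ([sf_bracket_tn]). A BC_n-symmetric Laurent
    polynomial is a symmetric polynomial f in z_i = x_i + 1/x_i ([zpoly]), so three facts
    about symmetric polynomials on the grid of the points z(mu) are needed, for f with all
    monomials dominated by la.
    - If f vanishes at z(mu) for every mu <= la, then f = 0 ([interp_unique]). This is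
      Newton interpolation: setting the last variable to z(s) gives the same problem in
      one variable less with s replaced by t s; once that specialisation is 0, f is
      divisible by prod_i (z_i - z(s)), and the quotient solves the same problem with s
      replaced by q s.
    - If f vanishes at z(mu) for mu < la, the same recursion computes f(z(la)) as the
      leading coefficient times a product over the boxes of la ([interp_value]), which is
      the product of C^- and C^+ in the formula to prove ([hookval_tn]).
    - In the same situation f vanishes at z(mu) unless la is contained in mu
      ([interp_extra]). The argument is a q-difference operator: multiply f by a suitable
      kernel, antisymmetrise over all flips x_i -> q / x_i, and divide by the Weyl
      denominator to get another symmetric polynomial R of the same kind, for the variables
      x_i + q / x_i ([weyl_op]). On the grid a flip lowers a part by 1, and the kernel
      vanishes when the result is not a partition. One parameter beta of the kernel can be
      chosen to kill the term of f(z(la)), and then R vanishes on all mu <= la, so R = 0 by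
      the first fact. What remains is a recursion for f(z(mu)) over smaller partitions.

    The lifted function of la is built by recursion on dominance: the brackets of m_la at
    the mu < la are cancelled, in order of size, by multiples of the functions already
    built ([interp_exists]). The divisions are by the explicit diagonal values, so all
    coefficients are regular at T = t^n. Hence the function can be specialised there, the
    facts above give its extra zeros and its diagonal value for all large n, and a rational
    function of T is determined by its values at infinitely many t^n ([triang_extra]).
    Since the brackets form a triangular matrix with nonzero diagonal, the family is unique
    ([interp_determined]). Specialising one lifted function at T = t^n and comparing zeros
    and leading terms identifies it with the interpolation polynomial in n variables, or
    with 0 when la has more than n parts ([interp_restrict]). *)

Set Implicit Arguments.
Unset Strict Implicit.
Unset Printing Implicit Defensive.

Import GRing.Theory Order.TTheory Num.Theory.
Local Open Scope ring_scope.

(** * Polynomials with bounded partial degrees *)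

Section Bounded.
Variables (n : nat) (R : idomainType).
Implicit Types (p r : {mpoly R[n]}) (A : {set 'I_n}) (B : {set 'I_n} -> nat).

(** With B A = la_1 + ... + la_#|A| this says that the decreasing rearrangement of
    each exponent is dominated by la. Quantifying over all sets A of variables avoids
    the rearrangement and makes the condition stable under products. *)
Definition bounded B p : Prop :=
  forall m, m \in msupp p -> forall A, (\sum_(i in A) m i <= B A)%N.

Lemma boundedW B B' p :
  (forall A, (B A <= B' A)%N) -> bounded B p -> bounded B' p.
Proof. by move=> le b m /b h A; exact: leq_trans (h A) (le A). Qed.

Lemma bounded0 B : bounded B 0.
Proof. by move=> m; rewrite mcoeff_msupp mcoeff0 eqxx. Qed.

Lemma boundedD B p r : bounded B p -> bounded B r -> bounded B (p + r).
Proof. by move=> bp br m /msuppD_le; rewrite mem_cat => /orP[/bp|/br]. Qed.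

Lemma boundedZ B c p : bounded B p -> bounded B (c *: p).
Proof. by move=> bp m /msuppZ_le /bp. Qed.

Lemma bounded_sum I (s : seq I) (P : pred I) (F : I -> {mpoly R[n]}) B :
  (forall i, P i -> bounded B (F i)) -> bounded B (\sum_(i <- s | P i) F i).
Proof. by move=> h; elim/big_ind: _ => //; [exact: bounded0|exact: boundedD]. Qed.

Lemma bounded_sum_seq (I : eqType) (s : seq I) (F : I -> {mpoly R[n]}) B :
  (forall i, i \in s -> bounded B (F i)) -> bounded B (\sum_(i <- s) F i).
Proof. by move=> h; rewrite big_seq; apply: bounded_sum. Qed.

Lemma boundedX B (m : 'X_{1..n}) : (forall A, (\sum_(i in A) m i <= B A)%N) -> bounded B 'X_[m].
Proof. by move=> h m'; rewrite msuppX inE => /eqP ->. Qed.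

Lemma boundedC B c : bounded B c%:MP.
Proof.
rewrite -[c%:MP]mulr1 mul_mpolyC -mpolyX0.
by apply/boundedZ/boundedX => A; rewrite big1 // => i _; rewrite mnm0E.
Qed.

Lemma boundedM B B' p r :
  bounded B p -> bounded B' r -> bounded (fun A => B A + B' A)%N (p * r).
Proof.
move=> bp br m /msuppM_le/allpairsP[[m1 m2] /= [/bp h1 /br h2 ->]] A.
under eq_bigr => i _ do rewrite mnmDE.
by rewrite big_split /= leq_add.
Qed.

Lemma bounded_prod I (s : seq I) (P : pred I) (F : I -> {mpoly R[n]})
    (G : I -> {set 'I_n} -> nat) :
  (forall i, P i -> bounded (G i) (F i)) ->
  bounded (fun A => \sum_(i <- s | P i) G i A)%N (\prod_(i <- s | P i) F i).
Proof.
move=> h; elim: s => [|i s IHs].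
  by rewrite big_nil -mpolyC1; exact: boundedC.
rewrite big_cons; case Pi: (P i).
  apply: boundedW (boundedM (h i Pi) IHs) => A.
  by rewrite big_cons Pi.
by apply: boundedW IHs => A; rewrite big_cons Pi.
Qed.

Lemma boundedXn B p k : bounded B p -> bounded (fun A => k * B A)%N (p ^+ k).
Proof.
move=> bp; elim: k => [|k IHk]; first by rewrite expr0 -mpolyC1; exact: boundedC.
by rewrite exprS; apply: boundedW (boundedM bp IHk) => A; rewrite mulSn.
Qed.

Lemma bounded_comp B (T : n.-tuple {mpoly R[n]}) p :
    (forall i, bounded (fun A => (i \in A) : nat) (tnth T i)) ->
  bounded B p -> bounded B (p \mPo T).
Proof.
move=> hT bp; rewrite comp_mpolyE; apply: bounded_sum_seq => m /bp hm.
apply: boundedZ.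
apply: (@boundedW (fun A => \sum_(i < n) m i * (i \in A))%N); last first.
  by apply: bounded_prod => i _; apply: (@boundedXn (fun A => (i \in A) : nat)).
move=> A; apply: leq_trans (hm A); rewrite [leqRHS]big_mkcond /=.
by apply: leq_sum => i _; case: (i \in A); rewrite ?muln1 ?muln0.
Qed.

Lemma boundedXU i : bounded (fun A => (i \in A) : nat) ('X_i : {mpoly R[n]}).
Proof.
apply: boundedX => A; case: (boolP (i \in A)) => iA.
  rewrite (bigD1 i) //= mnm1E eqxx big1 // => j /andP[_ /negPf ji].
  by rewrite mnm1E eq_sym ji.
by rewrite big1 // => j jA; rewrite mnm1E; case: eqP jA iA => // -> ->.
Qed.

Definition transl (a : R) p : {mpoly R[n]} :=
  p \mPo [tuple 'X_i + a%:MP | i < n].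

Lemma bounded_transl B a p : bounded B p -> bounded B (transl a p).
Proof.
apply: bounded_comp => i; rewrite tnth_mktuple.
by apply: boundedD; [exact: boundedXU|exact: boundedC].
Qed.

Lemma meval_transl a p v : (transl a p).@[v] = p.@[fun i => v i + a].
Proof.
rewrite comp_mpoly_meval; apply: meval_eq => i.
by rewrite tnth_mktuple mevalD mevalXU mevalC.
Qed.

Lemma translK a : cancel (transl a) (transl (- a)).
Proof.
move=> p; rewrite /transl [p \mPo _]comp_mpolyE raddf_sum /= [RHS]mpolyE.
apply: eq_bigr => m _; rewrite comp_mpolyZ rmorph_prod /= mpolyXE_id.
congr (_ *: _); apply: eq_bigr => i _.
rewrite rmorphXn /= tnth_mktuple comp_mpolyD comp_mpolyXU comp_mpolyC.
by rewrite -tnth_nth tnth_mktuple -addrA -mpolyCD addNr mpolyC0 addr0.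
Qed.

Lemma translM a p r : transl a (p * r) = transl a p * transl a r.
Proof. exact: rmorphM. Qed.

Lemma transl_sym a p : p \is symmetric -> transl a p \is symmetric.
Proof.
move=> sp; apply: (msym_comp_poly sp) => s.
apply/tuple_permP; exists s^-1%g.
congr tval; apply: eq_from_tnth => i; rewrite !tnth_mktuple -tnth_nth tnth_mktuple.
by rewrite msymD /msym mmapC mmapX mmap1U permKV.
Qed.

(** Translation adds only terms of smaller total degree, so it does not change the
    coefficients in the top degree. *)
Lemma mcoeff_transl B a p (m0 : 'X_{1..n}) :
    bounded B p -> (B setT <= \sum_i m0 i)%N ->
  (transl a p)@_m0 = p@_m0.
Proof.
move=> bp hm0; rewrite /transl comp_mpolyE [in RHS](mpolyE p) !raddf_sum /=.
rewrite !big_seq; apply: eq_bigr => m /bp bm; rewrite !mcoeffZ; congr (_ * _).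
have {bm} le_m : (mdeg m <= mdeg m0)%N.
  rewrite !mdegE; apply: leq_trans hm0; apply: leq_trans (bm setT).
  by rewrite [leqRHS](eq_bigl xpredT) // => i; rewrite inE.
suff [r rb ->] : exists2 r : {mpoly R[n]}, forall m', m' \in msupp r ->
    (mdeg m' < mdeg m)%N &
    \prod_(i < n) tnth [tuple 'X_i + a%:MP | i < n] i ^+ m i = 'X_[m] + r.
  rewrite mcoeffD (_ : r@_m0 = 0) ?addr0 //; apply/eqP; rewrite mcoeff_eq0.
  by apply/negP => /rb; rewrite ltnNge le_m.
clear le_m hm0 bp; pose lt d (r : {mpoly R[n]}) :=
  forall m', m' \in msupp r -> (mdeg m' < d)%N.
have ltW d d' r : (d <= d')%N -> lt d r -> lt d' r.
  by move=> h l m' /l; move/leq_trans; apply.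
have ltD d r1 r2 : lt d r1 -> lt d r2 -> lt d (r1 + r2).
  by move=> l1 l2 m' /msuppD_le; rewrite mem_cat => /orP[/l1|/l2].
have ltM d d' r1 r2 : lt d.+1 r1 -> lt d' r2 -> lt (d + d')%N (r1 * r2).
  move=> l1 l2 m' /msuppM_le/allpairsP[[m1 m2] /= [/l1 h1 /l2 h2 ->]].
  by rewrite mdegD -addnS leq_add.
have ltX m1 d : (mdeg m1 < d)%N -> lt d 'X_[m1].
  by move=> h m'; rewrite msuppX inE => /eqP ->.
have key m1 m2 r1 r2 : lt (mdeg m1) r1 -> lt (mdeg m2) r2 ->
    exists2 r, lt (mdeg (m1 + m2)%MM) r &
      ('X_[m1] + r1) * ('X_[m2] + r2) = 'X_[(m1 + m2)%MM] + r.
  move=> l1 l2; exists ('X_[m1] * r2 + (r1 * 'X_[m2] + r1 * r2)); last first.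
    by rewrite mpolyXD; ring.
  rewrite mdegD; apply: (ltD); first by apply: ltM => //; apply: ltX.
  apply: ltD; last by apply: ltM => //; apply: ltW l1.
  by rewrite mulrC addnC; apply: ltM => //; apply: ltX.
have keyX m1 r1 k : lt (mdeg m1) r1 ->
    exists2 r, lt (mdeg (m1 *+ k)%MM) r & ('X_[m1] + r1) ^+ k = 'X_[(m1 *+ k)%MM] + r.
  move=> l1; elim: k => [|k [r lr IH]].
    by exists 0 => [m'|]; rewrite ?msupp0 // addr0 mulm0n mpolyX0.
  by rewrite exprS IH mulmS; apply: key.
pose Q (m1 : 'X_{1..n}) (p1 : {mpoly R[n]}) :=
  exists2 r, lt (mdeg m1) r & p1 = 'X_[m1] + r.
suff: Q (\sum_(i < n) (U_(i) *+ m i))%MM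
    (\prod_(i < n) tnth [tuple 'X_i + a%:MP | i < n] i ^+ m i).
  by rewrite -multinomUE_id; case=> r; exists r.
apply: (big_ind2 Q) => [|m1 p1 m2 p2 [r1 l1 ->] [r2 l2 ->]|i _].
- by exists 0 => [m'|]; rewrite ?msupp0 // mpolyX0 addr0.
- exact: key.
rewrite tnth_mktuple; apply: keyX; rewrite mdeg1 => m'.
by rewrite msuppC; case: ifP => // _; rewrite inE => /eqP ->; rewrite mdeg0.
Qed.

End Bounded.

(** * Specialising the last variable *)

Section Restriction.
Variables (K : fieldType) (n : nat).
Implicit Types (p : {mpoly K[n.+1]}) (b : nat -> nat).

Local Notation widen := (widen_ord (leqnSn n)).

Lemma widen_ord_inj m k (h : (m <= k)%N) : injective (widen_ord h).
Proof. by move=> i j /(congr1 val) /= /val_inj. Qed.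

Lemma lift_max_widen (j : 'I_n) : fintype.lift ord_max j = widen j.
Proof. by apply: val_inj; rewrite /= /bump leqNgt ltn_ord. Qed.

Lemma ord_max_or (i : 'I_n.+1) : i = ord_max \/ exists j : 'I_n, i = widen j.
Proof.
by case: (unliftP ord_max i) => [j|] ->; [right; exists j; rewrite lift_max_widen|left].
Qed.

Lemma card_iprefix N k : (k <= N)%N -> #|[set i : 'I_N | (i < k)%N]| = k.
Proof.
move=> kN; rewrite -[RHS](card_ord k) -(card_imset _ (@widen_ord_inj _ _ kN)).
apply: eq_card => i; rewrite inE; apply/idP/imsetP => [ik|[j _ ->]].
  by exists (Ordinal ik) => //; apply: val_inj.
by rewrite /= ltn_ord.
Qed.

Lemma meval_mrestr p (w : 'I_n.+1 -> K) : w ord_max = 0 ->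
  (mrestr p).@[fun i => w (widen i)] = p.@[w].
Proof.
move=> w0; rewrite /mrestr comp_mpoly_meval; apply: meval_eq => i.
rewrite tnth_mktuple; case: (ord_max_or i) => [->|[j ->]].
  by rewrite insubF /= ?ltnn // meval0 w0.
rewrite insubT /= ?ltn_ord // => h; rewrite mevalXU; congr (w _); exact: val_inj.
Qed.

Lemma mrestr_sym p : p \is symmetric -> mrestr p \is symmetric.
Proof.
move=> sp; apply/issymP => s; apply/mpolyP => m.
rewrite mcoeff_sym !mcoeff_mrestr -[RHS](msym_coeff _ (lift_perm ord_max ord_max s)) //.
congr (_@__); apply/mnmP => i; rewrite mnmE; case: (ord_max_or i) => [->|[j ->]].
  by rewrite lift_perm_id !mnmwiden_ordmax.
by rewrite -{2}lift_max_widen lift_perm_lift lift_max_widen !mnmwiden_widen mnmE.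
Qed.

(** The last variable, whose exponent is 0 in what remains, can be added to A: hence
    the minimum. *)
Lemma mrestr_bounded b p : bounded (fun A => b #|A|) p ->
  bounded (fun A => minn (b #|A|) (b #|A|.+1)) (mrestr p).
Proof.
move=> bp m; rewrite mcoeff_msupp mcoeff_mrestr -mcoeff_msupp => /bp h A.
have wi : injective widen by exact: widen_ord_inj.
have E : (\sum_(i in A) m i = \sum_(i in widen @: A) mnmwiden m i)%N.
  rewrite big_imset /=; last by move=> i j _ _; apply: wi.
  by under [RHS]eq_bigr => i _ do rewrite mnmwiden_widen.
have nA : ord_max \notin widen @: A.
  by apply/imsetP => -[j _ /(congr1 val) /= jn]; have := ltn_ord j; rewrite -jn ltnn.
rewrite leq_min -(card_imset _ wi) E h /=.
by have := h (ord_max |: widen @: A); rewrite big_setU1 // cardsU1 nA mnmwiden_ordmax.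
Qed.

(** The value p(x_1, ..., x_n, a), which conjugation by a translation reduces to
    a = 0. *)
Definition restr (a : K) p : {mpoly K[n]} := transl (- a) (mrestr (transl a p)).

Lemma restr_sym a p : p \is symmetric -> restr a p \is symmetric.
Proof. by move=> sp; apply/transl_sym/mrestr_sym/transl_sym. Qed.

Lemma restr_bounded b a p : bounded (fun A => b #|A|) p ->
  bounded (fun A => minn (b #|A|) (b #|A|.+1)) (restr a p).
Proof. by move=> bp; apply/bounded_transl/mrestr_bounded/bounded_transl. Qed.

Lemma meval_restr a p (w : 'I_n.+1 -> K) : w ord_max = a ->
  (restr a p).@[fun i => w (widen i)] = p.@[w].
Proof.
move=> wa; rewrite /restr meval_transl.
have := @meval_mrestr (transl a p) (fun i => w i - a).
rewrite wa subrr => /(_ erefl) ->; rewrite meval_transl; apply: meval_eq => i.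
by rewrite subrK.
Qed.

Lemma mcoeff_restr b a p (m : 'X_{1..n}) :
    bounded (fun A => b #|A|) p -> (b n.+1 <= mdeg m)%N -> (b n <= mdeg m)%N ->
  (restr a p)@_m = p@_(mnmwiden m).
Proof.
move=> bp; rewrite mdegE => bm bm'.
rewrite /restr (@mcoeff_transl _ _ (fun A => minn (b #|A|) (b #|A|.+1))).
- rewrite mcoeff_mrestr (@mcoeff_transl _ _ (fun A => b #|A|)) //.
  rewrite cardsT card_ord (leq_trans bm) // big_ord_recr /=.
  by rewrite mnmwiden_ordmax addn0; apply: leq_sum => i _; rewrite mnmwiden_widen.
- by apply/mrestr_bounded/bounded_transl.
by rewrite cardsT card_ord geq_min bm'.
Qed.

Definition ones : 'X_{1..n.+1} := [multinom 1%N | i < n.+1].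

(** By symmetry, a polynomial that vanishes where the last variable is a is divisible
    by every v_i - a; once a is translated to 0 this means that all exponents are
    positive, and dividing lowers them by 1. If the quotient is nonzero, such a monomial
    exists, which forces k <= b k. *)
Lemma factor_restr b a p :
    p \is symmetric -> bounded (fun A => b #|A|) p -> restr a p = 0 ->
  exists g : {mpoly K[n.+1]},
  [/\ g \is symmetric, bounded (fun A => b #|A| - #|A|)%N g,
      forall v, p.@[v] = \prod_i (v i - a) * g.@[v],
      (g = 0 -> p = 0) /\ (g != 0 -> forall k, (k <= n.+1)%N -> (k <= b k)%N)
    & forall m : 'X_{1..n.+1}, (b n.+1 <= \sum_i (m i).+1)%N ->
        g@_m = p@_(m + ones)].
Proof.
move=> sp bp r0; pose p' := transl a p.
have sp' : p' \is symmetric by apply: transl_sym.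
have bp' : bounded (fun A => b #|A|) p' by apply: bounded_transl.
have {}r0 : mrestr p' = 0.
  by rewrite -(translK (- a) (mrestr p')) -/(restr a p) r0 /transl comp_mpoly0.
have pos m : m \in msupp p' -> forall i, (0 < m i)%N.
  have key m' : m' \in msupp p' -> (0 < m' ord_max)%N.
    move=> m'p; rewrite lt0n; apply/negP => /eqP m0.
    have m'E : m' = mnmwiden [multinom m' (widen i) | i < n].
      apply/mnmP => i; case: (ord_max_or i) => [->|[j ->]].
        by rewrite mnmwiden_ordmax.
      by rewrite mnmwiden_widen mnmE.
    by move: m'p; rewrite mcoeff_msupp m'E -mcoeff_mrestr r0 mcoeff0 eqxx.
  move=> mp i; have := key [multinom m (tperm i ord_max j) | j < n.+1].
  by rewrite issym_msupp // mnmE tpermR; apply.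
pose g' : {mpoly K[n.+1]} := \sum_(m <- msupp p') p'@_m *: 'X_[(m - ones)%MM].
have subK m : m \in msupp p' -> (m - ones + ones)%MM = m.
  move=> mp; apply/mnmP => i; rewrite mnmDE mnmBE !mnmE subnK //; exact: pos.
have g'E m : g'@_m = p'@_(m + ones).
  rewrite /g' [in RHS](mpolyE p') !raddf_sum /= !big_seq; apply: eq_bigr => m' mp.
  rewrite !mcoeffZ !mcoeffX.
  suff -> : ((m' - ones)%MM == m) = (m' == m + ones)%MM by [].
  apply/eqP/eqP => [<-|->]; first by rewrite subK.
  by apply/mnmP => i; rewrite mnmBE mnmDE addnK.
have p'E : p' = 'X_[ones] * g'.
  rewrite [LHS]mpolyE /g' mulr_sumr !big_seq; apply: eq_bigr => m mp.
  by rewrite -scalerAr -mpolyXD addmC subK.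
have bg' : bounded (fun A => b #|A| - #|A|)%N g'.
  move=> m; rewrite mcoeff_msupp g'E -mcoeff_msupp => /bp' h A.
  have := h A; under eq_bigr => i _ do rewrite mnmDE mnmE.
  by rewrite big_split /= sum1_card => hA; rewrite -[leqLHS](addnK #|A|) leq_sub2r.
exists (transl (- a) g'); split.
- apply/transl_sym/issymP => s; apply/mpolyP => m.
  rewrite mcoeff_sym !g'E -[RHS](msym_coeff _ s) //.
  by congr (_@__); apply/mnmP => i; rewrite !(mnmE, mnmDE).
- exact: bounded_transl.
- move=> v; rewrite -[p](translK a) -/p' p'E translM mevalM; congr (_ * _).
  by rewrite meval_transl mevalX; apply: eq_bigr => i _; rewrite mnmE expr1.
- split=> [g0|ng k kn].
    have {}g0 : g' = 0.
      by rewrite -(translK (- a) g') g0 /transl comp_mpoly0.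
    by rewrite -[p](translK a) -/p' p'E g0 mulr0 /transl comp_mpoly0.
  have : g' != 0.
    by apply: contra_neq ng => ->; rewrite /transl comp_mpoly0.
  rewrite -msupp_eq0; case E: (msupp g') => [|m s] // _.
  have : m \in msupp g' by rewrite E mem_head.
  rewrite mcoeff_msupp g'E -mcoeff_msupp => /bp' /(_ [set i : 'I_n.+1 | (i < k)%N]).
  rewrite card_iprefix //; apply: leq_trans.
  under eq_bigr => i _ do rewrite mnmDE mnmE.
  by rewrite big_split /= sum1_card card_iprefix // leq_addl.
move=> m bm; rewrite (mcoeff_transl _ bg') ?g'E.
  apply: (mcoeff_transl _ bp); rewrite cardsT card_ord (leq_trans bm) //.
  by apply: leq_sum => i _; rewrite mnmDE mnmE addn1.
rewrite cardsT card_ord leq_subLR; apply: leq_trans bm _.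
by under eq_bigr => i _ do rewrite -add1n; rewrite big_split /= sum1_card card_ord.
Qed.

End Restriction.

(** * Newton interpolation on the grid *)

Definition ispart (n : nat) (mu : nat -> nat) : Prop :=
  (forall i, (mu i.+1 <= mu i)%N) /\ (forall i, (n <= i)%N -> mu i = 0%N).

Definition psum (mu : nat -> nat) (k : nat) : nat := (\sum_(i < k) mu i)%N.

Lemma psum_recr mu k : psum mu k.+1 = (psum mu k + mu k)%N.
Proof. by rewrite /psum big_ord_recr. Qed.

Lemma ispart_le n mu i j : ispart n mu -> (i <= j)%N -> (mu j <= mu i)%N.
Proof.
move=> [h _]; elim: j => [|j IHj]; first by rewrite leqn0 => /eqP ->.
by rewrite leq_eqVlt => /predU1P[->//|/IHj]; apply: leq_trans.
Qed.

Definition addcol n (mu : nat -> nat) i := if (i < n)%N then (mu i).+1 else 0%N.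
Definition delcol (mu : nat -> nat) i := (mu i).-1.

Lemma ispart_addcol n mu : ispart n mu -> ispart n (addcol n mu).
Proof.
move=> [h1 h2]; split=> i; rewrite /addcol.
  by case: ltnP => // lt_i; rewrite (ltn_trans _ lt_i) // ltnS.
by rewrite leqNgt => /negPf ->.
Qed.

Lemma ispart_delcol n mu : ispart n mu -> ispart n (delcol mu).
Proof.
move=> [h1 h2]; split=> i; rewrite /delcol; last by move/h2 ->.
by have := h1 i; lia.
Qed.

Lemma psum_addcol n mu k : (k <= n)%N -> psum (addcol n mu) k = (psum mu k + k)%N.
Proof.
elim: k => [|k IHk] kn; first by rewrite /psum !big_ord0.
by rewrite !psum_recr IHk ?(ltnW kn) // /addcol kn addnS addnAC addnS.
Qed.

Lemma delcolK n mu : ispart n mu -> (forall i, (i < n)%N -> (0 < mu i)%N) ->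
  addcol n (delcol mu) =1 mu.
Proof.
move=> [_ h] pos i; rewrite /addcol /delcol; case: ltnP => [/pos|/h ->//].
by case: (mu i).
Qed.

Lemma eq_psum mu mu' k : mu =1 mu' -> psum mu k = psum mu' k.
Proof. by move=> e; apply: eq_bigr. Qed.

Section Grid.
Variables (K : fieldType) (q t c : K).
Implicit Types (s x y : K) (mu la : nat -> nat).

(** The invariant of x -> c / x. The parameter c is 1 for the interpolation
    polynomials, but the proof of the extra vanishing passes from c to q c. *)
Definition zfun x := x + c / x.
(** Indices start at 0, whence the exponent n - i.+1 of t. *)
Definition gridx n s mu i := q ^+ mu i * t ^+ (n - i.+1) * s.
Definition zpt n s mu i := zfun (gridx n s mu i).

(** These conditions are stable under s -> t s, s -> q s and c -> q c, the shifts
    that the inductions below perform. *)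
Definition generic s : Prop :=
  [/\ q != 0, t != 0, s != 0 & c != 0] /\
  ((forall a b : int, q ^ a * t ^ b = 1 -> a = 0 /\ b = 0) /\
   (forall a b : int, q ^ a * t ^ b * s ^+ 2 != c)).

Lemma zfun_eq x y : x != 0 -> y != 0 ->
  (zfun x == zfun y) = (x == y) || (x * y == c).
Proof.
move=> nx ny; rewrite -subr_eq0 -[x == y]subr_eq0 -[_ == c]subr_eq0 -mulf_eq0.
have -> : (x - y) * (x * y - c) = (zfun x - zfun y) * (x * y).
  by rewrite /zfun; field; rewrite nx ny.
by rewrite !mulf_eq0 (negPf nx) (negPf ny) !orbF.
Qed.

Section Gen.
Variables (s : K) (gs : generic s).
Let nq : q != 0. Proof. by case: gs => -[]. Qed.
Let nt : t != 0. Proof. by case: gs => -[]. Qed.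
Let ns : s != 0. Proof. by case: gs => -[]. Qed.
Let nc : c != 0. Proof. by case: gs => -[]. Qed.

Lemma generic_qt a b : q ^ a * t ^ b = 1 -> a = 0 /\ b = 0.
Proof. by case: gs => _ [h _]; apply: h. Qed.

Lemma generic_s a b : q ^ a * t ^ b * s ^+ 2 != c.
Proof. by case: gs => _ [_ h]; apply: h. Qed.

Lemma generic_inj (a b a' b' : nat) :
  q ^+ a * t ^+ b * s = q ^+ a' * t ^+ b' * s -> a = a' /\ b = b'.
Proof.
move/(mulIf ns) => h.
have nz : q ^+ a' * t ^+ b' != 0 by rewrite mulf_neq0 ?expf_neq0.
have : q ^ (a%:Z - a'%:Z) * t ^ (b%:Z - b'%:Z) = 1.
  rewrite !expfzDr // -!invr_expz -!exprnP; apply: (mulIf nz).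
  by rewrite mul1r -[RHS]h; field; rewrite !expf_neq0.
by move/generic_qt => []; lia.
Qed.

Lemma generic_t : generic (t * s).
Proof.
split; first by split=> //; apply: mulf_neq0.
split=> a b; first exact: generic_qt.
have -> : q ^ a * t ^ b * (t * s) ^+ 2 = q ^ a * t ^ (b + 2) * s ^+ 2.
  by rewrite expfzDr // -exprnP exprMn; ring.
exact: generic_s.
Qed.

Lemma generic_q : generic (q * s).
Proof.
split; first by split=> //; apply: mulf_neq0.
split=> a b; first exact: generic_qt.
have -> : q ^ a * t ^ b * (q * s) ^+ 2 = q ^ (a + 2) * t ^ b * s ^+ 2.
  by rewrite expfzDr // -exprnP exprMn; ring.
exact: generic_s.
Qed.

Lemma gridx_neq0 n mu i : gridx n s mu i != 0.
Proof. by rewrite !mulf_neq0 ?expf_neq0. Qed.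

Lemma gridx_prod n mu i j : gridx n s mu i * gridx n s mu j != c.
Proof.
rewrite (_ : _ * _ = q ^ (mu i + mu j)%:Z * t ^ (n - i.+1 + (n - j.+1))%:Z * s ^+ 2).
  exact: generic_s.
by rewrite -!exprnP !exprD /gridx; ring.
Qed.

Lemma zpt_base n mu i : (i < n)%N -> (0 < mu i)%N -> zpt n s mu i != zfun s.
Proof.
move=> lt_i mu0; rewrite zfun_eq ?gridx_neq0 //; apply/negP => /orP[/eqP h|/eqP h].
  have [] : mu i = 0%N /\ (n - i.+1)%N = 0%N.
    by apply: generic_inj; rewrite -/(gridx n s mu i) h !expr0 !mul1r.
  by lia.
have /eqP[] := generic_s (mu i)%:Z (n - i.+1)%:Z.
by rewrite -h -!exprnP /gridx; ring.
Qed.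
End Gen.

Lemma zpt_widen n s mu i : (i < n)%N -> zpt n.+1 s mu i = zpt n (t * s) mu i.
Proof.
move=> lt_i; congr zfun; rewrite /gridx (_ : n.+1 - i.+1 = (n - i.+1).+1)%N; last by lia.
by rewrite exprS; ring.
Qed.

Lemma zpt_last n s mu : mu n = 0%N -> zpt n.+1 s mu n = zfun s.
Proof. by move=> h; rewrite /zpt /gridx h subnn !expr0 !mul1r. Qed.

Lemma zpt_addcol n s mu i : (i < n)%N ->
  zpt n s (addcol n mu) i = zpt n (q * s) mu i.
Proof. by move=> h; congr zfun; rewrite /gridx /addcol h exprS; ring. Qed.

Lemma eq_zpt n s mu mu' i : mu =1 mu' -> zpt n s mu i = zpt n s mu' i.
Proof. by rewrite /zpt /gridx => ->. Qed.

Definition gev n s mu (f : {mpoly K[n]}) := f.@[fun i : 'I_n => zpt n s mu i].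

Lemma gev_restr n s mu (f : {mpoly K[n.+1]}) : mu n = 0%N ->
  gev (t * s) mu (restr (zfun s) f) = gev s mu f.
Proof.
move=> mu0; rewrite /gev -[RHS](@meval_restr _ _ (zfun s)) ?zpt_last //.
by apply: meval_eq => i; rewrite -zpt_widen /= ?ltn_ord.
Qed.

(** Newton interpolation. At the grid points with an empty last row, the last
    variable is z(s), and the other ones form a grid for n - 1 variables and t s. So by
    induction f vanishes where its last variable is z(s), hence is divisible by
    prod_i (z_i - z(s)). At the other points the first column is full; removing it
    amounts to replacing s by q s, and the quotient has smaller degree. *)
Lemma interp_unique n : forall (b : nat -> nat) s (f : {mpoly K[n]}),
    generic s -> f \is symmetric -> bounded (fun A => b #|A|) f ->
    (forall mu, ispart n mu -> (forall k, (k <= n)%N -> (psum mu k <= b k)%N) ->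
       gev s mu f = 0) ->
  f = 0.
Proof.
elim: n => [|n IHn].
  move=> b s f _ _ _ /(_ (fun _ => 0%N)) h.
  have : gev s (fun _ => 0%N) f = 0.
    apply: h => [|k]; first by split.
    by rewrite leqn0 => /eqP ->; rewrite /psum big_ord0.
  by rewrite /gev -[f in f.@[_]]mpolyKC mevalC => h0; rewrite -[f]mpolyKC h0 mpolyC0.
have r0 b s (f : {mpoly K[n.+1]}) : generic s -> f \is symmetric -> bounded (fun A => b #|A|) f ->
    (forall mu, ispart n.+1 mu ->
       (forall k, (k <= n.+1)%N -> (psum mu k <= b k)%N) -> gev s mu f = 0) ->
    restr (zfun s) f = 0.
  move=> gs sf bf vf.
  have bf' := @restr_bounded _ _ _ (zfun s) _ bf.
  apply: (IHn (fun k => minn (b k) (b k.+1)) _ _ (generic_t gs) (restr_sym (zfun s) sf) bf').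
  move=> mu pmu hmu; have mu0 : mu n = 0%N by case: pmu => _; apply.
  rewrite gev_restr //; apply: vf.
    by split; case: pmu => // h1 h2 i /ltnW; apply: h2.
  move=> k; rewrite leq_eqVlt => /predU1P[->|/hmu]; last by rewrite leq_min => /andP[].
  by rewrite psum_recr mu0 addn0; have := hmu _ (leqnn n); rewrite leq_min => /andP[].
(* b n.+1 bounds the total degree, which drops by n.+1 at each division *)
move=> b; move: {2}(b n.+1) (leqnn (b n.+1)) => N.
elim: N b => [|N IHN] b bN s f gs sf bf vf;
  have [g [sg bg fg [g0 gn] _]] := factor_restr sf bf (r0 _ _ _ gs sf bf vf);
  have [/g0 //|/gn hk] := eqVneq g 0;
  have hn := hk _ (leqnn _); first by lia.
apply: g0; apply: (IHN (fun k => b k - k)%N _ (q * s)) => //.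
- by lia.
- exact: generic_q.
move=> mu pmu hmu; have := vf _ (ispart_addcol pmu).
rewrite /gev fg => /(_ _)/wrap[].
  move=> k kn; rewrite psum_addcol //; have := hmu _ kn; have := hk _ kn; lia.
move/eqP; rewrite mulf_eq0 => /orP[/prodf_eq0[i _]|/eqP <-]; last first.
  by apply: meval_eq => i; rewrite zpt_addcol.
by rewrite subr_eq0 (negPf (zpt_base gs _ _)) // /addcol ltn_ord.
Qed.

Definition pmnm n mu : 'X_{1..n} := [multinom mu (nat_of_ord i) | i < n].

Definition colsize n mu j : nat := (\sum_(i < n) (j < mu i))%N.

(** One factor for each box (i, j). The recursion of [interp_unique] divides by
    z_i - z(s) after s has been multiplied by t for each row that misses column j and by
    q for each previous column. *)
Definition diagval n s la : K :=
  \prod_(i < n) \prod_(j < la i) (zpt n s la i - zfun (q ^+ j * t ^+ (n - colsize n la j) * s)).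

Lemma colsize_le n la j : (colsize n la j <= n)%N.
Proof.
rewrite -[leqRHS](card_ord n) -sum1_card; apply: leq_sum => i _.
by case: (_ < _)%N.
Qed.

Lemma diagval_last n s la : la n = 0%N -> diagval n.+1 s la = diagval n (t * s) la.
Proof.
move=> l0; rewrite /diagval big_ord_recr /= l0 big_ord0 mulr1.
apply: eq_bigr => i _; apply: eq_bigr => j _.
rewrite zpt_widen ?ltn_ord //; congr (_ - zfun _).
rewrite /colsize big_ord_recr /= l0 addn0 subSn ?colsize_le // exprS; ring.
Qed.

Lemma diagval_addcol n s la : diagval n s (addcol n la) =
  \prod_(i < n) (zpt n s (addcol n la) i - zfun s) * diagval n (q * s) la.
Proof.
have cj j : colsize n (addcol n la) j.+1 = colsize n la j.
  by apply: eq_bigr => i _; rewrite /addcol ltn_ord.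
have c0 : colsize n (addcol n la) 0 = n.
  rewrite -[RHS](card_ord n) -sum1_card; apply: eq_bigr => i _.
  by rewrite /addcol ltn_ord.
rewrite /diagval -big_split /=; apply: eq_bigr => i _.
have -> : addcol n la i = (la i).+1 by rewrite /addcol ltn_ord.
rewrite big_ord_recl /= c0 subnn !expr0 !mul1r; congr (_ * _).
apply: eq_bigr => j _; rewrite zpt_addcol ?ltn_ord // /bump leq0n add1n cj.
by congr (_ - zfun _); rewrite exprS; ring.
Qed.

Lemma eq_diagval n s la la' : la =1 la' -> diagval n s la = diagval n s la'.
Proof.
move=> e; apply: eq_bigr => i _; rewrite e; apply: eq_bigr => j _.
rewrite (eq_zpt _ _ _ e) /colsize; congr (_ - zfun (_ * _ ^+ (_ - _) * _)).
by apply: eq_bigr => k _; rewrite e.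
Qed.

Lemma eq_gev n s la la' (f : {mpoly K[n]}) : la =1 la' -> gev s la f = gev s la' f.
Proof. by move=> e; apply: meval_eq => i; apply: eq_zpt. Qed.

(** The recursion of [interp_unique] followed along la: while the last row is empty,
    the last variable is specialised, which preserves the leading coefficient; otherwise
    a full column is divided out, and its boxes contribute their factors. *)
Lemma interp_value n : forall la s (f : {mpoly K[n]}),
    generic s -> ispart n la -> f \is symmetric ->
    bounded (fun A => psum la #|A|) f ->
    (forall mu, ispart n mu -> (forall k, (k <= n)%N -> (psum mu k <= psum la k)%N) ->
       ~ (mu =1 la) -> gev s mu f = 0) ->
  gev s la f = f@_(pmnm n la) * diagval n s la.
Proof.
elim: n => [|n IHn] la.
  move=> s f _ _ _ _ _; rewrite /diagval big_ord0 mulr1 /gev.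
  by rewrite -[f in f.@[_]]mpolyKC mevalC; congr (_@__); apply/mnmP => -[].
have last s (f : {mpoly K[n.+1]}) la0 : la0 n = 0%N ->
    generic s -> ispart n.+1 la0 -> f \is symmetric ->
    bounded (fun A => psum la0 #|A|) f ->
    (forall mu, ispart n.+1 mu ->
       (forall k, (k <= n.+1)%N -> (psum mu k <= psum la0 k)%N) ->
       ~ (mu =1 la0) -> gev s mu f = 0) ->
    gev s la0 f = f@_(pmnm n.+1 la0) * diagval n.+1 s la0.
  move=> lan gs pla sf bf vf.
  have pla' : ispart n la0.
    case: pla => h1 h2; split=> // i; rewrite leq_eqVlt => /predU1P[<- //|]; exact: h2.
  have ple k : minn (psum la0 k) (psum la0 k.+1) = psum la0 k.
    by apply/minn_idPl; rewrite psum_recr leq_addr.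
  have degE : mdeg (pmnm n la0) = psum la0 n.
    by rewrite mdegE; apply: eq_bigr => i _; rewrite mnmE.
  have lanE : psum la0 n.+1 = psum la0 n by rewrite psum_recr lan addn0.
  rewrite -gev_restr // (IHn _ _ _ (generic_t gs) pla' (restr_sym _ sf)) ?diagval_last //.
  - congr (_ * _); rewrite (mcoeff_restr _ bf) ?degE ?lanE //.
    congr (_@__); apply/mnmP => i; case: (ord_max_or i) => [->|[j ->]].
      by rewrite mnmwiden_ordmax mnmE.
    by rewrite mnmwiden_widen !mnmE.
  - by apply: boundedW (@restr_bounded _ _ _ (zfun s) _ bf) => A; rewrite /= ple.
  move=> mu pmu hmu nmu; have mu0 : mu n = 0%N by case: pmu => _; apply.
  rewrite gev_restr // vf //.
    by case: pmu => h1 h2; split=> // i /ltnW; apply: h2.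
  move=> k; rewrite leq_eqVlt => /predU1P[->|/hmu //].
  by rewrite psum_recr mu0 addn0 lanE hmu.
move: {2}(la 0%N) (leqnn (la 0%N)) => N.
elim: N la => [|N IHN] la laN s f gs pla sf bf vf;
  have [lan|lan] := posnP (la n); do ?[exact: last].
  by have := ispart_le pla (leq0n n); lia.
have pos i : (i < n.+1)%N -> (0 < la i)%N.
  by rewrite ltnS => /(ispart_le pla); apply: leq_trans.
have ledel k : (k <= n.+1)%N -> psum la k = (psum (delcol la) k + k)%N.
  by move=> kn; rewrite -(psum_addcol _ kn); apply: eq_psum => i; rewrite (delcolK pla).
(* the last part of la is positive, so f vanishes at every grid point with an empty last row *)
have r0 : restr (zfun s) f = 0.
  have bf' := @restr_bounded _ _ _ (zfun s) _ bf.
  apply: (interp_unique (generic_t gs) (restr_sym (zfun s) sf)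
    (b := fun k => minn (psum la k) (psum la k.+1)) bf').
  move=> mu pmu hmu; have mu0 : mu n = 0%N by case: pmu => _; apply.
  rewrite gev_restr // vf //.
  - by case: pmu => h1 h2; split=> // i /ltnW; apply: h2.
  - move=> k; rewrite leq_eqVlt => /predU1P[->|/hmu]; last by rewrite leq_min => /andP[].
    by rewrite psum_recr mu0 addn0; have := hmu _ (leqnn n); rewrite leq_min => /andP[].
  by move=> /(_ n); lia.
have [g [sg bg fg _ gc]] := factor_restr sf bf r0.
have pdel := ispart_delcol pla.
have {}bg : bounded (fun A => psum (delcol la) #|A|) g.
  apply: boundedW bg => A; rewrite ledel ?addnK //.
  by rewrite -[leqRHS](card_ord n.+1) max_card.
have gevE mu : gev s (addcol n.+1 mu) f =
    \prod_(i < n.+1) (zpt n.+1 s (addcol n.+1 mu) i - zfun s) * gev (q * s) mu g.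
  rewrite /gev fg; congr (_ * _); apply: meval_eq => i.
  by rewrite zpt_addcol ?ltn_ord.
rewrite -(eq_gev _ _ (delcolK pla pos)) -(eq_diagval _ _ (delcolK pla pos)) diagval_addcol.
rewrite gevE mulrCA; congr (_ * _).
rewrite (IHN _ _ (q * s)) //.
- congr (_ * _); rewrite gc; last first.
    by rewrite ledel // -ledel //; apply: leq_sum => i _; rewrite mnmE /delcol prednK ?pos.
  by congr (_@__); apply/mnmP => i; rewrite mnmDE !mnmE /delcol addn1 prednK ?pos.
- by rewrite /delcol; lia.
- exact: generic_q.
move=> mu pmu hmu nmu; have := vf _ (ispart_addcol pmu).
rewrite gevE => /(_ _ _)/wrap[].
- by move=> k kn; rewrite psum_addcol // ledel // leq_add2r hmu.
- move=> e; apply: nmu => i; have := e i; rewrite -(delcolK pla pos i) /addcol.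
  case: ltnP => [_ [//]|ni _]; rewrite /delcol.
  by case: pmu pla => _ -> // [_ ->].
move/eqP; rewrite mulf_eq0 => /orP[/prodf_eq0[i _]|/eqP //].
by rewrite subr_eq0 (negPf (zpt_base gs _ _)) // /addcol ltn_ord.
Qed.

End Grid.

(** * Alternants and the Weyl denominator *)

Section Chebyshev.
Variables (K : fieldType) (c : K).

Fixpoint cheb2 (k : nat) : {poly K} * {poly K} :=
  if k is k'.+1 then let: (u, v) := cheb2 k' in (v, 'X * v - c *: u) else (0, 1).

(** Chebyshev polynomials of the second kind: [chebUE] shows that chebU l, taken at
    x + c / x, is the quotient of x^l - (c / x)^l by x - c / x. *)
Definition chebU (l : int) : {poly K} :=
  match l with Posz k => (cheb2 k).1 | Negz k => - c ^- k.+1 *: (cheb2 k.+1).1 end.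

Lemma cheb2E k : c != 0 -> forall x, x != 0 ->
  x ^+ k - (c / x) ^+ k = (x - c / x) * (cheb2 k).1.[x + c / x] /\
  x ^+ k.+1 - (c / x) ^+ k.+1 = (x - c / x) * (cheb2 k).2.[x + c / x].
Proof.
move=> nc x nx; elim: k => [|k [IH1 IH2]] /=.
  by rewrite horner0 mulr0 !expr0 subrr hornerC mulr1 !expr1.
case: (cheb2 k) IH1 IH2 => u v /= IH1 IH2; split=> //.
rewrite !hornerE mulrBr mulrCA -IH2 mulrCA -IH1 !exprS.
by field.
Qed.

Lemma chebUE l x : c != 0 -> x != 0 ->
  x ^ l - (c / x) ^ l = (x - c / x) * (chebU l).[x + c / x].
Proof.
move=> nc nx; case: l => k /=; first by rewrite -!exprnP; case: (cheb2E k nc nx).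
rewrite hornerZ mulrCA -(cheb2E k.+1 nc nx).1 NegzE -!exprnN expr_div_n.
by field; rewrite !expf_neq0.
Qed.

Lemma size_cheb2 k : (size (cheb2 k).1 <= k)%N /\ (size (cheb2 k).2 <= k.+1)%N.
Proof.
elim: k => [|k [h1 h2]] /=; first by rewrite size_poly0 size_poly1.
case: (cheb2 k) h1 h2 => u v /= h1 h2; split=> //.
rewrite (leq_trans (size_polyD _ _)) // geq_max size_polyN.
apply/andP; split; last by rewrite (leq_trans (size_scale_leq _ _)) // ltnW // ltnW.
rewrite mulrC.
have [->|nv] := eqVneq v 0; first by rewrite mul0r size_poly0.
by rewrite size_mulX.
Qed.

Lemma size_chebU l : (size (chebU l) <= `|l|)%N.
Proof.
case: l => k; first exact: (size_cheb2 k).1.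
exact: leq_trans (size_scale_leq _ _) (size_cheb2 k.+1).1.
Qed.

End Chebyshev.

Section Alternant.
Variables (K : fieldType) (n : nat).
Implicit Types (A : {set 'I_n}) (p : {mpoly K[n]}).

(** The degree of the Vandermonde product in the variables of A. *)
Definition npairs A : nat :=
  (\sum_(i < n) \sum_(j < n | (i < j)%N) ((i \in A) || (j \in A)))%N.

Lemma npairs_double A : (npairs A).*2 =
  (\sum_(i < n) \sum_(j < n | i != j) ((i \in A) || (j \in A)))%N.
Proof.
rewrite -addnn {2}/npairs.
rewrite (eq_bigr (fun i : 'I_n => \sum_(j < n) (i < j) * ((i \in A) || (j \in A))))%N; last first.
  by move=> i _; rewrite big_mkcond /=; apply: eq_bigr => j _; case: ifP; rewrite ?mul1n.
rewrite exchange_big -big_split /=; apply: eq_bigr => i _.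
rewrite [X in (X + _)%N]big_mkcond -big_split [RHS]big_mkcond /=; apply: eq_bigr => j _.
rewrite -val_eqE /= neq_ltn orbC.
by case: ltngtP; rewrite ?mul1n ?mul0n ?addn0 // orbC.
Qed.

Lemma npairs_preim A (w : 'S_n) : npairs [set i | w i \in A] = npairs A.
Proof.
apply: double_inj; rewrite !npairs_double [RHS](reindex_inj (@perm_inj _ w)) /=.
apply: eq_bigr => i _; rewrite [RHS](reindex_inj (@perm_inj _ w)) /=.
by apply: eq_big => [j|j _]; rewrite ?(inj_eq perm_inj) // !inE.
Qed.

(** Multiplying the variables of A by a new variable turns the degree in them into
    the degree of a univariate polynomial, which is additive on products. *)
Definition scaleA A (p : {mpoly K[n]}) : {poly {mpoly K[n]}} :=
  mmap (polyC \o @mpolyC n K)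
    (fun i => if i \in A then 'X * ('X_i)%:P else ('X_i)%:P) p.

Lemma scaleAM A : {morph scaleA A : p r / p * r}.
Proof. exact: rmorphM. Qed.

Lemma scaleAX A m : scaleA A 'X_[m] = ('X_[m])%:P * 'X^(\sum_(i in A) m i).
Proof.
rewrite /scaleA mmapX /mmap1 mpolyXE_id rmorph_prod /= -prodrXr big_mkcond /=.
rewrite [X in _ * X]big_mkcond -big_split /=; apply: eq_bigr => i _.
by case: (i \in A); rewrite ?mulr1 ?exprMn rmorphXn //= mulrC.
Qed.

Lemma scaleAE A p : scaleA A p =
  \sum_(m <- msupp p) (p@_m *: 'X_[m])%:P * 'X^(\sum_(i in A) m i).
Proof.
rewrite {1}[p]mpolyE /scaleA raddf_sum /=; apply: eq_bigr => m _.
rewrite mmapZ -/(scaleA A _) scaleAX -mul_mpolyC polyCM mulrA; congr (_ * _).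
Qed.

Lemma coef_scaleA A p d m :
  ((scaleA A p)`_d)@_m = if (\sum_(i in A) m i == d)%N then p@_m else 0.
Proof.
rewrite scaleAE coef_sum raddf_sum /=.
rewrite (eq_bigr (fun m' => if (\sum_(i in A) m i == d)%N
   then (p@_m' *: 'X_[m'])@_m else 0)); last first.
  move=> m' _; rewrite coefCM coefXn mulr_natr mcoeffMn mcoeffZ mcoeffX.
  case: (m' =P m) => [->|_]; first by rewrite eq_sym; case: ifP.
  by rewrite mulr0 mul0rn if_same.
case: ifP => _; last by rewrite big1.
by rewrite [in RHS](mpolyE p) raddf_sum.
Qed.

Lemma scaleA_bound A p d :
  (size (scaleA A p) <= d.+1)%N <-> forall m, m \in msupp p -> (\sum_(i in A) m i <= d)%N.
Proof.
split=> [h m|h].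
  rewrite mcoeff_msupp leqNgt => nz; apply/negP => lt.
  have := coef_scaleA A p (\sum_(i in A) m i)%N m; rewrite eqxx nth_default.
    by rewrite mcoeff0 => e; rewrite -e eqxx in nz.
  exact: leq_trans h lt.
apply/leq_sizeP => j dj; apply/mpolyP => m; rewrite coef_scaleA mcoeff0.
case: eqP => // e; apply/eqP; rewrite mcoeff_eq0; apply/negP => /h.
by rewrite e leqNgt dj.
Qed.

Lemma scaleA_eq0 A p : (scaleA A p == 0) = (p == 0).
Proof.
apply/eqP/eqP => [h|->]; last by rewrite /scaleA mmap0.
apply/mpolyP => m; have := coef_scaleA A p (\sum_(i in A) m i)%N m.
by rewrite h coef0 !mcoeff0 eqxx.
Qed.

Definition vand : {mpoly K[n]} := \det (Vandermonde n (\row_j ('X_j : {mpoly K[n]}))).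

Lemma vandE : vand = \prod_(i < n) \prod_(j < n | (i < j)%N) ('X_j - 'X_i).
Proof.
rewrite /vand det_Vandermonde; apply: eq_bigr => i _; apply: eq_bigr => j _.
by rewrite !mxE.
Qed.

Lemma XsubX_neq0 (i j : 'I_n) : i != j -> 'X_j - 'X_i != 0 :> {mpoly K[n]}.
Proof.
move=> ij; apply/eqP => /(congr1 (mcoeff U_(j))).
rewrite mcoeffB !mcoeffXU eqxx (negPf ij) subr0 mcoeff0 => /eqP.
by rewrite oner_eq0.
Qed.

Lemma vand_neq0 : vand != 0.
Proof.
rewrite vandE; apply/prodf_neq0 => i _; apply/prodf_neq0 => j ij.
by apply: XsubX_neq0; rewrite neq_ltn ij.
Qed.

Lemma size_scaleA_vand A : size (scaleA A vand) = (npairs A).+1.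
Proof.
have F (i j : 'I_n) : i != j ->
    size (scaleA A ('X_j - 'X_i)) = ((i \in A) || (j \in A)).+1.
  move=> ij; rewrite /scaleA mmapB !mmapX !mmap1U.
  have nx k : 'X_k != 0 :> {mpoly K[n]}.
    by rewrite -msupp_eq0 msuppX.
  have sz (u v : {mpoly K[n]}) : u != 0 -> size ('X * u%:P + v%:P) = 2.
    by move=> nu; rewrite mulrC size_MXaddC polyC_eq0 (negPf nu) /= size_polyC nu.
  case: (i \in A); case: (j \in A) => /=.
  - by rewrite -mulrBr -polyCB -[_ * _]addr0 -[0]polyC0 sz // XsubX_neq0.
  - by rewrite addrC -mulrN -polyCN sz // oppr_eq0.
  - by rewrite -polyCN sz.
  - by rewrite -polyCB size_polyC XsubX_neq0.
rewrite vandE /scaleA rmorph_prod /=.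
rewrite (eq_bigr (fun i : 'I_n => \prod_(j < n | (i < j)%N) scaleA A ('X_j - 'X_i))); last first.
  by move=> i _; rewrite rmorph_prod.
have nz (i j : 'I_n) : (i < j)%N -> scaleA A ('X_j - 'X_i) != 0.
  by move=> ij; rewrite scaleA_eq0 XsubX_neq0 // neq_ltn ij.
have S (I : Type) (r : seq I) (P : pred I) (f : I -> {poly {mpoly K[n]}}) (N : I -> nat) :
    (forall i, P i -> size (f i) = (N i).+1) ->
    size (\prod_(i <- r | P i) f i) = (\sum_(i <- r | P i) N i).+1.
  move=> h; elim: r => [|i r IHr]; first by rewrite !big_nil size_poly1.
  rewrite !big_cons; case Pi: (P i) => //.
  rewrite size_mul -?size_poly_eq0 ?IHr ?h // addnS /=.
  by rewrite addSn.
rewrite (S _ _ _ _ (fun i : 'I_n => \sum_(j < n | (i < j)%N) ((i \in A) || (j \in A)))%N) //.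
move=> i _; rewrite (S _ _ _ _ (fun j : 'I_n => ((i \in A) || (j \in A)) : nat)) // => j ij.
by rewrite F // neq_ltn ij.
Qed.

End Alternant.

(** Each p_i can be replaced by its remainder modulo prod_j (X - f_j), of degree less
    than n, without changing its values at the f_j. So det (p_i(f_j)) is the Vandermonde
    determinant times the determinant of the coefficients of the remainders. *)
Section GenericAlternant.
Variables (R : comNzRingType) (n : nat) (f : 'I_n -> R).

Let chi : {poly R} := \prod_(j < n) ('X - (f j)%:P).

Fact chi_monic : chi \is monic.
Proof. by apply: monic_prod => i _; apply: monicXsubC. Qed.

Definition altquo (p : 'I_n -> {poly R}) : R :=
  \det (\matrix_(i < n, a < n) (Pdiv.Ring.rmodp (p i) chi)`_a).

Lemma alternant_quo (p : 'I_n -> {poly R}) :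
  \det (Vandermonde n (\row_j f j)) * altquo p
  = \det (\matrix_(i < n, j < n) (p i).[f j]).
Proof.
rewrite mulrC -det_mulmx; congr (\det _); apply/matrixP => i j; rewrite !mxE.
have sz : (size (Pdiv.Ring.rmodp (p i) chi) <= n)%N.
  have szc : size chi = n.+1.
    by rewrite /chi size_prod_XsubC /index_enum -enumT size_enum_ord.
  by have := Pdiv.Ring.ltn_rmodpN0 (p i) (monic_neq0 chi_monic); rewrite szc ltnS.
rewrite [in RHS](Pdiv.RingMonic.rdivp_eq chi_monic (p i)) hornerD hornerM.
have -> : chi.[f j] = 0.
  by rewrite /chi horner_prod (bigD1 j isT) hornerXsubC subrr; apply: mul0r.
rewrite mulr0 add0r (horner_coef_wide _ sz).
by apply: eq_bigr => a _; rewrite !mxE.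
Qed.
End GenericAlternant.

Lemma size_mul_bound (R : idomainType) (p r : {poly R}) a d :
  size p = a.+1 -> (size (p * r)%R <= (d + a).+1)%N -> (size r <= d.+1)%N.
Proof.
move=> pa; have [->|nr] := eqVneq r 0; first by rewrite size_poly0.
have np : p != 0 by rewrite -size_poly_eq0 pa.
by rewrite size_mul // pa addSn /= addnC -addSn leq_add2r.
Qed.

Section PolyAt.
Variables (K : fieldType) (n : nat).
Local Notation MP := {mpoly K[n]}.
Implicit Types (A : {set 'I_n}).

Definition polyat (p : {poly K}) (j : 'I_n) : MP :=
  \sum_(a < size p) p`_a *: 'X_j ^+ a.

Lemma polyatE p j : polyat p j = (map_poly (@mpolyC n K) p).['X_j].
Proof.
rewrite (horner_coef_wide _ (size_poly _ _)).
by apply: eq_bigr => a _; rewrite coef_map /= mul_mpolyC.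
Qed.

Lemma meval_polyat p j v : (polyat p j).@[v] = p.[v j].
Proof.
rewrite /polyat raddf_sum horner_coef /=; apply: eq_bigr => a _.
by rewrite mevalZ rmorphXn /= mevalXU.
Qed.

Lemma msym_polyat (s : 'S_n) p j : msym s (polyat p j) = polyat p (s j).
Proof.
rewrite /polyat raddf_sum; apply: eq_bigr => a _ /=.
by rewrite msymZ rmorphXn /= /msym mmapX mmap1U.
Qed.

Lemma bounded_polyat (p : {poly K}) j :
  bounded (fun A => (j \in A) * (size p).-1)%N (polyat p j).
Proof.
apply: bounded_sum => a _; apply: boundedZ.
apply: (@boundedW _ _ (fun A => a * (j \in A))%N) => [A|].
  rewrite mulnC leq_mul2l.
  by apply/orP; right; have := ltn_ord a; lia.
by apply: boundedXn (@boundedXU _ _ j).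
Qed.

End PolyAt.

Section Weyl.
Variables (K : fieldType) (n : nat) (c : K).
Hypothesis nc : c != 0.
Implicit Types (x y : 'I_n -> K) (l : {ffun 'I_n -> int}) (A : {set 'I_n}).
Local Notation MP := {mpoly K[n]}.

Definition flip (e : {ffun 'I_n -> bool}) x (i : 'I_n) : K :=
  if e i then c / x i else x i.

Definition mono l x : K := \prod_i x i ^ l i.

Definition signf (e : {ffun 'I_n -> bool}) : K := \prod_i (-1) ^+ e i.

Section OneAlternant.
Variable l : {ffun 'I_n -> int}.

Definition altM : MP := \det (\matrix_(i < n, j < n) polyat (chebU c (l i)) j).
Definition altR : MP :=
  altquo (fun j : 'I_n => 'X_j : MP) (fun i => map_poly (@mpolyC n K) (chebU c (l i))).

Lemma vand_altR : vand K n * altR = altM.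
Proof.
rewrite /vand /altR alternant_quo; congr (\det _); apply/matrixP => i j.
by rewrite !mxE polyatE.
Qed.

Lemma msym_altM (s : 'S_n) : msym s altM = (-1) ^+ s * altM.
Proof.
rewrite /altM -det_map_mx.
have -> : map_mx (msym s) (\matrix_(i < n, j < n) polyat (chebU c (l i)) j) =
    col_perm s (\matrix_(i < n, j < n) polyat (chebU c (l i)) j).
  by apply/matrixP => i j; rewrite !mxE msym_polyat.
by rewrite col_permE det_mulmx det_perm odd_permV mulrC.
Qed.

Lemma msym_vand (s : 'S_n) : msym s (vand K n) = (-1) ^+ s * vand K n.
Proof.
rewrite /vand -det_map_mx.
have -> : map_mx (msym s) (Vandermonde n (\row_j ('X_j : MP))) =
    col_perm s (Vandermonde n (\row_j ('X_j : MP))).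
  by apply/matrixP => i j; rewrite !mxE rmorphXn /= /msym mmapX mmap1U.
by rewrite col_permE det_mulmx det_perm odd_permV mulrC.
Qed.

Lemma altR_sym : altR \is symmetric.
Proof.
apply/issymP => s; apply: (mulfI (vand_neq0 K n)).
apply: (mulfI (_ : (-1) ^+ s != 0)); first by rewrite signr_eq0.
by rewrite [LHS]mulrA -msym_vand -msymM vand_altR msym_altM.
Qed.

(** The determinant has degree at most b + npairs in the variables of A, the
    Vandermonde factor has degree exactly npairs in them, and degrees are additive. *)
Lemma altR_bounded (b : nat -> nat) :
    (forall A, (\sum_(i in A) `|l i| <= b #|A| + #|A| + npairs A)%N) ->
  bounded (fun A => b #|A|) altR.
Proof.
move=> hl m mR A.
have nR : altR != 0 by apply: contraTneq mR => ->; rewrite msupp0.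
move: m mR; apply/scaleA_bound.
have sz : (size (scaleA A (vand K n * altR)) <= (b #|A| + npairs A).+1)%N.
  rewrite vand_altR; apply/scaleA_bound => m mG.
  have [/existsP[i /eqP li]|/existsPn nl] := boolP [exists i, l i == 0].
    move: mG; rewrite (_ : altM = 0) ?msupp0 // /altM (expand_det_row _ i) big1 // => j _.
    by rewrite !mxE li /= /polyat size_poly0 big_ord0 mul0r.
  move: m mG A {nR}.
  suff: bounded (fun A => b #|A| + npairs A)%N altM by [].
  rewrite /altM /determinant; apply: bounded_sum => w _.
  apply: (@boundedW _ _ (fun A => 0 + \sum_(i < n) (w i \in A) * (size (chebU c (l i))).-1)%N).
    move=> A; rewrite add0n.
    have lA : (\sum_(i < n) (w i \in A) * (size (chebU c (l i))).-1 + #|A| <=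
       \sum_(i in [set i | w i \in A]) `|l i|)%N.
      rewrite -sum1_card [X in (_ + X)%N](reindex_inj (@perm_inj _ w)) /= [X in (_ + X)%N]big_mkcond.
      rewrite -big_split /= [leqRHS]big_mkcond /=; apply: leq_sum => i _; rewrite inE.
      case: (w i \in A) => //=.
      move: (size_chebU c (l i)) (nl i); rewrite -absz_eq0.
      by move: (size _) (absz (l i)) => u v; lia.
    have := hl [set i | w i \in A]; rewrite npairs_preim.
    have -> : #|[set i | w i \in A]| = #|A|.
      by rewrite -sum1dep_card -[RHS]sum1_card [RHS](reindex_inj (@perm_inj _ w)).
    by move: lA; lia.
  rewrite -(rmorph_sign (@mpolyC n K)).
  apply: boundedM; first exact: boundedC.
  by apply: bounded_prod => i _; rewrite mxE; apply: bounded_polyat.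
move: sz; rewrite scaleAM.
by apply: size_mul_bound; apply: size_scaleA_vand.
Qed.

(** Weyl character formula of type C: the alternating sum of the monomial with
    exponent l over the permutations and the flips x_i -> c / x_i, divided by the Weyl
    denominator, is a symmetric polynomial in the x_i + c / x_i. *)
Lemma meval_altR x : (forall i, x i != 0) ->
  \prod_(i < n) \prod_(j < n | (i < j)%N) (zfun c (x j) - zfun c (x i))
    * \prod_(i < n) (x i - c / x i) * altR.@[fun i => zfun c (x i)]
  = \sum_(e : {ffun 'I_n -> bool}) signf e *
      \sum_(w : 'S_n) (-1) ^+ w * \prod_j flip e x j ^ l (w j).
Proof.
move=> nx; set z := fun i => zfun c (x i).
have -> : \prod_(i < n) \prod_(j < n | (i < j)%N) (zfun c (x j) - zfun c (x i)) =
    (vand K n).@[z].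
  rewrite vandE rmorph_prod; apply: eq_bigr => i _; rewrite rmorph_prod.
  by apply: eq_bigr => j _; rewrite /= mevalB !mevalXU.
rewrite mulrAC -mevalM vand_altR /altM -det_map_mx -det_tr /determinant mulr_suml.
under [RHS]eq_bigr => e _ do rewrite mulr_sumr.
rewrite exchange_big /=; apply: eq_bigr => w _.
rewrite -mulrA -big_split /= (eq_bigr (fun j => \sum_(b : bool)
   (-1) ^+ b * (if b then c / x j else x j) ^ l (w j))); last first.
  move=> j _; rewrite !mxE meval_polyat mulrC -chebUE // big_bool /=; ring.
rewrite bigA_distr_bigA /= mulr_sumr; apply: eq_bigr => e _.
by rewrite big_split /= mulrCA.
Qed.

End OneAlternant.
End Weyl.

(** * Antisymmetrisation over permutations and flips *)

Section LaurentFunctions.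
Variables (K : fieldType) (n : nat).
Implicit Types (x y : 'I_n -> K) (l : {ffun 'I_n -> int}) (A : {set 'I_n}).
Implicit Types (g h : ('I_n -> K) -> K) (B : {set 'I_n} -> nat).

(** Laurent polynomials are treated as functions of nonzero arguments, which lets
    them be flipped and multiplied by composing functions. *)
Definition lbounded B g : Prop :=
  exists2 r : seq (K * {ffun 'I_n -> int}),
    forall p, p \in r -> forall A, (\sum_(i in A) `|p.2 i| <= B A)%N
  & forall x, (forall i, x i != 0) -> g x = \sum_(p <- r) p.1 * mono p.2 x.

Lemma lboundedW B B' g : (forall A, (B A <= B' A)%N) -> lbounded B g -> lbounded B' g.
Proof. by move=> le [r h1 h2]; exists r => // p /h1 h A; apply: leq_trans (le A). Qed.

Lemma eq_lbounded B g h : (forall x, (forall i, x i != 0) -> g x = h x) ->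
  lbounded B g -> lbounded B h.
Proof. by move=> e [r h1 h2]; exists r => // x nx; rewrite -e // h2. Qed.

Lemma lboundedC B (a : K) : lbounded B (fun=> a).
Proof.
exists [:: (a, [ffun=> 0] : {ffun 'I_n -> int})] => [p|x nx].
  by rewrite inE => /eqP -> A /=; rewrite big1 // => i _; rewrite ffunE.
by rewrite big_seq1 /mono big1 ?mulr1 // => i _; rewrite ffunE expr0z.
Qed.

Lemma lboundedD B g h : lbounded B g -> lbounded B h -> lbounded B (fun x => g x + h x).
Proof.
move=> [r h1 h2] [r' h1' h2']; exists (r ++ r') => [p|x nx].
  by rewrite mem_cat => /orP[/h1|/h1'].
by rewrite big_cat h2 // h2'.
Qed.

Lemma lboundedM B B' g h : lbounded B g -> lbounded B' h ->
  lbounded (fun A => B A + B' A)%N (fun x => g x * h x).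
Proof.
move=> [r h1 h2] [r' h1' h2'].
pose m (p p' : K * {ffun 'I_n -> int}) : K * {ffun 'I_n -> int} :=
  (p.1 * p'.1, [ffun i => p.2 i + p'.2 i]).
exists [seq m p p' | p <- r, p' <- r'] => [p|x nx].
  case/allpairsP => -[p1 p2] /= [/h1 b1 /h1' b2 ->] A /=.
  apply: leq_trans (leq_add (b1 A) (b2 A)); rewrite -big_split /=.
  by apply: leq_sum => i _; rewrite ffunE; move: (p1.2 i) (p2.2 i) => u v; lia.
rewrite h2 // h2' // big_allpairs_dep /= big_distrlr /=.
apply: eq_bigr => p _; apply: eq_bigr => p' _; rewrite mulrACA; congr (_ * _).
by rewrite /mono -big_split; apply: eq_bigr => i _; rewrite ffunE expfzDr.
Qed.

Lemma lbounded_sum I (r : seq I) (F : I -> ('I_n -> K) -> K) B :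
  (forall i, lbounded B (F i)) -> lbounded B (fun x => \sum_(i <- r) F i x).
Proof.
move=> hF; elim: r => [|i r IHr].
  by apply: eq_lbounded (lboundedC B 0) => x _; rewrite big_nil.
by apply: eq_lbounded (lboundedD (hF i) IHr) => x _; rewrite big_cons.
Qed.

Lemma lbounded_prod I (r : seq I) (P : pred I) (F : I -> ('I_n -> K) -> K)
    (G : I -> {set 'I_n} -> nat) :
  (forall i, P i -> lbounded (G i) (F i)) ->
  lbounded (fun A => \sum_(i <- r | P i) G i A)%N (fun x => \prod_(i <- r | P i) F i x).
Proof.
move=> hF; elim: r => [|i r IHr].
  by apply: eq_lbounded (lboundedC _ 1) => x _; rewrite big_nil.
case Pi: (P i).
  apply: lboundedW (eq_lbounded _ (lboundedM (hF i Pi) IHr)) => [A|x _].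
    by rewrite big_cons Pi.
  by rewrite big_cons Pi.
apply: lboundedW (eq_lbounded _ IHr) => [A|x _]; first by rewrite big_cons Pi.
by rewrite big_cons Pi.
Qed.

Lemma lboundedXn B g k : lbounded B g -> lbounded (fun A => k * B A)%N (fun x => g x ^+ k).
Proof.
move=> hg; elim: k => [|k IHk].
  by apply: eq_lbounded (lboundedC _ 1) => x _; rewrite expr0.
apply: lboundedW (eq_lbounded _ (lboundedM hg IHk)) => [A|x _]; first by rewrite mulSn.
by rewrite exprS.
Qed.

Lemma lboundedX (i : 'I_n) (k : int) :
  lbounded (fun A => (i \in A) * `|k|)%N (fun x => x i ^ k).
Proof.
exists [:: (1, [ffun j => if j == i then k else 0] : {ffun 'I_n -> int})] => [p|x nx].
  rewrite inE => /eqP -> A /=; case: (boolP (i \in A)) => iA.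
    rewrite (bigD1 i) //= ffunE eqxx mul1n big1 ?addn0 // => j /andP[_ /negPf ji].
    by rewrite ffunE ji.
  by rewrite big1 // => j jA; rewrite ffunE; case: eqP jA iA => // -> ->.
rewrite big_seq1 mul1r /mono (bigD1 i) //= ffunE eqxx big1 ?mulr1 // => j /negPf ji.
by rewrite ffunE ji expr0z.
Qed.

Lemma lboundedX1 (i : 'I_n) (a : K) (b : bool) :
  lbounded (fun A => (i \in A) : nat) (fun x => a * (if b then x i else (x i)^-1)).
Proof.
apply: lboundedW (eq_lbounded _ (lboundedM (lboundedC (fun=> 0%N) a)
  (lboundedX i (if b then 1 else -1)))) => [A|x _].
  by case: b; rewrite add0n muln1.
by case: b.
Qed.

End LaurentFunctions.

Section WeylOperator.
Variables (K : fieldType) (n : nat) (c : K).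
Hypothesis nc : c != 0.
Implicit Types (x y : 'I_n -> K) (A : {set 'I_n}).

Lemma meval_msym (w : 'S_n) (p : {mpoly K[n]}) v :
  (msym w p).@[v] = p.@[fun i => v (w i)].
Proof.
have -> : msym w p = p \mPo [tuple 'X_(w i) | i < n].
  by rewrite -[in LHS](comp_mpoly_id (msym w p)) msym_mPo; congr (_ \mPo _);
     apply: eq_from_tnth => i; rewrite !tnth_mktuple.
rewrite comp_mpoly_meval; apply: meval_eq => i.
by rewrite tnth_mktuple mevalXU.
Qed.

(** Add up [meval_altR] over the monomials of g. Since g is already alternating in
    its arguments, the sum over permutations only contributes n!. *)
Lemma weyl_op (b : nat -> nat) (g : ('I_n -> K) -> K) :
    lbounded (fun A => b #|A| + #|A| + npairs A)%N g ->
    (forall (w : 'S_n) y, (forall i, y i != 0) -> g (fun i => y (w i)) = (-1) ^+ w * g y) ->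
  exists R : {mpoly K[n]},
  [/\ R \is symmetric, bounded (fun A => b #|A|) R &
      forall x, (forall i, x i != 0) ->
        \prod_(i < n) \prod_(j < n | (i < j)%N) (zfun c (x j) - zfun c (x i))
          * \prod_(i < n) (x i - c / x i) * R.@[fun i => zfun c (x i)]
        = n`!%:R * \sum_(e : {ffun 'I_n -> bool}) signf K e * g (flip c e x)].
Proof.
move=> [r h1 h2] antig; exists (\sum_(p <- r) p.1 *: altR c p.2); split.
- by apply: rpred_sum => p _; rewrite rpredZ // altR_sym.
- by apply: bounded_sum_seq => p /h1 hp; apply/boundedZ/altR_bounded.
move=> x nx; rewrite raddf_sum /= mulr_sumr.
rewrite (eq_bigr (fun p : K * {ffun 'I_n -> int} => \sum_(e : {ffun 'I_n -> bool})
    p.1 * (signf K e * \sum_(w : 'S_n) (-1) ^+ w *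
      \prod_j flip c e x j ^ p.2 (w j)))); last first.
  by move=> p _; rewrite mevalZ mulrCA meval_altR // mulr_sumr.
rewrite exchange_big mulr_sumr /=; apply: eq_bigr => e _.
have ny i : flip c e x i != 0.
  by rewrite /flip; case: (e i); rewrite ?mulf_neq0 ?invr_eq0.
under eq_bigr => p _ do rewrite mulrCA.
rewrite -mulr_sumr mulrCA; congr (_ * _).
under eq_bigr => p _ do rewrite mulr_sumr.
rewrite exchange_big /= (eq_bigr (fun=> g (flip c e x))); last first.
  move=> w _; rewrite (eq_bigr (fun p => (-1) ^+ w *
      (p.1 * mono p.2 (fun i => flip c e x (w^-1 i)%g)))); last first.
    move=> p _; rewrite mulrCA; congr (_ * (_ * _)).
    rewrite /mono (reindex_inj (@perm_inj _ w^-1%g)) /=.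
    by apply: eq_bigr => i _; rewrite permKV.
  rewrite -mulr_sumr -h2 // antig // odd_permV mulrA -expr2.
  by rewrite sqrr_sign mul1r.
by rewrite sumr_const card_Sn mulr_natl.
Qed.

End WeylOperator.

(** * Extra vanishing *)

Section PairProducts.
Variables (K : fieldType) (n : nat).

Lemma prod_pairs_perm (F : 'I_n -> 'I_n -> K) (w : 'S_n) :
    (forall i j, F i j = F j i) ->
  \prod_(i < n) \prod_(j < n | (i < j)%N) F (w i) (w j) =
  \prod_(i < n) \prod_(j < n | (i < j)%N) F i j.
Proof.
move=> symF; rewrite !pair_big_dep /=.
pose o (p : 'I_n * 'I_n) := if (p.1 < p.2)%N then p else (p.2, p.1).
pose h (s : 'S_n) (p : 'I_n * 'I_n) := o (s p.1, s p.2).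
have Fo p : F (o p).1 (o p).2 = F p.1 p.2.
  by rewrite /o; case: ifP => //= _; rewrite symF.
have lto p : p.1 != p.2 -> ((o p).1 < (o p).2)%N.
  move=> ne; rewrite /o; case: ifP => //= /negbT.
  rewrite -leqNgt leq_eqVlt => /predU1P[/val_inj e|//].
  by rewrite e eqxx in ne.
have hK (s : 'S_n) (p : 'I_n * 'I_n) : (p.1 < p.2)%N -> h s^-1%g (h s p) = p.
  move=> lt; rewrite /h /o /=; case: p lt => i j /= ij.
  by case: (ltnP (s i) (s j)) => _ /=; rewrite !permK ?ij // ltnNge ltnW.
rewrite [RHS](reindex_onto (h w) (h w^-1%g)) /=; last first.
  by move=> p lt; rewrite -{1}[w]invgK hK.
apply: eq_big => [p|p _]; last by rewrite Fo.
apply/idP/andP => [lt|[lt /eqP <-]].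
  by rewrite hK // eqxx lto // (inj_eq perm_inj) /= neq_ltn lt.
apply: lto => /=; rewrite (inj_eq perm_inj).
by rewrite neq_ltn lt.
Qed.

Lemma prod_diff_perm (y : 'I_n -> K) (w : 'S_n) :
  \prod_(i < n) \prod_(j < n | (i < j)%N) (y (w j) - y (w i)) =
  (-1) ^+ w * \prod_(i < n) \prod_(j < n | (i < j)%N) (y j - y i).
Proof.
have V z : \prod_(i < n) \prod_(j < n | (i < j)%N) (z j - z i) =
    \det (Vandermonde n (\row_j (z j : K))).
  rewrite det_Vandermonde; apply: eq_bigr => i _; apply: eq_bigr => j _.
  by rewrite !mxE.
rewrite (V y) (V (fun i => y (w i))).
have -> : Vandermonde n (\row_j y (w j)) = col_perm w (Vandermonde n (\row_j y j)).
  by apply/matrixP => i j; rewrite !mxE.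
by rewrite col_permE det_mulmx det_perm odd_permV mulrC.
Qed.
End PairProducts.

Section Extra.
Variables (K : fieldType) (char0 : [pchar K] =i pred0) (q t c s : K).
Hypothesis gs : generic q t c s.
Variable n : nat.
Let c' := q * c.

Let nq : q != 0. Proof. by case: gs => -[]. Qed.
Let nt : t != 0. Proof. by case: gs => -[]. Qed.
Let ns : s != 0. Proof. by case: gs => -[]. Qed.
Let nc : c != 0. Proof. by case: gs => -[]. Qed.
Let nc' : c' != 0. Proof. exact: mulf_neq0. Qed.

Let gs' : generic q t c' s.
Proof.
split=> //; split=> a b; first by move=> h; apply: (generic_qt gs).
have := generic_s gs (a - 1) b; apply: contra_neq => e.
by apply: (mulfI nq); rewrite -/c' -e expfzDr // exprN1; field.
Qed.

(** With c' = q c, the flip of x_i to c' / x_i replaces x_i + c / x_i by its value at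
    x_i / q, so on the grid it lowers the i-th part by 1. The factors of this kernel
    vanish after a flip that does not lead to a partition: y_i - c' / s if the last
    part is 0, and c' - t y_i y_j if the i-th part equals the next one, which is not
    lowered. The factor y_i - beta serves to kill one chosen coordinate. *)
Definition flipker (beta : K) (f : {mpoly K[n]}) (y : 'I_n -> K) : K :=
  \prod_i ((y i - c' / s) * (y i - beta) / y i)
  * (\prod_(i < n) \prod_(j < n | (i < j)%N) ((c' - t * (y i * y j)) / (y i * y j))
     * \prod_(i < n) \prod_(j < n | (i < j)%N) (y j - y i))
  * f.@[fun i => zfun c (y i)].

Lemma flipker_lbounded b beta f : bounded (fun A => b #|A|) f ->
  lbounded (fun A => b #|A| + #|A| + npairs A)%N (flipker beta f).
Proof.
move=> bf; pose G1 (y : 'I_n -> K) := \prod_i ((y i - c' / s) * (y i - beta) / y i).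
pose G2 (y : 'I_n -> K) := \prod_(i < n) \prod_(j < n | (i < j)%N)
  ((c' - t * (y i * y j)) / (y i * y j) * (y j - y i)).
pose G3 (y : 'I_n -> K) := f.@[fun i => zfun c (y i)].
have X1 i a e : lbounded (fun A : {set 'I_n} => (i \in A) : nat)
   (fun y : 'I_n -> K => a * (if e then y i else (y i)^-1)) by exact: lboundedX1.
have h1 : lbounded (fun A => \sum_(i < n) (i \in A))%N G1.
  apply: lbounded_prod => i _.
  apply: eq_lbounded (lboundedD (lboundedD (X1 i 1 true) (lboundedC _ (- (c' / s + beta))))
    (X1 i (c' / s * beta) false)) => x nx /=.
  by field; rewrite nx ns.
have h2 : lbounded (@npairs n) G2.
  apply: lbounded_prod => i _; apply: lbounded_prod => j ij.
  have wl k a e : k = i \/ k = j ->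
      lbounded (fun A : {set 'I_n} => (i \in A) || (j \in A) : nat)
        (fun y : 'I_n -> K => a * (if e then y k else (y k)^-1)).
    by case=> ->; apply: lboundedW (X1 _ a e) => A; do 2!case: (_ \in _).
  apply: eq_lbounded (lboundedD
    (lboundedD (wl i c' false (or_introl erefl)) (wl j (- c') false (or_intror erefl)))
    (lboundedD (wl i t true (or_introl erefl)) (wl j (- t) true (or_intror erefl)))) => x nx /=.
  by field; rewrite !nx.
have h3 : lbounded (fun A => b #|A|) G3.
  apply: (@eq_lbounded _ _ _ (fun y => \sum_(m <- msupp f)
     if m \in msupp f then f@_m * \prod_i (zfun c (y i)) ^+ m i else 0)) => [x nx|].
    by rewrite /G3 mevalE big_seq [RHS]big_seq; apply: eq_bigr => m ->.
  apply: lbounded_sum => m; case: (boolP (m \in msupp f)) => [/bf hm|_]; last first.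
    exact: lboundedC.
  apply: lboundedW (lboundedM (lboundedC (fun=> 0%N) f@_m)
     (@lbounded_prod _ _ _ _ _ _ (fun i A => m i * (i \in A))%N _)) => [A|i _].
    rewrite add0n; apply: leq_trans (hm A); rewrite [leqRHS]big_mkcond /=.
    by apply: leq_sum => i _; case: (i \in A); rewrite ?muln1 ?muln0.
  apply: (@lboundedXn _ _ (fun A => (i \in A) : nat)).
  apply: eq_lbounded (lboundedD (X1 i 1 true) (X1 i c false)) => x nx /=.
  by rewrite mul1r.
apply: lboundedW (eq_lbounded _ (lboundedM (lboundedM h1 h2) h3)) => [A|x nx].
  rewrite addnC addnA leq_add2r leq_add2l -sum1_card [leqRHS]big_mkcond /=.
  by apply: leq_sum => i _; case: (i \in A).
rewrite /flipker /G1 /G2 /G3; congr (_ * _ * _).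
by rewrite -big_split; apply: eq_bigr => i _; rewrite -big_split.
Qed.

Lemma flipker_perm beta f (w : 'S_n) y : f \is symmetric ->
  flipker beta f (fun i => y (w i)) = (-1) ^+ w * flipker beta f y.
Proof.
move=> /issymP sf; rewrite /flipker.
rewrite -[in LHS](meval_msym w f (fun i => zfun c (y i))) sf prod_diff_perm.
rewrite (@prod_pairs_perm _ _ (fun i j => (c' - t * (y i * y j)) / (y i * y j))); last first.
  by move=> i j; rewrite [y i * y j]mulrC.
rewrite [X in _ = _ * (X * _ * _)](reindex_inj (@perm_inj _ w)) /=.
have aux (A B sg D E : K) : A * (B * (sg * D)) * E = sg * (A * (B * D) * E) by ring.
exact: aux.
Qed.

Definition lower (mu : nat -> nat) (e : {ffun 'I_n -> bool}) (i : nat) : nat :=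
  (mu i - (if insub i is Some j then nat_of_bool (e j) else 0))%N.

Lemma lowerE mu e (i : 'I_n) : lower mu e i = (mu i - e i)%N.
Proof. by rewrite /lower valK. Qed.

Lemma lower_out mu e i : (n <= i)%N -> lower mu e i = mu i.
Proof. by move=> ni; rewrite /lower insubN ?subn0 // -leqNgt. Qed.

(** If lowering the parts marked by e does not lead to a partition, a factor of the
    kernel vanishes; if it does, then f vanishes there. *)
Lemma flipker_vanish beta (f : {mpoly K[n]}) (mu : nat -> nat) (e : {ffun 'I_n -> bool}) :
    ispart n mu -> (exists i, e i) ->
    (forall mu', ispart n mu' -> (forall i, (mu' i <= mu i)%N) ->
       (exists i : 'I_n, (mu' i < mu i)%N) -> gev q t c s mu' f = 0) ->
  flipker beta f (flip c' e (fun i => gridx q t n s mu i)) = 0.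
Proof.
move=> pmu [i0 ei0] vf; set x := fun i : 'I_n => gridx q t n s mu i.
have nx i : x i != 0 by apply: gridx_neq0 gs _ _ _.
(* lowering along e fails to give a partition when a marked part equals the next one, which is
   not marked, or is a last part equal to 0 *)
have [bad|good] := pselect (exists i : 'I_n, e i /\
   ((exists2 j : 'I_n, j = i.+1 :> nat & ~~ e j /\ mu j = mu i)
     \/ (i.+1 = n /\ mu i = 0%N))).
  case: bad => i [ei [[j ji [nej mji]]|[ni mi0]]].
    have ij : (i < j)%N by rewrite ji.
    rewrite /flipker; set F := (X in _ * (X * _) * _).
    suff -> : F = 0 by rewrite mul0r mulr0 mul0r.
    rewrite /F (bigD1 i) //= (bigD1 j) //= /flip ei (negPf nej).
    have xi : x i = t * x j.
      rewrite /x /gridx mji ji (_ : n - i.+1 = (n - i.+2).+1)%N ?exprS; first by ring.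
      by have := ltn_ord j; rewrite ji; lia.
    rewrite (_ : c' - _ = 0) ?mul0r // xi; field.
    by rewrite nt nx.
  rewrite /flipker; set F := (X in X * _ * _).
  suff -> : F = 0 by rewrite !mul0r.
  rewrite /F (bigD1 i) //= /flip ei.
  have -> : x i = s by rewrite /x /gridx mi0 ni subnn !expr0 !mul1r.
  by rewrite subrr !mul0r.
have {}good (i : 'I_n) : e i -> (forall j : 'I_n, j = i.+1 :> nat -> ~~ e j -> (mu j < mu i)%N)
    /\ (i.+1 = n -> (0 < mu i)%N).
  move=> ei; split=> [j ji nej|ni].
    rewrite ltn_neqAle; apply/andP; split; last by rewrite ji (pmu.1 i).
    by apply/eqP => mji; apply: good; exists i; split=> //; left; exists j.
  rewrite lt0n; apply/eqP => mi0; apply: good; exists i; split=> //; right; split=> //.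
have pos (i : 'I_n) : e i -> (0 < mu i)%N.
  move: {2}(n - i)%N (leqnn (n - i)%N) => N; elim: N i => [|N IHN] i iN ei.
    by have := ltn_ord i; lia.
  have [ni|/eqP ni] := eqVneq i.+1 n; first exact: (good _ ei).2.
  have lt : (i.+1 < n)%N by have := ltn_ord i; lia.
  have le : (mu i.+1 <= mu i)%N := pmu.1 i.
  case: (boolP (e (Ordinal lt))) => [ej|nej].
    by apply: leq_trans le; apply: (IHN (Ordinal lt)) => //=; lia.
  by apply: leq_ltn_trans ((good _ ei).1 (Ordinal lt) erefl nej).
have plow : ispart n (lower mu e).
  split=> i; last by move=> ni; rewrite lower_out //; case: pmu => _; apply.
  have [lt|ni] := ltnP i.+1 n; last first.
    by rewrite lower_out //; case: (pmu) => _ ->.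
  pose j := Ordinal lt; pose k := Ordinal (ltnW lt).
  rewrite (lowerE mu e j : lower mu e i.+1 = _) (lowerE mu e k : lower mu e i = _).
  have := pmu.1 i; have := good k; have := pos k.
  case: (e k) => /=; case ej: (e j) => /=; try lia.
  by move=> _ /(_ isT) [/(_ j erefl)]; rewrite ej /= => /(_ isT); lia.
have -> : flipker beta f (flip c' e x) =
    \prod_i ((flip c' e x i - c' / s) * (flip c' e x i - beta) / flip c' e x i)
  * (\prod_(i < n) \prod_(j < n | (i < j)%N)
       ((c' - t * (flip c' e x i * flip c' e x j)) / (flip c' e x i * flip c' e x j))
     * \prod_(i < n) \prod_(j < n | (i < j)%N) (flip c' e x j - flip c' e x i))
  * gev q t c s (lower mu e) f.
  congr (_ * _); apply: meval_eq => i; rewrite /flip /zpt /x /gridx lowerE.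
  case ei: (e i); last by rewrite subn0.
  have := pos i ei; case: (mu i) => // m _; rewrite subSS subn0 exprS /zfun.
  by rewrite /c'; field; rewrite ns nq nc !expf_neq0.
rewrite vf ?mulr0 //.
  by move=> i; rewrite /lower leq_subr.
by exists i0; rewrite lowerE ei0; have := pos _ ei0; lia.
Qed.

Lemma flip0 (x : 'I_n -> K) : flip c' [ffun=> false] x = x.
Proof. by apply: funext => i; rewrite /flip ffunE. Qed.

Lemma psum_sub (mu mu' : nat -> nat) k : (forall i, (mu' i <= mu i)%N) -> (psum mu' k <= psum mu k)%N.
Proof. by move=> h; apply: leq_sum. Qed.

Lemma psum_sub_lt (mu mu' : nat -> nat) (i : 'I_n) : (forall i, (mu' i <= mu i)%N) ->
  (mu' i < mu i)%N -> (psum mu' n < psum mu n)%N.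
Proof.
move=> h lt; rewrite /psum (bigD1 i) //= [ltnRHS](bigD1 i) //=.
by rewrite -addSn leq_add // leq_sum.
Qed.

(** Take beta to be the k-th coordinate of the grid point of la, and let R be the
    quotient of the Weyl sum of the kernel over all flips by the Weyl denominator. At a
    grid point of a partition mu below la the flipped terms involve f at smaller
    partitions, so they vanish, and the unflipped one vanishes because f(z(mu)) = 0, or,
    if mu = la, because of beta. By [interp_unique], now for q c, R is 0. Then, for any
    mu with mu_k < la_k, the Weyl sum at mu being 0 expresses f(z(mu)) through the values
    of f at partitions contained in mu, and induction on |mu| concludes. *)
Lemma interp_extra la (f : {mpoly K[n]}) :
    ispart n la -> f \is symmetric -> bounded (fun A => psum la #|A|) f ->
    (forall mu, ispart n mu -> (forall k, (k <= n)%N -> (psum mu k <= psum la k)%N) ->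
       ~ (mu =1 la) -> gev q t c s mu f = 0) ->
  forall mu (k : 'I_n), ispart n mu -> (mu k < la k)%N -> gev q t c s mu f = 0.
Proof.
move=> pla sf bf vf mu0 k; pose beta := gridx q t n s la k.
have [R [sR bR eR]] := weyl_op nc' (flipker_lbounded beta bf)
  (fun w y _ => flipker_perm beta w y sf).
pose x mu := fun i : 'I_n => gridx q t n s mu i.
have nx mu i : x mu i != 0 by apply: gridx_neq0 gs _ _ _.
(* only the unflipped term survives, by flipker_vanish *)
have key mu : ispart n mu -> (forall mu', ispart n mu' -> (forall i, (mu' i <= mu i)%N) ->
       (exists i : 'I_n, (mu' i < mu i)%N) -> gev q t c s mu' f = 0) ->
    \prod_(i < n) \prod_(j < n | (i < j)%N) (zfun c' (x mu j) - zfun c' (x mu i))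
          * \prod_(i < n) (x mu i - c' / x mu i) * gev q t c' s mu R
    = n`!%:R * flipker beta f (x mu).
  move=> pmu vmu; rewrite /gev eR //; congr (_ * _).
  rewrite (bigD1 [ffun=> false]) //= flip0 /signf big1 ?mul1r; last first.
    by move=> i _; rewrite ffunE.
  rewrite big1 ?addr0 // => e ne; rewrite flipker_vanish ?mulr0 //.
  apply: contrapT => he; case/eqP: ne; apply/ffunP => i; rewrite ffunE.
  by apply/negbTE/negP => ei; apply: he; exists i.
have fact0 : n`!%:R != 0 :> K.
  by move/pcharf0P: char0 => ->; rewrite -lt0n fact_gt0.
have nV mu : \prod_(i < n) \prod_(j < n | (i < j)%N) (zfun c' (x mu j) - zfun c' (x mu i))
          * \prod_(i < n) (x mu i - c' / x mu i) != 0.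
  apply/mulf_neq0; apply/prodf_neq0 => i _; last first.
    have := gridx_prod gs' n mu i i; apply: contra_neq => /eqP.
    rewrite subr_eq0 -/(x mu i) => /eqP e; rewrite [X in X * _]e.
    by rewrite divfK // nx.
  apply/prodf_neq0 => j ij; rewrite subr_eq0 zfun_eq ?nx // negb_or.
  rewrite (gridx_prod gs') andbT; apply/eqP => /(generic_inj gs) [_].
  by have := ltn_ord j; lia.
(* at mu = la the k-th factor y_k - beta vanishes *)
have R0 : R = 0.
  apply: (interp_unique gs' sR bR) => mu pmu hmu.
  have := key mu pmu; move=> /(_ _)/wrap[].
    move=> mu' pmu' hsub [i lt]; apply: vf => //.
      by move=> j jn; apply: leq_trans (hmu _ jn); apply: psum_sub.
    move=> e; have := psum_sub_lt hsub lt; rewrite (eq_psum _ e).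
    by rewrite ltnNge hmu.
  suff -> : flipker beta f (x mu) = 0.
    by rewrite mulr0 => /eqP; rewrite mulf_eq0 (negPf (nV mu)) /= => /eqP.
  have [e|ne] := pselect (mu =1 la); last first.
    by rewrite /flipker -/(gev q t c s mu f) vf // mulr0.
  rewrite /flipker; set F := (X in X * _ * _).
  suff -> : F = 0 by rewrite !mul0r.
  by rewrite /F (bigD1 k) //= /x /gridx e -/(gridx q t n s la k) -/beta subrr mulr0 !mul0r.
(* every factor of the kernel but the value of f is nonzero when mu_k < la_k *)
have nzP (mu : nat -> nat) : (mu k < la k)%N -> flipker beta f (x mu) = 0 -> gev q t c s mu f = 0.
  move=> lt /eqP; rewrite /flipker mulf_eq0 -/(gev q t c s mu f) => /orP[e0|/eqP //].
  exfalso; move: e0; apply/negP/mulf_neq0; last apply/mulf_neq0.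
  - apply/prodf_neq0 => i _; rewrite !mulf_neq0 ?invr_eq0 ?nx //.
      have := generic_s gs' (mu i) (n - i.+1)%:Z; rewrite subr_eq0.
      apply: contra_neq; rewrite -!exprnP => e.
      by rewrite -[RHS](divfK ns c') -e /x /gridx expr2; ring.
    rewrite subr_eq0; apply/eqP => /(generic_inj gs)[e1 e2].
    have ik : i = k by apply: val_inj; have := ltn_ord i; have := ltn_ord k; move=> /=; lia.
    by move: lt; rewrite -ik e1 ik ltnn.
  - apply/prodf_neq0 => i _; apply/prodf_neq0 => j ij.
    apply: mulf_neq0; last by rewrite invr_eq0 mulf_neq0 ?nx.
    rewrite subr_eq0 eq_sym.
    have := generic_s gs' (mu i + mu j)%:Z (n - i.+1 + (n - j.+1)).+1%:Z.
    apply: contra_neq; rewrite -!exprnP => <-.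
    by rewrite /x /gridx exprS !exprD; ring.
  apply/prodf_neq0 => i _; apply/prodf_neq0 => j ij; rewrite subr_eq0.
  by apply/eqP => /(generic_inj gs)[_]; have := ltn_ord j; lia.
move: {2}(psum mu0 n) (leqnn (psum mu0 n)) => N.
elim: N mu0 => [|N IHN] mu muN pmu lt; apply: (nzP _ lt).
all: have := key mu pmu; rewrite R0 /gev meval0 mulr0 => /(_ _)/wrap[].
1,3: move=> mu' pmu' hsub [i lt']; have h := psum_sub_lt hsub lt'.
- by have := leq_trans h muN.
- by apply: IHN => //; [rewrite -ltnS (leq_trans h)|apply: leq_ltn_trans lt].
all: by move/esym/eqP; rewrite mulf_eq0 (negPf fact0) /= => /eqP.
Qed.

End Extra.

(** * Partitions and dominance *)

Section IntPart.
Implicit Types (la mu : intpart) (n k i : nat).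

Definition pfun la : nat -> nat := nth 0%N la.

Lemma prowE la i : prow la i.+1 = pfun la i. Proof. by []. Qed.

Lemma pfun_ispart la n : (size la <= n)%N -> ispart n (pfun la).
Proof.
move=> sz; split=> i; rewrite /pfun; last by move=> ni; rewrite nth_default // (leq_trans sz).
have [lt|ge] := ltnP i.+1 (size la); last by rewrite nth_default.
have /andP[so _] := partsP la.
have ge_trans : transitive geq by move=> x y z /= h1 h2; apply: leq_trans h2 h1.
by apply: (sorted_leq_nth ge_trans leqnn 0%N so); rewrite ?inE //= ltnW.
Qed.

Lemma pfun_gt0 la i : (i < size la)%N -> (0 < pfun la i)%N.
Proof.
move=> lt; rewrite lt0n; apply/negP => /eqP e; have /andP[_] := partsP la.
by rewrite -e mem_nth.
Qed.

Lemma size_pfun la n : (forall i, (n <= i)%N -> pfun la i = 0%N) -> (size la <= n)%N.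
Proof.
move=> h; rewrite leqNgt; apply/negP => lt.
by have := pfun_gt0 lt; rewrite h.
Qed.

Lemma pfun_inj la mu : pfun la =1 pfun mu -> la = mu.
Proof.
move=> e; apply: val_inj; apply: (@eq_from_nth _ 0%N) => [|i _]; last exact: e.
apply/eqP; rewrite eqn_leq; apply/andP; split; apply: size_pfun => i sz.
  by rewrite e /pfun nth_default.
by rewrite -e /pfun nth_default.
Qed.

Lemma dom_leE mu la : dom_le mu la <-> forall k, (psum (pfun mu) k <= psum (pfun la) k)%N.
Proof.
have E (nu : intpart) k : (\sum_(1 <= i < k.+1) prow nu i = psum (pfun nu) k)%N.
  by rewrite big_add1 /= big_mkord.
split=> h k; last by move=> _; rewrite !E.
by case: k => [|k]; [rewrite /psum !big_ord0|rewrite -!E; apply: h].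
Qed.

Lemma dom_le_refl la : dom_le la la. Proof. by move=> k. Qed.

Lemma dom_le_trans la mu nu : dom_le la mu -> dom_le mu nu -> dom_le la nu.
Proof. by move=> h1 h2 k k0; apply: leq_trans (h1 k k0) (h2 k k0). Qed.

Lemma dom_le_anti la mu : dom_le la mu -> dom_le mu la -> la = mu.
Proof.
move=> /dom_leE h1 /dom_leE h2; apply: pfun_inj => i.
have e k : psum (pfun la) k = psum (pfun mu) k by apply/eqP; rewrite eqn_leq h1 h2.
by have := e i.+1; rewrite !psum_recr e => /addnI.
Qed.

Lemma dom_lt_trans la mu nu : dom_lt la mu -> dom_lt mu nu -> dom_lt la nu.
Proof.
move=> [h1 n1] [h2 n2]; split; first exact: dom_le_trans h2.
by move=> e; apply: n2; apply: dom_le_anti => //; rewrite -e.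
Qed.

Lemma psum_size la n k : (size la <= n)%N -> (n <= k)%N -> psum (pfun la) k = psum (pfun la) n.
Proof.
move=> sz; elim: k => [|k IHk]; first by rewrite leqn0 => /eqP ->.
rewrite leq_eqVlt => /predU1P[->//|nk]; rewrite psum_recr IHk //.
by rewrite /pfun nth_default ?addn0 // (leq_trans sz).
Qed.

Lemma psum_sumn la n : (size la <= n)%N -> psum (pfun la) n = sumn la.
Proof.
move=> sz; rewrite (psum_size (leqnn _) sz) sumnE (big_nth 0%N) big_mkord.
by [].
Qed.

Lemma psum_mono la j k : (j <= k)%N -> (psum (pfun la) j <= psum (pfun la) k)%N.
Proof.
move=> jk; rewrite /psum -(subnKC jk) big_split_ord /=; exact: leq_addr.
Qed.

Lemma dom_le_trunc mu la n : (size mu <= n)%N ->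
  (forall k, (k <= n)%N -> (psum (pfun mu) k <= psum (pfun la) k)%N) -> dom_le mu la.
Proof.
move=> sz h; apply/dom_leE => k; have [/h //|/ltnW nk] := leqP k n.
by rewrite (psum_size sz nk) (leq_trans (h _ (leqnn n))) // psum_mono.
Qed.

Lemma part_subE la mu : part_sub la mu <-> forall i, (pfun la i <= pfun mu i)%N.
Proof. by split=> [h i|h [//|i] _]; [apply: (h i.+1)|apply: h]. Qed.

Lemma part_sub_dom la mu : part_sub la mu -> dom_le la mu.
Proof. by move/part_subE => h; apply/dom_leE => k; apply: leq_sum. Qed.

Lemma dom_lt_nsub la mu : dom_lt mu la -> ~ part_sub la mu.
Proof. by move=> [h ne] /part_sub_dom h'; apply: ne; apply: dom_le_anti. Qed.

Lemma dom_le_sumn la mu : dom_le la mu -> (sumn la <= sumn mu)%N.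
Proof.
move/dom_leE => h; pose N := maxn (size la) (size mu).
by rewrite -(psum_sumn (leq_maxl _ _ : _ <= N)%N) -(psum_sumn (leq_maxr _ _ : _ <= N)%N).
Qed.

Lemma part_sub_sumn la mu : part_sub la mu -> la <> mu -> (sumn la < sumn mu)%N.
Proof.
move=> sub ne; rewrite ltn_neqAle (dom_le_sumn (part_sub_dom sub)) andbT.
apply/negP => /eqP e; apply: ne; apply: pfun_inj => i.
move/part_subE: sub => sub; pose N := (maxn (maxn (size la) (size mu)) i).+1.
have szl : (size la <= N)%N by rewrite /N; lia.
have szm : (size mu <= N)%N by rewrite /N; lia.
apply/eqP; rewrite eqn_leq sub /= leqNgt; apply/negP => lt.
have iN : (i < N)%N by rewrite /N; lia.
have := psum_sub_lt (n := N) (i := Ordinal iN) sub lt.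
by rewrite !psum_sumn // e ltnn.
Qed.

Lemma ispart_intpart n (mu : nat -> nat) : ispart n mu ->
  exists2 la : intpart, pfun la =1 mu & (size la <= n)%N.
Proof.
elim: n => [|n IHn] pmu.
  have p0 : sorted geq [::] && (0%N \notin [::]) by [].
  by exists (IntPart p0) => // i; rewrite pmu.2 // /pfun nth_nil.
have [m0|m0] := posnP (mu n).
  have [|la e sz] := IHn; last by exists la => //; apply: leqW.
  split=> [i|i]; first exact: pmu.1.
  by rewrite leq_eqVlt => /predU1P[<- //|]; apply: pmu.2.
have p0 : sorted geq (mkseq mu n.+1) && (0%N \notin mkseq mu n.+1).
  apply/andP; split; last first.
    apply/mapP => -[i]; rewrite mem_iota add0n ltnS => /andP[_ /(ispart_le pmu) h] e.
    by rewrite -e leqNgt m0 in h.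
  apply/(sortedP 0%N) => i; rewrite size_mkseq => lt.
  by rewrite !nth_mkseq ?(ltnW lt) //; apply: pmu.1.
exists (IntPart p0); last by rewrite /= size_map size_iota.
move=> i; rewrite /pfun; have [lt|ge] := ltnP i n.+1; first by rewrite nth_mkseq.
by rewrite nth_default ?size_mkseq // pmu.2.
Qed.

End IntPart.

Section Enumeration.
Implicit Types (la mu : intpart).

Lemma sum_trunc (F : nat -> nat) j N : (j <= N)%N ->
  (forall i, (j <= i)%N -> F i = 0%N) -> (\sum_(i < N) F i = \sum_(i < j) F i)%N.
Proof.
move=> jN h; rewrite -(subnKC jN) big_split_ord /= [X in (_ + X)%N]big1 ?addn0 // => i _.
by rewrite h // leq_addr.
Qed.

Lemma filter_mkseq_pfun mu n : (size mu <= n)%N ->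
  [seq k <- mkseq (pfun mu) n | k != 0%N] = mu.
Proof.
move=> sz; have -> : mkseq (pfun mu) n = mu ++ nseq (n - size mu) 0%N.
  apply: (@eq_from_nth _ 0%N).
    by rewrite size_cat size_nseq size_mkseq subnKC.
  move=> i; rewrite size_mkseq => lt; rewrite nth_mkseq // nth_cat /pfun.
  by case: ltnP => // ge; rewrite nth_nseq if_same nth_default.
rewrite filter_cat (_ : [seq k <- nseq _ _ | _] = [::]) ?cats0; last first.
  by elim: (_ - _)%N.
apply/all_filterP/allP => k kmu; have /andP[_] := partsP mu.
by apply: contraNneq => <-.
Qed.

Lemma size_le_sumn mu : (size mu <= sumn mu)%N.
Proof.
rewrite -(psum_sumn (leqnn _)) -[leqLHS](card_ord (size mu)) -sum1_card.
by apply: leq_sum => i _; apply: pfun_gt0.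
Qed.

Lemma pfun_le_sumn mu i : (pfun mu i <= sumn mu)%N.
Proof.
have [lt|ge] := ltnP i (size mu); last by rewrite /pfun nth_default.
by rewrite -(psum_sumn (leqnn _)) /psum (bigD1 (Ordinal lt)) //= leq_addr.
Qed.

(** A partition below la has at most |la| parts, each of them at most |la|. *)
Lemma enum_dom_le la : exists2 s : seq intpart, uniq s & forall mu, mu \in s <-> dom_le mu la.
Proof.
pose d := sumn la; pose F (f : {ffun 'I_d -> 'I_d.+1}) : option intpart :=
  insub [seq k <- [seq val (f i) | i <- enum 'I_d] | k != 0%N].
exists (undup [seq mu <- pmap F (enum {: {ffun 'I_d -> 'I_d.+1}}) | `[< dom_le mu la >]]).
  exact: undup_uniq.
move=> mu; rewrite mem_undup mem_filter; split=> [/andP[/asboolP //]|le].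
apply/andP; split; first exact/asboolP.
have szd : (size mu <= d)%N := leq_trans (size_le_sumn mu) (dom_le_sumn le).
rewrite mem_pmap; apply/mapP; exists [ffun i : 'I_d => inord (pfun mu i)]; first by rewrite mem_enum.
rewrite /F (_ : [seq _ <- _ | _] = mu) ?valK //.
rewrite -[RHS](filter_mkseq_pfun szd) /mkseq -val_enum_ord -map_comp; congr filter.
apply: eq_map => i /=; rewrite ffunE inordK // ltnS.
exact: leq_trans (pfun_le_sumn mu i) (dom_le_sumn le).
Qed.

(** With v the part of la of index #|A|, each entry is at most v plus its excess over
    v. The total excess does not depend on the order of the entries, and in la only the
    first #|A| parts have any. *)
Lemma sub_psum N (A : {set 'I_N}) (m : 'I_N -> nat) la :
    perm_eq [seq k <- [seq m i | i <- enum 'I_N] | k != 0%N] la ->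
  (\sum_(i in A) m i <= psum (pfun la) #|A|)%N.
Proof.
move=> pm; pose v := pfun la #|A|.
have mono : forall i j, (i <= j)%N -> (pfun la j <= pfun la i)%N.
  by move=> i j; apply: ispart_le (pfun_ispart (leqnn (size la))).
have -> : psum (pfun la) #|A| = (#|A| * v + \sum_(i < #|A|) (pfun la i - v))%N.
  have -> : (#|A| * v = \sum_(i < #|A|) v)%N by rewrite sum_nat_const card_ord.
  rewrite -big_split /=; apply: eq_bigr => i _; rewrite subnKC //.
  by apply: mono; apply: ltnW.
apply: (@leq_trans (\sum_(i in A) (v + (m i - v)))%N).
  by apply: leq_sum => i _; rewrite -leq_subLR.
rewrite big_split /= sum_nat_const leq_add2l.
apply: (@leq_trans (\sum_(i < N) (m i - v))%N).
  by rewrite big_mkcond /=; apply: leq_sum => i _; case: ifP.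
have -> : (\sum_(i < N) (m i - v) = \sum_(x <- la) (x - v))%N.
  rewrite -(perm_big _ pm) big_filter big_map [RHS]big_mkcond /= big_enum /=.
  by apply: eq_bigr => i _; case: eqP => //= ->.
rewrite (big_nth 0%N) big_mkord -/(pfun la).
pose M := maxn (size la) #|A|.
rewrite -(@sum_trunc (fun i => pfun la i - v)%N (size la) M) ?leq_maxl //; last first.
  by move=> i ge; rewrite /pfun nth_default.
rewrite -(@sum_trunc (fun i => pfun la i - v)%N #|A| M) ?leq_maxr // => i ge.
by apply/eqP; rewrite subn_eq0 mono.
Qed.

End Enumeration.

(** * Symmetric Laurent polynomials as polynomials in x + 1/x *)

Section LaurentSums.
Variables (K : fieldType) (n : nat).
Implicit Types (g : laurent K n) (a b : {ffun 'I_n -> int}) (w : bc_group n).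

Lemma laurent_evalE (L : fieldType) (h : K -> L) (x : 'I_n -> L) g s :
    h 0 = 0 -> uniq s -> {subset dom g <= s} ->
  laurent_eval h x g = \sum_(a <- s) h (coeff a g) * \prod_i x i ^ a i.
Proof.
move=> h0 us sub; rewrite [RHS](bigID (mem (dom g))) /= [X in _ + X]big1 ?addr0; last first.
  by move=> a /coeff_outdom ->; rewrite h0 mul0r.
rewrite -big_filter; apply: perm_big; apply: uniq_perm; rewrite ?uniq_dom ?filter_uniq //.
by move=> a; rewrite mem_filter; case: (boolP (a \in dom g)) => // /sub ->.
Qed.

Lemma laurent_evalD (L : fieldType) (h : {rmorphism K -> L}) (x : 'I_n -> L) g g' :
  laurent_eval h x (g + g') = laurent_eval h x g + laurent_eval h x g'.
Proof.
pose s := undup (dom g ++ dom g').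
have us : uniq s by exact: undup_uniq.
have E g0 : {subset dom g0 <= s} ->
    laurent_eval h x g0 = \sum_(a <- s) h (coeff a g0) * \prod_i x i ^ a i.
  by apply: laurent_evalE us; rewrite rmorph0.
rewrite !E => [|a ha|a ha|a /domD_subset ha].
- by rewrite -big_split; apply: eq_bigr => a _; rewrite coeffD rmorphD mulrDl.
- by rewrite mem_undup mem_cat ha orbT.
- by rewrite mem_undup mem_cat ha.
- by rewrite mem_undup.
Qed.

Lemma laurent_evalZ (L : fieldType) (h : {rmorphism K -> L}) (x : 'I_n -> L) (c : K) g :
  laurent_eval h x (c *: g) = h c * laurent_eval h x g.
Proof.
rewrite (@laurent_evalE _ _ _ (c *: g) (dom g)) ?rmorph0 ?uniq_dom //; last by move=> a /domZ_subset.
by rewrite mulr_sumr; apply: eq_bigr => a _; rewrite coeffZ rmorphM mulrA.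
Qed.

Lemma laurent_eval0 (L : fieldType) (h : {rmorphism K -> L}) (x : 'I_n -> L) :
  laurent_eval h x (0 : laurent K n) = 0.
Proof. by rewrite /laurent_eval dom0 big_nil. Qed.

Lemma laurent_evalU (L : fieldType) (h : {rmorphism K -> L}) (x : 'I_n -> L) a :
  laurent_eval h x (<< a >> : laurent K n) = \prod_i x i ^ a i.
Proof.
by rewrite /laurent_eval domU1 big_seq1 coeffU eqxx mulr1 rmorph1 mul1r.
Qed.

Lemma bc_act_inj w : injective (bc_act w).
Proof.
move=> a b /ffunP e; apply/ffunP => i; have := e (w.1^-1 i)%g.
by rewrite !ffunE permKV; apply: mulfI; rewrite signr_eq0.
Qed.

(** The action permutes the support of g. *)
Lemma sum_bc_act (V : zmodType) w g (F : {ffun 'I_n -> int} -> V) : bc_symmetric g ->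
  \sum_(a <- dom g) F (bc_act w a) = \sum_(a <- dom g) F a.
Proof.
move=> sg; rewrite -(big_map (bc_act w) xpredT F); apply: perm_big.
have ud : uniq [seq bc_act w a | a <- dom g].
  by rewrite map_inj_uniq ?uniq_dom //; apply: bc_act_inj.
apply: uniq_perm; rewrite ?uniq_dom //.
have sub : {subset [seq bc_act w a | a <- dom g] <= dom g}.
  by move=> b /mapP[a ha ->]; rewrite mem_dom sg -mem_dom.
have szl : (size (dom g) <= size [seq bc_act w a | a <- dom g])%N by rewrite size_map.
exact: (uniq_min_size ud sub szl).2.
Qed.

End LaurentSums.

Section ChebyshevFirst.
Variable K : fieldType.

Fixpoint cheb1 (k : nat) : {poly K} * {poly K} :=
  if k is k'.+1 then let: (u, v) := cheb1 k' in (v, 'X * v - u) else (2%:P, 'X).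

(** Twice the Chebyshev polynomials of the first kind: x^k + x^-k in terms of
    x + 1 / x. *)
Definition chebC (k : nat) : {poly K} := (cheb1 k).1.

Lemma chebCSS k : chebC k.+2 = 'X * chebC k.+1 - chebC k.
Proof. by rewrite /chebC /=; case: (cheb1 k). Qed.

Lemma chebC_natE k x : x != 0 -> x ^+ k + x ^- k = (chebC k).[zfun 1 x].
Proof.
move=> nx; suff: x ^+ k + x ^- k = (chebC k).[zfun 1 x] /\
    x ^+ k.+1 + x ^- k.+1 = (chebC k.+1).[zfun 1 x] by case.
elim: k => [|k [IH1 IH2]].
  by rewrite /chebC /= hornerC hornerX !expr0 !expr1 invr1 /zfun div1r.
split=> //; rewrite chebCSS !hornerE -IH1 -IH2 /zfun !exprS.
by field; rewrite expf_neq0.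
Qed.

Lemma chebCE (l : int) x : x != 0 -> x ^ l + x ^ (- l) = (chebC `|l|).[zfun 1 x].
Proof.
move=> nx; rewrite -chebC_natE //; case: l => k; first by rewrite -invr_expz -exprnP.
by rewrite NegzE opprK abszN addrC -invr_expz -exprnP.
Qed.

Lemma size_chebC k : (size (chebC k) <= k.+1)%N.
Proof.
suff: (size (chebC k) <= k.+1)%N /\ (size (chebC k.+1) <= k.+2)%N by case.
elim: k => [|k [h1 h2]]; first by rewrite /chebC /= size_polyC size_polyX leq_b1.
split=> //; rewrite chebCSS (leq_trans (size_polyD _ _)) // geq_max size_polyN.
apply/andP; split; last by rewrite (leq_trans h1) // leqW.
have [->|nz] := eqVneq (chebC k.+1) 0; first by rewrite mulr0 size_poly0.
by rewrite mulrC size_mulX.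
Qed.

Lemma lead_chebC k : (chebC k)`_k = if k == 0%N then 2 else 1.
Proof.
suff: (chebC k)`_k = (if k == 0%N then 2 else 1) /\ (chebC k.+1)`_k.+1 = 1 by case.
elim: k => [|k [h1 h2]]; first by rewrite /chebC /= coefC coefX.
split=> //; rewrite chebCSS coefB coefXM /= h2 nth_default ?subr0 //.
by rewrite (leq_trans (size_chebC k)) // leqW.
Qed.

(** Two indicators rather than one, so that l = 0, where the coefficient is 2, is not
    an exception. *)
Lemma coef_chebC (l : int) (k : nat) : (`|l| <= k)%N ->
  (chebC `|l|)`_k = (l == k%:Z)%:R + (l == - k%:Z)%:R.
Proof.
rewrite leq_eqVlt => /predU1P[<-|lt].
  rewrite lead_chebC absz_eq0; have [->|nz] := eqVneq l 0; first by rewrite -natrD.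
  have [pos|neg] := leP 0 l.
    have -> : (l == `|l|%N%:Z) = true by lia.
    have -> : (l == - `|l|%N%:Z) = false by lia.
    by rewrite -natrD.
  have -> : (l == `|l|%N%:Z) = false by lia.
  have -> : (l == - `|l|%N%:Z) = true by lia.
  by rewrite -natrD.
rewrite nth_default ?(leq_trans (size_chebC _)) //.
have -> : (l == k%:Z) = false by lia.
have -> : (l == - k%:Z) = false by lia.
by rewrite addr0.
Qed.
End ChebyshevFirst.

Section ZPoly.
Variables (K : fieldType) (n : nat).
Hypothesis two : 2 != 0 :> K.
Implicit Types (g : laurent K n) (a b : {ffun 'I_n -> int}) (A : {set 'I_n}).

Lemma polyat_wide (p : {poly K}) (j : 'I_n) N : (size p <= N)%N ->
  polyat p j = \sum_(k < N) p`_k *: 'X_j ^+ k.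
Proof.
move=> h; rewrite /polyat (big_ord_widen N (fun k => p`_k *: 'X_j ^+ k)) //.
rewrite big_mkcond /=; apply: eq_bigr => k _; case: ltnP => // ge.
by rewrite nth_default // scale0r.
Qed.

Lemma mcoeff_prod_polyat (p : 'I_n -> {poly K}) (m : 'X_{1..n}) :
  (\prod_i polyat (p i) i)@_m = \prod_i (p i)`_(m i).
Proof.
pose N := (\max_i size (p i) + \sum_i m i).+1.
have pN i : (size (p i) <= N)%N.
  apply: leqW; apply: leq_trans (leq_addr _ _).
  exact: (leq_bigmax (F := fun i => size (p i)) i).
have mN i : (m i < N)%N.
  by rewrite /N ltnS (leq_trans _ (leq_addl _ _)) // (bigD1 i) //= leq_addr.
under eq_bigr => i _ do rewrite (polyat_wide i (pN i)).
rewrite bigA_distr_bigA /= raddf_sum /= (bigD1 [ffun i => Ordinal (mN i)]) //=.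
have E (f : {ffun 'I_n -> 'I_N}) :
    (\prod_i ((p i)`_(f i) *: 'X_i ^+ f i))@_m =
    \prod_i (p i)`_(f i) * ([multinom nat_of_ord (f i) | i < n] == m)%:R.
  rewrite scaler_prod mcoeffZ -mcoeffX mpolyXE_id; congr (_ * mcoeff m _).
  by apply: eq_bigr => i _; rewrite mnmE.
rewrite E [X in _ + X]big1 ?addr0 => [|f nf].
  rewrite (_ : _ == m) ?mulr1; first by apply: eq_bigr => i _; rewrite ffunE.
  by apply/eqP/mnmP => i; rewrite mnmE ffunE.
rewrite E (_ : _ == m = false) ?mulr0 //; apply: contraNF nf => /eqP e.
by apply/eqP/ffunP => i; apply: val_inj; rewrite ffunE /= -e mnmE.
Qed.

(** A symmetric element is invariant under the 2^n sign changes of its exponents, and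
    averaging the monomial of exponent a over them gives
    2^-n prod_i (x_i^a_i + x_i^-a_i), a polynomial in the x_i + 1 / x_i. *)
Definition zpoly g : {mpoly K[n]} :=
  \sum_(a <- dom g) (2 ^- n * coeff a g) *: \prod_i polyat (chebC K `|a i|) i.

Definition signs (e : {ffun 'I_n -> bool}) : bc_group n := (1%g, e).

Lemma bc_signsE e a i : bc_act (signs e) a i = (-1) ^+ e i * a i.
Proof. by rewrite ffunE perm1. Qed.

Lemma meval_zpoly g (x : 'I_n -> K) : bc_symmetric g -> (forall i, x i != 0) ->
  (zpoly g).@[fun i => zfun 1 (x i)] = laurent_eval id x g.
Proof.
move=> sg nx; rewrite /zpoly raddf_sum /=.
have two_n : 2 ^+ n != 0 :> K by rewrite expf_neq0.
apply: (mulfI two_n); rewrite mulr_sumr.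
rewrite (eq_bigr (fun a => \sum_(e : {ffun 'I_n -> bool})
   coeff (bc_act (signs e) a) g * \prod_i x i ^ (bc_act (signs e) a) i)); last first.
  move=> a _; rewrite mevalZ !mulrA mulfV // mul1r.
  under [RHS]eq_bigr => e _ do rewrite sg.
  rewrite -mulr_sumr; congr (_ * _).
  rewrite rmorph_prod /= (eq_bigr (fun i => \sum_(b : bool) x i ^ ((-1) ^+ b * a i))).
    rewrite bigA_distr_bigA; apply: eq_bigr => e _; apply: eq_bigr => i _.
    by rewrite bc_signsE.
  by move=> i _; rewrite meval_polyat -chebCE // big_bool /= expr0 expr1 mul1r mulN1r addrC.
rewrite exchange_big /= (eq_bigr (fun=> laurent_eval id x g)); last first.
  by move=> e _; rewrite (sum_bc_act _ (fun a => coeff a g * \prod_i x i ^ a i)).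
by rewrite sumr_const card_ffun card_bool card_ord -[LHS]mulr_natl natrX.
Qed.

Lemma zpoly_sym g : bc_symmetric g -> zpoly g \is symmetric.
Proof.
move=> sg; apply/issymP => s; rewrite /zpoly raddf_sum /=.
pose w : bc_group n := (s, [ffun=> false]).
rewrite -(sum_bc_act w (fun a => msym s ((2 ^- n * coeff a g) *:
   \prod_i polyat (chebC K `|a i|) i)) sg).
apply: eq_bigr => a _; rewrite sg msymZ rmorph_prod; congr (_ *: _).
rewrite [RHS](reindex_inj (@perm_inj _ s)); apply: eq_bigr => i _ /=.
by rewrite msym_polyat !ffunE expr0 mul1r.
Qed.

Definition exp_bounded (B : {set 'I_n} -> nat) g : Prop :=
  forall a, a \in dom g -> forall A, (\sum_(i in A) `|a i| <= B A)%N.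

Lemma zpoly_bounded B g : exp_bounded B g -> bounded B (zpoly g).
Proof.
move=> bg; apply: bounded_sum_seq => a /bg ba; apply: boundedZ.
apply: (@boundedW _ _ (fun A => \sum_(i < n) (i \in A) * (size (chebC K `|a i|)).-1)%N);
  last by apply: bounded_prod => i _; apply: bounded_polyat.
move=> A.
apply: leq_trans (ba A); rewrite [leqRHS]big_mkcond /=; apply: leq_sum => i _.
by have := size_chebC K `|a i|; case: (i \in A); rewrite ?mul1n ?mul0n //; case: (size _).
Qed.

(** In the top degree only the leading coefficients of the Chebyshev polynomials
    contribute, one for each choice of signs. *)
Lemma mcoeff_zpoly g (m : 'X_{1..n}) : bc_symmetric g ->
    (forall a, a \in dom g -> (\sum_i `|a i| <= \sum_i m i)%N) ->
  (zpoly g)@_m = coeff [ffun i => (m i)%:Z] g.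
Proof.
move=> sg bg; rewrite /zpoly raddf_sum /=; set b := [ffun i => _].
have two_n : 2 ^+ n != 0 :> K by rewrite expf_neq0.
apply: (mulfI two_n); rewrite mulr_sumr.
rewrite big_seq (eq_bigr (fun a => \sum_(e : {ffun 'I_n -> bool})
   coeff a g * (a == bc_act (signs e) b)%:R)); last first.
  move=> a /bg ha; rewrite mcoeffZ !mulrA mulfV // mul1r -mulr_sumr; congr (_ * _).
  rewrite mcoeff_prod_polyat.
  transitivity (\prod_i \sum_(c : bool) (a i == (-1) ^+ c * b i)%:R : K).
    have [/forallP le|] := boolP [forall i, (`|a i| <= m i)%N].
      apply: eq_bigr => i _; rewrite coef_chebC // big_bool /= !ffunE expr1 expr0.
      by rewrite mul1r mulN1r addrC.
    case/forallPn => i; rewrite -ltnNge => lt.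
    have [j ltj] : exists j : 'I_n, (`|a j| < m j)%N.
      apply/existsP; apply: contraLR lt => /existsPn h; rewrite -leqNgt.
      move: ha; rewrite (bigD1 i) //= [leqRHS](bigD1 i) //=.
      move=> ha'; have h2 : (\sum_(j < n | j != i) m j <= \sum_(j < n | j != i) `|a j|)%N.
        by apply: leq_sum => j _; rewrite leqNgt.
      by rewrite leqNgt; apply/negP => lt'; have := leq_add lt' h2; rewrite addSn ltnNge ha'.
    rewrite (bigD1 j) //= nth_default ?(leq_trans (size_chebC _ _)) // mul0r.
    rewrite (bigD1 i) //= big_bool /= !ffunE expr1 expr0 mul1r mulN1r.
    have -> : (a i == (m i)%:Z) = false by move: (m i) lt => k; lia.
    have -> : (a i == - (m i)%:Z) = false by move: (m i) lt => k; lia.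
    by rewrite addr0 mul0r.
  rewrite bigA_distr_bigA /=; apply: eq_bigr => e _.
  have [->|ne] := eqVneq a (bc_act (signs e) b).
    by rewrite big1 // => i _; rewrite bc_signsE eqxx.
  have [i ni] : exists i, a i != (-1) ^+ e i * b i.
    apply/existsP; apply: contraNT ne => /existsPn h; apply/eqP/ffunP => i.
    by rewrite bc_signsE; apply/eqP; have := h i; rewrite negbK.
  by rewrite (bigD1 i) //= (negPf ni) mul0r.
rewrite -big_seq exchange_big /= (eq_bigr (fun=> coeff b g)); last first.
  move=> e _; set b' := bc_act _ b.
  rewrite -(sg (signs e) b) -/b'; have [hb|nb] := boolP (b' \in dom g).
    rewrite (bigD1_seq b') ?uniq_dom //= eqxx mulr1 big1 ?addr0 // => a /negPf ->.
    by rewrite mulr0.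
  rewrite coeff_outdom // big_seq big1 // => a ha.
  by rewrite (_ : (a == b') = false) ?mulr0 //; apply: contraNF nb => /eqP <-.
by rewrite sumr_const card_ffun card_bool card_ord -[LHS]mulr_natl natrX.
Qed.

(** By [mcoeff_zpoly] the coefficient of an exponent of maximal size survives in
    zpoly g. *)
Lemma zpoly_eq0 g : bc_symmetric g -> zpoly g = 0 -> g = 0.
Proof.
move=> sg z0; apply/eqP; rewrite -dom_eq0; apply/eqP.
case E: (dom g) => [//|a0 s0]; exfalso.
pose N a := (\sum_i `|a i|)%N.
have [a ag amax] : exists2 a : {ffun 'I_n -> int}, a \in dom g &
    forall b, b \in dom g -> (N b <= N a)%N.
  have ex : exists k, has (fun a => N a == k) (dom g).
    by exists (N a0); apply/hasP; exists a0; rewrite ?E ?mem_head.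
  have ub k : has (fun a => N a == k) (dom g) -> (k <= \sum_(a <- dom g) N a)%N.
    by case/hasP => b hb /eqP <-; rewrite (big_rem _ hb) /= leq_addr.
  case: (ex_maxnP ex ub) => k /hasP[a ha /eqP e] max; exists a => // b hb.
  by rewrite e; apply: max; apply/hasP; exists b.
have := @mcoeff_zpoly g [multinom `|a i|%N | i < n] sg.
rewrite z0 mcoeff0 => /(_ _)/wrap[b hb|].
  by under [leqRHS]eq_bigr => i _ do rewrite mnmE; apply: amax.
pose e := [ffun i => a i < 0]%R.
have -> : [ffun i => ([multinom `|a i|%N | i < n] i)%:Z] = bc_act (signs e) a.
  apply/ffunP => i; rewrite bc_signsE !ffunE mnmE.
  by case: (ltrP (a i) 0) => h; rewrite ?expr1 ?expr0; lia.
by rewrite sg => /esym/eqP; apply/negP; rewrite -mem_dom.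
Qed.

End ZPoly.

(** * Orbit sums *)

Section Orbits.
Variables (K : fieldType) (n : nat).
Implicit Types (g : laurent K n) (a b : {ffun 'I_n -> int}) (w : bc_group n).
Implicit Types (la mu : intpart).

Lemma bc_act_comp w w' a : exists w'', bc_act w (bc_act w' a) = bc_act w'' a.
Proof.
exists ((w.1 * w'.1)%g, [ffun i => w.2 i (+) w'.2 (w.1 i)]).
by apply/ffunP => i; rewrite !ffunE permM signr_addb mulrA.
Qed.

Lemma bc_act_inv w a : exists w', bc_act w' (bc_act w a) = a.
Proof.
exists ((w.1^-1)%g, [ffun i => w.2 (w.1^-1 i)%g]).
by apply/ffunP => i; rewrite !ffunE permKV mulrA -expr2 sqrr_sign mul1r.
Qed.

Lemma coeff_orbit_sum a b :
  coeff b (bc_orbit_sum K a) = (b \in [seq bc_act w a | w : bc_group n])%:R.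
Proof.
rewrite /bc_orbit_sum; set s := [seq _ | _ in _].
rewrite raddf_sum /= -mem_undup.
have [bs|nb] := boolP (b \in undup s).
  rewrite (bigD1_seq b) ?undup_uniq //= coeffU eqxx mulr1 big1 ?addr0 // => c /negPf e.
  by rewrite coeffU e mulr0.
rewrite big_seq big1 // => c cs; rewrite coeffU.
by case: eqP cs nb => [->->//|]; rewrite mulr0.
Qed.

Lemma orbit_sum_sym a : bc_symmetric (bc_orbit_sum K a).
Proof.
move=> w b; rewrite !coeff_orbit_sum; congr (nat_of_bool _)%:R.
apply/mapP/mapP => -[w' _ e].
  have [w1 e1] := bc_act_inv w b; rewrite e in e1.
  have [w2 e2] := bc_act_comp w1 w' a.
  by exists w2; rewrite ?mem_enum // -e2.
have [w2 e2] := bc_act_comp w w' a.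
by exists w2; rewrite ?mem_enum // e.
Qed.

Definition exp_dom la g := exp_bounded (fun A => psum (pfun la) #|A|) g.

Lemma orbit_bounded la w (A : {set 'I_n}) : (size la <= n)%N ->
  (\sum_(i in A) `|bc_act w (part_exp n la) i| <= psum (pfun la) #|A|)%N.
Proof.
move=> sz; rewrite (eq_bigr (fun i => pfun la (w.1 i))); last first.
  by move=> i _; rewrite !ffunE abszMsign prowE.
apply: (@sub_psum _ _ (fun i => pfun la (w.1 i))).
rewrite -[X in perm_eq _ X](filter_mkseq_pfun sz); apply: perm_filter.
rewrite /mkseq -val_enum_ord -map_comp (map_comp (fun i : 'I_n => pfun la i) w.1).
apply: perm_map; apply: uniq_perm; rewrite ?(map_inj_uniq (@perm_inj _ w.1)) ?enum_uniq //.
move=> i; rewrite mem_enum inE; apply/mapP; exists (w.1^-1 i)%g; rewrite ?mem_enum //.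
by rewrite permKV.
Qed.

Lemma orbit_sum_bounded la : (size la <= n)%N -> exp_dom la (bc_orbit_sum K (part_exp n la)).
Proof.
move=> sz b; rewrite mem_dom coeff_orbit_sum.
case: (boolP (b \in _)) => [/mapP[w _ ->] _ A|]; last by rewrite eqxx.
exact: orbit_bounded.
Qed.

Lemma exp_domW la mu g : dom_le mu la -> exp_dom mu g -> exp_dom la g.
Proof. by move=> /dom_leE le h a /h ha A; apply: leq_trans (le _). Qed.

Lemma exp_boundedD (B : {set 'I_n} -> nat) g g' :
  exp_bounded B g -> exp_bounded B g' -> exp_bounded B (g + g').
Proof. by move=> h h' a /domD_subset; rewrite mem_cat => /orP[/h|/h']. Qed.

Lemma exp_boundedZ (B : {set 'I_n} -> nat) c g : exp_bounded B g -> exp_bounded B (c *: g).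
Proof. by move=> h a /domZ_subset /h. Qed.

Lemma exp_bounded0 (B : {set 'I_n} -> nat) : exp_bounded B (0 : laurent K n).
Proof. by move=> a; rewrite dom0. Qed.

Lemma exp_bounded_sum (B : {set 'I_n} -> nat) (I : eqType) (r : seq I) (F : I -> laurent K n) :
  (forall i, i \in r -> exp_bounded B (F i)) -> exp_bounded B (\sum_(i <- r) F i).
Proof.
move=> h; rewrite big_seq; elim/big_ind: _ => //; first exact: exp_bounded0.
exact: exp_boundedD.
Qed.

Lemma bc_symmetricD g g' : bc_symmetric g -> bc_symmetric g' -> bc_symmetric (g + g').
Proof. by move=> h h' w a; rewrite !coeffD h h'. Qed.

Lemma bc_symmetricZ c g : bc_symmetric g -> bc_symmetric (c *: g).
Proof. by move=> h w a; rewrite !coeffZ h. Qed.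

Lemma coeff_exp_dom la mu g : exp_dom la g -> (size mu <= n)%N ->
  coeff (part_exp n mu) g != 0 -> dom_le mu la.
Proof.
move=> h sz; rewrite -mem_dom => /h ha; apply: (dom_le_trunc sz) => k kn.
have := ha [set i : 'I_n | (i < k)%N]; rewrite card_iprefix //; apply: leq_trans.
rewrite /psum (big_ord_widen n (pfun mu) kn) [leqRHS](eq_bigl (fun i : 'I_n => (i < k)%N)).
  by apply: leq_sum => i _; rewrite ffunE prowE.
by move=> i; rewrite inE.
Qed.

Lemma part_exp_orbit la mu w : (size la <= n)%N -> (size mu <= n)%N ->
  part_exp n la = bc_act w (part_exp n mu) -> la = mu.
Proof.
have key la' mu' w' : (size la' <= n)%N -> (size mu' <= n)%N ->
    part_exp n la' = bc_act w' (part_exp n mu') -> dom_le la' mu'.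
  move=> sl sm e; apply: (coeff_exp_dom (orbit_sum_bounded sm) sl).
  rewrite coeff_orbit_sum (_ : _ \in _) ?oner_eq0 //.
  by apply/mapP; exists w'; rewrite ?mem_enum.
move=> sl sm e; apply: dom_le_anti; first exact: key e.
have [w' e'] := bc_act_inv w (part_exp n mu); apply: (key _ _ w') => //.
by rewrite e e'.
Qed.

Lemma bc_sort b : exists2 mu : intpart, (size mu <= n)%N & exists w, bc_act w (part_exp n mu) = b.
Proof.
pose s := sort geq [seq `|b i|%N | i <- enum 'I_n].
have szs : size s == n by rewrite size_sort size_map size_enum_ord.
have gt : total geq by move=> x y; exact: leq_total.
have pm : ispart n (nth 0%N s).
  have so : sorted geq s by apply: sort_sorted.
  split=> i; last by move=> ni; rewrite nth_default // (eqP szs).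
  have [lt|ge] := ltnP i.+1 (size s); last by rewrite nth_default.
  by move/(sortedP 0%N): so; apply.
have [mu e sz] := ispart_intpart pm; exists mu => //.
have /tuple_permP[p pE] : perm_eq [seq `|b i|%N | i <- enum 'I_n] (Tuple szs).
  by rewrite /= perm_sym perm_sort.
exists (p, [ffun i => b i < 0]%R); apply/ffunP => i; rewrite !ffunE /= prowE e.
have -> : nth 0%N s (p i) = `|b i|%N.
  have := congr1 (fun l => nth 0%N l i) pE.
  rewrite (nth_map i) ?size_enum_ord // nth_ord_enum => ->.
  by rewrite /= (nth_map i) ?size_enum_ord // nth_ord_enum (tnth_nth 0%N).
by case: (ltrP (b i) 0) => h; rewrite ?expr1 ?expr0; lia.
Qed.

(** Every orbit contains the exponent of exactly one partition, and the coefficient of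
    g at that exponent is the coefficient of the orbit sum. *)
Lemma bc_decomp la g : bc_symmetric g -> exp_dom la g -> (size la <= n)%N ->
    coeff (part_exp n la) g = 1 ->
  exists2 r : seq (K * intpart), forall c, c \in r -> dom_lt c.2 la /\ (size c.2 <= n)%N
   & g = bc_orbit_sum K (part_exp n la) + \sum_(c <- r) c.1 *: bc_orbit_sum K (part_exp n c.2).
Proof.
move=> sg bg szl g1; have [s us sP] := enum_dom_le la.
pose s' := [seq mu <- s | (mu != la) && (size mu <= n)%N].
exists [seq (coeff (part_exp n mu) g, mu) | mu <- s'] => [c|].
  case/mapP => mu; rewrite mem_filter => /andP[/andP[ne sz] /sP le] -> /=.
  by split=> //; split=> //; apply/eqP.
rewrite big_map /=; apply/eqP/freeg_eqP => b /=; rewrite coeffD [X in _ + X]raddf_sum /=.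
have [mu szm [w <-]] := bc_sort b; rewrite sg orbit_sum_sym.
have orbE (nu : intpart) : (size nu <= n)%N -> coeff (part_exp n mu) (bc_orbit_sum K (part_exp n nu)) = (mu == nu)%:R.
  move=> szn; rewrite coeff_orbit_sum; congr (nat_of_bool _)%:R; apply/mapP/eqP => [[w' _ e]|->].
    exact: part_exp_orbit e.
  exists (1%g, [ffun=> false]); rewrite ?mem_enum //.
  by apply/ffunP => i; rewrite !ffunE perm1 expr0 mul1r.
rewrite orbE // big_seq.
rewrite (eq_bigr (fun nu => coeff (part_exp n nu) g * (mu == nu)%:R)); last first.
  by move=> nu; rewrite mem_filter => /andP[/andP[_ sz] _]; rewrite coeffZ orbit_sum_sym orbE.
rewrite -big_seq; have [->|ne] := eqVneq mu la.
  rewrite g1 big_seq big1 ?addr0 // => nu; rewrite mem_filter => /andP[/andP[ne _] _].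
  by rewrite eq_sym (negPf ne) mulr0.
rewrite add0r; have [ms|nms] := boolP (mu \in s').
  rewrite (bigD1_seq mu) ?filter_uniq //= eqxx mulr1 big1 ?addr0 // => nu /negPf e.
  by rewrite eq_sym e mulr0.
rewrite big_seq big1 => [|nu ns]; last first.
  by rewrite (_ : mu == nu = false) ?mulr0 //; apply: contraNF nms => /eqP ->.
apply: contraNeq nms => c0; rewrite mem_filter ne szm /=.
by apply/sP; apply: coeff_exp_dom c0.
Qed.

End Orbits.

(** * Interpolation by symmetric Laurent polynomials *)

Section LaurentInterpolation.
Variables (K : fieldType) (char0 : [pchar K] =i pred0) (q t s : K) (n : nat).
Hypothesis gs : generic q t 1 s.
Implicit Types (g : laurent K n) (la mu : intpart).

Let two : 2 != 0 :> K.
Proof. by move/pcharf0P: char0 => ->. Qed.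

Definition gpoint mu (i : 'I_n) : K := q ^+ prow mu i.+1 * t ^+ (n - i.+1) * s.

Lemma gpoint_neq0 mu i : gpoint mu i != 0.
Proof. exact: (gridx_neq0 gs n (pfun mu) i). Qed.

Lemma laurent_gev g mu : bc_symmetric g ->
  laurent_eval id (gpoint mu) g = gev q t 1 s (pfun mu) (zpoly g).
Proof.
move=> sg; rewrite -(meval_zpoly two sg (gpoint_neq0 mu)).
by apply: meval_eq.
Qed.

Definition vanish_below la g : Prop :=
  forall mu, dom_lt mu la -> (size mu <= n)%N -> laurent_eval id (gpoint mu) g = 0.

Lemma gev_below la g (mu : nat -> nat) : bc_symmetric g -> vanish_below la g -> ispart n mu ->
    (forall k, (k <= n)%N -> (psum mu k <= psum (pfun la) k)%N) -> ~ (mu =1 pfun la) ->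
  gev q t 1 s mu (zpoly g) = 0.
Proof.
move=> sg vg pmu le ne; have [nu e sz] := ispart_intpart pmu.
rewrite -(eq_gev _ _ _ _ _ e) -laurent_gev // vg //; split.
  by apply: (dom_le_trunc sz) => k kn; rewrite (eq_psum _ e) le.
by move=> enu; apply: ne => i; rewrite -enu e.
Qed.

Lemma mcoeff_zpoly_exp la g : bc_symmetric g -> exp_dom la g -> (size la <= n)%N ->
  (zpoly g)@_(pmnm n (pfun la)) = coeff (part_exp n la) g.
Proof.
move=> sg bg sz; rewrite mcoeff_zpoly //; last first.
  move=> a /bg /(_ setT); rewrite cardsT card_ord.
  rewrite (eq_bigl xpredT) => [|i]; last by rewrite inE.
  move=> h; apply: leq_trans h _.
  by apply: leq_sum => i _; rewrite mnmE.
by congr (coeff _ g); apply/ffunP => i; rewrite !ffunE mnmE.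
Qed.

Lemma bc_value la g : bc_symmetric g -> exp_dom la g -> (size la <= n)%N ->
    vanish_below la g ->
  laurent_eval id (gpoint la) g = coeff (part_exp n la) g * diagval q t 1 n s (pfun la).
Proof.
move=> sg bg sz vg; rewrite laurent_gev // -(mcoeff_zpoly_exp sg bg sz).
apply: interp_value => //.
- exact: pfun_ispart.
- exact: zpoly_sym.
- exact: zpoly_bounded.
by move=> mu pmu le ne; apply: gev_below ne.
Qed.

Lemma bc_extra la mu g : bc_symmetric g -> exp_dom la g -> (size la <= n)%N ->
    vanish_below la g -> (size mu <= n)%N -> ~ part_sub la mu ->
  laurent_eval id (gpoint mu) g = 0.
Proof.
move=> sg bg sz vg szm nsub; rewrite laurent_gev //.
have [k lt] : exists k : 'I_n, (pfun mu k < pfun la k)%N.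
  apply: contrapT => h; apply: nsub; apply/part_subE => i.
  have [ni|lt] := leqP n i; first by rewrite {1}/pfun nth_default // (leq_trans sz).
  by rewrite leqNgt; apply/negP => lt'; apply: h; exists (Ordinal lt).
apply: (interp_extra char0 gs (pfun_ispart sz) (zpoly_sym sg) _ _ (pfun_ispart szm) lt).
  exact: zpoly_bounded.
by move=> nu pnu le ne; apply: gev_below ne.
Qed.

(** When size la > n there is no leading coefficient to subtract: this case makes the
    lifted functions vanish in too few variables. *)
Lemma bc_unique la g : bc_symmetric g -> exp_dom la g ->
    ((size la <= n)%N -> coeff (part_exp n la) g = 0) -> vanish_below la g ->
  g = 0.
Proof.
move=> sg bg c0 vg; apply: (zpoly_eq0 two sg).
apply: (interp_unique gs (zpoly_sym sg) (zpoly_bounded bg)) => mu pmu le.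
have [e|ne] := pselect (mu =1 pfun la); last exact: gev_below ne.
have sz : (size la <= n)%N by apply: size_pfun => i ni; rewrite -e pmu.2.
rewrite (eq_gev _ _ _ _ _ e) -laurent_gev // bc_value //.
by rewrite c0 // mul0r.
Qed.

Lemma bc_interp_unique la : forall g g', bc_interp q t s la g -> bc_interp q t s la g' ->
  (size la <= n)%N -> g = g'.
Proof.
have prop g : (size la <= n)%N -> bc_interp q t s la g ->
    [/\ bc_symmetric g, exp_dom la g, coeff (part_exp n la) g = 1 & vanish_below la g].
  move=> sz [sg [r hr eg] vg]; have bg : exp_dom la g.
    rewrite eg; apply: exp_boundedD; first exact: orbit_sum_bounded.
    apply: exp_bounded_sum => c /hr[[le _] szc]; apply: exp_boundedZ.
    exact: exp_domW le (orbit_sum_bounded szc).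
  split=> //; rewrite eg coeffD [X in _ + X]raddf_sum /= big_seq big1 ?addr0.
    rewrite coeff_orbit_sum (_ : _ \in _) //; apply/mapP.
    exists (1%g, [ffun=> false]); rewrite ?mem_enum //.
    by apply/ffunP => i; rewrite !ffunE perm1 expr0 mul1r.
  move=> c /hr[[le ne] szc]; rewrite coeffZ; apply/eqP; rewrite mulf_eq0; apply/orP; right.
  apply: contra_notT ne => /(coeff_exp_dom (orbit_sum_bounded szc) sz) le'.
  exact: dom_le_anti.
move=> g g' hg hg' sz; have [sg bg cg vg] := prop g sz hg.
have [sg' bg' cg' vg'] := prop g' sz hg'.
apply/eqP; rewrite -subr_eq0; apply/eqP; rewrite -scaleN1r.
apply: (@bc_unique la).
- by apply: bc_symmetricD => //; apply: bc_symmetricZ.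
- by apply: exp_boundedD => //; apply: exp_boundedZ.
- by move=> _; rewrite coeffD coeffZ cg cg' mulN1r subrr.
move=> mu lt szm.
have := laurent_evalD (@idfun K : {rmorphism K -> K}) (gpoint mu) g (- 1 *: g').
rewrite (laurent_evalZ (@idfun K : {rmorphism K -> K}) (gpoint mu)) /= => e.
transitivity (laurent_eval id (gpoint mu) g + (-1) * laurent_eval id (gpoint mu) g') => //.
by rewrite vg // vg' // mulr0 addr0.
Qed.

End LaurentInterpolation.

(** * Symmetric functions of x_1, 1/x_1, ..., x_n, 1/x_n *)

Section PlusMinus.
Variables (K : fieldType) (n : nat).
Implicit Types (p : {mpoly K[n.*2]}) (la mu : intpart).

Fact dord_proof (ib : 'I_n * bool) : (ib.1.*2 + ib.2 < n.*2)%N.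
Proof. by case: ib => [[i lt] []] /=; rewrite ?addn1 ?addn0 ?ltn_Sdouble ?ltn_double. Qed.

(** The variables of indices i.*2 and i.*2.+1 are specialised to x_i and its
    inverse. *)
Definition dord (ib : 'I_n * bool) : 'I_(n.*2) := Ordinal (dord_proof ib).
Definition dinv (j : 'I_(n.*2)) : 'I_n * bool := (Ordinal (half_ord_proof j), odd j).

Lemma dordK : cancel dord dinv.
Proof.
move=> [i b]; rewrite /dinv; congr (_, _); last by rewrite /= oddD odd_double; case: b.
by apply: val_inj; rewrite /= addnC half_bit_double.
Qed.

Lemma dinvK : cancel dinv dord.
Proof. by move=> j; apply: val_inj; rewrite /= addnC odd_double_half. Qed.

Lemma big_dord (R : Type) (idx : R) (op : Monoid.com_law idx) (F : 'I_(n.*2) -> R) :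
  \big[op/idx]_j F j = \big[op/idx]_i (op (F (dord (i, false))) (F (dord (i, true)))).
Proof.
rewrite (reindex dord) /=; last by exists dinv => j _; rewrite ?dordK ?dinvK.
rewrite (eq_bigr (fun ib => F (dord (ib.1, ib.2)))); last by case.
rewrite -(pair_bigA _ (fun i b => F (dord (i, b)))) /=; apply: eq_bigr => i _.
by rewrite big_bool Monoid.mulmC.
Qed.

Definition pmexp (m : 'X_{1..n.*2}) : {ffun 'I_n -> int} :=
  [ffun i => (m (dord (i, false)))%:Z - (m (dord (i, true)))%:Z].

(** The value p(x_1, 1/x_1, ..., x_n, 1/x_n). *)
Definition pm_laurent p : laurent K n := \sum_(m <- msupp p) p@_m *: << pmexp m >>.

Lemma pm_laurentE p (s : seq 'X_{1..n.*2}) : uniq s -> {subset msupp p <= s} ->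
  pm_laurent p = \sum_(m <- s) p@_m *: << pmexp m >>.
Proof.
move=> us sub; rewrite [RHS](bigID (mem (msupp p))) /= [X in _ + X]big1 ?addr0; last first.
  by move=> m /memN_msupp_eq0 ->; rewrite scale0r.
rewrite -big_filter; apply: perm_big; apply: uniq_perm; rewrite ?msupp_uniq ?filter_uniq //.
by move=> a; rewrite mem_filter; case: (boolP (a \in msupp p)) => // /sub ->.
Qed.

Lemma pm_laurentD p p' : pm_laurent (p + p') = pm_laurent p + pm_laurent p'.
Proof.
pose s := undup (msupp p ++ msupp p').
have us : uniq s by exact: undup_uniq.
rewrite (pm_laurentE us (p := p)) ?(pm_laurentE us (p := p')) ?(pm_laurentE us (p := p + p')).
- by rewrite -big_split; apply: eq_bigr => m _; rewrite mcoeffD scalerDl.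
- by move=> m /msuppD_le; rewrite mem_undup.
- by move=> m hm; rewrite mem_undup mem_cat hm orbT.
by move=> m hm; rewrite mem_undup mem_cat hm.
Qed.

Lemma pm_laurentZ c p : pm_laurent (c *: p) = c *: pm_laurent p.
Proof.
rewrite (pm_laurentE (msupp_uniq p)); last by move=> m /msuppZ_le.
by rewrite scaler_sumr; apply: eq_bigr => m _; rewrite mcoeffZ scalerA.
Qed.

Lemma pm_laurent0 : pm_laurent 0 = 0.
Proof. by rewrite /pm_laurent msupp0 big_nil. Qed.

Lemma eval_pm_laurent (L : fieldType) (h : {rmorphism K -> L}) (x : 'I_n -> L) p :
    (forall i, x i != 0) ->
  laurent_eval h x (pm_laurent p) =
  mmap h (fun j : 'I_n.*2 => let y := x (Ordinal (half_ord_proof j)) in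
                             if odd j then y^-1 else y) p.
Proof.
move=> nx; rewrite /pm_laurent /mmap.
elim: (msupp p) => [|m ms IH]; first by rewrite !big_nil laurent_eval0.
rewrite !big_cons laurent_evalD IH laurent_evalZ laurent_evalU; congr (_ * _ + _).
rewrite /mmap1 big_dord; apply: eq_bigr => i _.
have E b : Ordinal (half_ord_proof (dord (i, b))) = i.
  exact: (congr1 fst (dordK (i, b))).
have o b : odd (dord (i, b)) = b by exact: (congr1 snd (dordK (i, b))).
by rewrite !E !o ffunE expfzDr // -invr_expz -!exprnP exprVn.
Qed.

(** Inverting x_i exchanges the two variables that are specialised to x_i and to its
    inverse, so the action on exponents lifts to permutations of the 2n variables. *)
Definition dperm_fun (w : bc_group n) (j : 'I_n.*2) : 'I_n.*2 :=
  dord (w.1 (dinv j).1, (dinv j).2 (+) w.2 (dinv j).1).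

Fact dperm_inj w : injective (dperm_fun w).
Proof.
move=> j k /(can_inj dordK); case Ej: (dinv j) => [i b]; case Ek: (dinv k) => [i' b'].
move=> [/perm_inj /= e1]; rewrite e1 => /(@addIb _) e2.
by apply: (can_inj dinvK); rewrite Ej Ek e1 e2.
Qed.

Definition dperm w : 'S_(n.*2) := perm (@dperm_inj w).

Lemma pmexp_dperm w (m : 'X_{1..n.*2}) : pmexp [multinom m (dperm w j) | j < n.*2] = bc_act w (pmexp m).
Proof.
apply/ffunP => i; rewrite !ffunE !mnmE !permE /dperm_fun !dordK /=.
by case: (w.2 i); rewrite ?expr1 ?expr0 ?mul1r //= mulN1r opprB.
Qed.

Lemma coeff_pm_laurent p a :
  coeff a (pm_laurent p) = \sum_(m <- msupp p) p@_m * (pmexp m == a)%:R.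
Proof.
by rewrite /pm_laurent raddf_sum; apply: eq_bigr => m _ /=; rewrite coeffZ coeffU mul1r.
Qed.

Lemma pm_laurent_sym p : p \is symmetric -> bc_symmetric (pm_laurent p).
Proof.
move=> sp w a; rewrite !coeff_pm_laurent.
pose f (m : 'X_{1..n.*2}) := [multinom m (dperm w j) | j < n.*2].
have fi : injective f by exact: mperm_inj.
have ud : uniq (map f (msupp p)) by rewrite (map_inj_uniq fi) msupp_uniq.
have sub : {subset map f (msupp p) <= msupp p}.
  by move=> _ /mapP[m hm ->]; rewrite /f issym_msupp.
have szl : (size (msupp p) <= size (map f (msupp p)))%N by rewrite size_map.
rewrite [LHS](perm_big (map f (msupp p))) /=; last first.
  rewrite perm_sym; apply: uniq_perm; rewrite ?msupp_uniq //.
  exact: (uniq_min_size ud sub szl).2.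
rewrite big_map; apply: eq_bigr => m _; rewrite /f (msym_coeff _ _ sp) pmexp_dperm.
by rewrite (inj_eq (@bc_act_inj _ w)).
Qed.

Lemma dom_pm_laurent p a : a \in dom (pm_laurent p) -> exists2 m, m \in msupp p & a = pmexp m.
Proof.
rewrite mem_dom coeff_pm_laurent => h; apply: contrapT => nex; case/eqP: h.
rewrite big_seq big1 // => m hm; case: eqP => e; last by rewrite mulr0.
by case: nex; exists m.
Qed.

End PlusMinus.

Section MonoLaurent.
Variables (K : fieldType) (n : nat).
Implicit Types (la mu : intpart).

Lemma msupp_mono_sym N la (m : 'X_{1..N}) : m \in msupp (Defs.mono_sym K la N) ->
  perm_eq [seq k <- [seq m i | i <- enum 'I_N] | k != 0%N] la.
Proof.
rewrite mcoeff_msupp mcoeff_mono_sym (_ : [seq m i | i <- enum 'I_N] = m).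
  by case: perm_eq; rewrite ?eqxx.
by rewrite -[RHS]map_tnth_enum.
Qed.

(** The difference of the exponents of x_i and of its inverse is at most the larger of
    the two, and the entries so selected are distinct entries of a rearrangement of la. *)
Lemma mono_laurent_bounded la : exp_dom la (pm_laurent (Defs.mono_sym K la n.*2)).
Proof.
move=> a /dom_pm_laurent[m /msupp_mono_sym pm ->] A.
pose f (i : 'I_n) : 'I_n.*2 := dord (i, m (dord (i, false)) < m (dord (i, true)))%N.
have fi : injective f by move=> i j /(can_inj (@dordK n)) [].
apply: (@leq_trans (\sum_(i in A) m (f i))%N).
  apply: leq_sum => i _; rewrite ffunE /f; case: ltnP => h.
    by move: (m _) (m _) h => u v; lia.
  by move: (m _) (m _) h => u v; lia.
by rewrite -(big_imset _ (in2W fi)) -(card_imset _ fi); apply: sub_psum.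
Qed.

(** A cancellation between x_i and its inverse lowers the degree below |la|, so the
    monomial without inverses is the only one to contribute. *)
Lemma coeff_mono_laurent la : (size la <= n)%N ->
  coeff (part_exp n la) (pm_laurent (Defs.mono_sym K la n.*2)) = 1.
Proof.
move=> sz; rewrite coeff_pm_laurent.
(* the exponent without inverses *)
pose m0 : 'X_{1..n.*2} := [multinom (if odd j then 0 else pfun la j./2)%N | j < n.*2].
have m0E i b : m0 (dord (i, b)) = if b then 0%N else pfun la i.
  by rewrite mnmE -[odd _]/(dinv (dord (i, b))).2 -[_./2]/(nat_of_ord (dinv (dord (i, b))).1) dordK.
have m0s : (Defs.mono_sym K la n.*2)@_m0 = 1.
  rewrite mcoeff_mono_sym (_ : perm_eq _ _) //; apply/seq.permP => P.
  rewrite -[in RHS](filter_mkseq_pfun sz) !count_filter.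
  have -> : (m0 : seq nat) = [seq m0 j | j <- enum 'I_n.*2] by rewrite -[LHS]map_tnth_enum.
  rewrite /mkseq -val_enum_ord -map_comp [LHS]count_map [RHS]count_map -!sum1_count.
  rewrite !big_enum_cond /=.
  rewrite big_mkcond big_dord [RHS]big_mkcond /=; apply: eq_bigr => i _.
  by rewrite !m0E /= andbF addn0.
have uniq0 m : m \in msupp (Defs.mono_sym K la n.*2) -> pmexp m = part_exp n la -> m = m0.
  move=> /msupp_mono_sym pm e.
  have tot : (\sum_j m j = sumn la)%N.
    rewrite sumnE -(perm_big _ pm) big_filter big_map [RHS]big_mkcond /= big_enum /=.
    by apply: eq_bigr => i _; case: eqP => //= ->.
  have ei i : (m (dord (i, false)) = pfun la i + m (dord (i, true)))%N.
    by have := congr1 (fun f : {ffun 'I_n -> int} => f i) e; rewrite !ffunE prowE;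
      move: (m _) (m _) (pfun la i) => u v w' /=; lia.
  rewrite big_dord -(psum_sumn sz) /psum in tot.
  have z i : m (dord (i, true)) = 0%N.
    have : (\sum_(i < n) (m (dord (i, true))).*2 = 0)%N.
      apply/eqP; rewrite -(eqn_add2l (\sum_(i < n) pfun la i)%N) addn0 -{2}tot -big_split /=.
      by apply/eqP; apply: eq_bigr => j _; rewrite ei -addnn addnA.
    by move/eqP; rewrite sum_nat_eq0 => /forallP/(_ i) /=; rewrite double_eq0 => /eqP.
  apply/mnmP => j; rewrite -(dinvK j); case: (dinv j) => i b; rewrite m0E.
  by case: b; rewrite ?z // ei z addn0.
have m0in : m0 \in msupp (Defs.mono_sym K la n.*2) by rewrite mcoeff_msupp m0s oner_eq0.
have e0 : pmexp m0 = part_exp n la.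
  by apply/ffunP => i; rewrite !ffunE !m0E prowE subr0.
rewrite (bigD1_seq m0) ?msupp_uniq //= m0s e0 eqxx mulr1 big_seq_cond big1 ?addr0 //.
move=> m /andP[hm nm]; rewrite (_ : (pmexp m == _) = false) ?mulr0 //.
by apply: contraNF nm => /eqP /(uniq0 m hm) ->.
Qed.

(** The value f(x_1, 1/x_1, ..., x_n, 1/x_n). *)
Definition sf_laurent (f : symfun K) : laurent K n := pm_laurent (sf f n.*2).

Lemma sf_laurentD f g : sf_laurent (f + g) = sf_laurent f + sf_laurent g.
Proof. exact: pm_laurentD. Qed.

Lemma sf_laurentZ c f : sf_laurent (c *: f) = c *: sf_laurent f.
Proof. exact: pm_laurentZ. Qed.

Lemma sf_laurent_sum I (r : seq I) (F : I -> symfun K) :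
  sf_laurent (\sum_(i <- r) F i) = \sum_(i <- r) sf_laurent (F i).
Proof.
elim: r => [|i r IHr]; first by rewrite !big_nil; exact: pm_laurent0.
by rewrite !big_cons sf_laurentD IHr.
Qed.

Lemma sf_laurent_sym f : bc_symmetric (sf_laurent f).
Proof. exact/pm_laurent_sym/sf_sym. Qed.

Section Triangular.
Variables (la : intpart) (r : seq (K * intpart)).
Hypothesis hr : forall c, c \in r -> dom_lt c.2 la.
Let f := mono_fun K la + \sum_(c <- r) c.1 *: mono_fun K c.2.

Lemma sf_laurent_bounded : exp_dom la (sf_laurent f).
Proof.
rewrite sf_laurentD sf_laurent_sum; apply: exp_boundedD.
  exact: mono_laurent_bounded.
apply: exp_bounded_sum => c /hr[le _]; rewrite sf_laurentZ; apply: exp_boundedZ.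
exact: exp_domW le (@mono_laurent_bounded _).
Qed.

Lemma coeff_sf_laurent : (size la <= n)%N -> coeff (part_exp n la) (sf_laurent f) = 1.
Proof.
move=> sz; rewrite sf_laurentD sf_laurent_sum coeffD coeff_mono_laurent //.
rewrite raddf_sum /= big_seq big1 ?addr0 // => c /hr[le ne].
rewrite sf_laurentZ coeffZ; apply/eqP; rewrite mulf_eq0; apply/orP; right.
apply: contra_notT ne => /(coeff_exp_dom (@mono_laurent_bounded _) sz) le'.
exact: dom_le_anti.
Qed.
End Triangular.
End MonoLaurent.

(** * Values of rational functions *)

Section RatFun.
Variables (K : fieldType) (c : K).
Implicit Types (f g : ratfun K) (a u v : K).

Local Notation tf := (@tofrac {poly K}).

Lemma horner_neq0 (r : {poly K}) : r.[c] != 0 -> r != 0.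
Proof. by apply: contraNneq => ->; rewrite horner0. Qed.

Lemma tf_neq0 (r : {poly K}) : r != 0 -> tf r != 0.
Proof. by rewrite tofrac_eq0. Qed.

Lemma ratfun_at_uniq f u v : ratfun_at c f u -> ratfun_at c f v -> u = v.
Proof.
move=> [p [r [nr ef ->]]] [p' [r' [nr' ef' ->]]].
have nR := tf_neq0 (horner_neq0 nr); have nR' := tf_neq0 (horner_neq0 nr').
have : tf (p * r') = tf (p' * r).
  rewrite !tofracM; apply/eqP; rewrite -(eqr_div _ _ nR nR'); apply/eqP.
  by rewrite -ef -ef'.
move/eqP; rewrite tofrac_eq => /eqP /(congr1 (fun w => w.[c])); rewrite !hornerM => e.
by apply/eqP; rewrite (eqr_div _ _ nr nr') e.
Qed.

Lemma ratfun_at_poly (p : {poly K}) : ratfun_at c (tf p) p.[c].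
Proof. by exists p, 1; rewrite hornerC oner_eq0 tofrac1 !divr1. Qed.

Lemma ratfun_at_cst a : ratfun_at c (cst a) a.
Proof. by have := ratfun_at_poly a%:P; rewrite hornerC. Qed.

Lemma ratfun_at0 : ratfun_at c 0 0.
Proof. by have := ratfun_at_poly 0; rewrite tofrac0 horner0. Qed.

Lemma ratfun_at1 : ratfun_at c 1 1.
Proof. by have := ratfun_at_poly 1; rewrite tofrac1 hornerC. Qed.

Lemma ratfun_at_var : ratfun_at c (var K) c.
Proof. by have := ratfun_at_poly 'X; rewrite hornerX. Qed.

Lemma ratfun_atD f g u v : ratfun_at c f u -> ratfun_at c g v -> ratfun_at c (f + g) (u + v).
Proof.
move=> [p [r [nr -> ->]]] [p' [r' [nr' -> ->]]].
have nR := tf_neq0 (horner_neq0 nr); have nR' := tf_neq0 (horner_neq0 nr').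
exists (p * r' + p' * r), (r * r'); split; first by rewrite hornerM mulf_neq0.
  rewrite tofracD !tofracM; exact: (addf_div _ _ nR nR').
by rewrite hornerD !hornerM addf_div.
Qed.

Lemma ratfun_atM f g u v : ratfun_at c f u -> ratfun_at c g v -> ratfun_at c (f * g) (u * v).
Proof.
move=> [p [r [nr -> ->]]] [p' [r' [nr' -> ->]]].
exists (p * p'), (r * r'); split; first by rewrite hornerM mulf_neq0.
  rewrite !tofracM; exact: mulf_div.
by rewrite !hornerM mulf_div.
Qed.

Lemma ratfun_atN f u : ratfun_at c f u -> ratfun_at c (- f) (- u).
Proof.
move=> [p [r [nr -> ->]]]; exists (- p), r; split=> //; first by rewrite tofracN mulNr.
by rewrite hornerN mulNr.
Qed.

Lemma ratfun_atB f g u v : ratfun_at c f u -> ratfun_at c g v -> ratfun_at c (f - g) (u - v).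
Proof. by move=> h h'; apply/ratfun_atD/ratfun_atN. Qed.

Lemma ratfun_atV f u : u != 0 -> ratfun_at c f u -> ratfun_at c f^-1 u^-1.
Proof.
move=> nu [p [r [nr -> eu]]]; exists r, p; split; last by rewrite eu invf_div.
  by apply: contra_neq nu => e; rewrite eu e mul0r.
by rewrite invf_div.
Qed.

Lemma ratfun_at_div f g u v : v != 0 -> ratfun_at c f u -> ratfun_at c g v ->
  ratfun_at c (f / g) (u / v).
Proof. by move=> nv h h'; apply: ratfun_atM => //; apply: ratfun_atV. Qed.

Lemma ratfun_atX f u k : ratfun_at c f u -> ratfun_at c (f ^+ k) (u ^+ k).
Proof.
move=> h; elim: k => [|k IHk]; first by rewrite !expr0; exact: ratfun_at1.
by rewrite !exprS; apply: ratfun_atM.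
Qed.

Lemma ratfun_atXV f u k : u != 0 -> ratfun_at c f u -> ratfun_at c (f ^- k) (u ^- k).
Proof. by move=> nu h; apply: ratfun_atV; [rewrite expf_neq0|apply: ratfun_atX]. Qed.

Lemma ratfun_atXz f u (k : int) : u != 0 -> ratfun_at c f u -> ratfun_at c (f ^ k) (u ^ k).
Proof.
move=> nu h; case: k => k; first by rewrite -!exprnP; apply: ratfun_atX.
by rewrite NegzE -!exprnN; apply: ratfun_atXV.
Qed.

Lemma ratfun_at_sum (I : eqType) (r : seq I) (F : I -> ratfun K) (G : I -> K) :
  (forall i, i \in r -> ratfun_at c (F i) (G i)) ->
  ratfun_at c (\sum_(i <- r) F i) (\sum_(i <- r) G i).
Proof.
elim: r => [|i r IHr] h; first by rewrite !big_nil; exact: ratfun_at0.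
rewrite !big_cons; apply: ratfun_atD; first by apply: h; rewrite mem_head.
by apply: IHr => j jr; apply: h; rewrite inE jr orbT.
Qed.

Lemma ratfun_at_prod (I : eqType) (r : seq I) (F : I -> ratfun K) (G : I -> K) :
  (forall i, i \in r -> ratfun_at c (F i) (G i)) ->
  ratfun_at c (\prod_(i <- r) F i) (\prod_(i <- r) G i).
Proof.
elim: r => [|i r IHr] h; first by rewrite !big_nil; exact: ratfun_at1.
rewrite !big_cons; apply: ratfun_atM; first by apply: h; rewrite mem_head.
by apply: IHr => j jr; apply: h; rewrite inE jr orbT.
Qed.

End RatFun.

Lemma ratfun_at_neq0 (K : fieldType) (c : K) (f : ratfun K) v :
  ratfun_at c f v -> v != 0 -> f != 0.
Proof.
move=> h nv; apply: contra_neq nv => f0; rewrite f0 in h.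
exact: ratfun_at_uniq h (ratfun_at0 c).
Qed.

(** The numerator of f has infinitely many roots. *)
Lemma ratfun_eq0 (K : fieldType) (x : nat -> K) N0 (f : ratfun K) :
    injective x -> (forall N, (N0 <= N)%N -> ratfun_at (x N) f 0) -> f = 0.
Proof.
move=> xi h; have [p [r [nr ef _]]] := h N0 (leqnn _).
have nR := tf_neq0 (horner_neq0 nr).
suff p0 : p = 0 by rewrite ef p0 tofrac0 mul0r.
apply/eqP; apply: contraT => np; pose s := [seq x N | N <- iota N0 (size p)].
have us : uniq s by rewrite map_inj_uniq ?iota_uniq.
have rs : all (root p) s.
  apply/allP => z /mapP[N hN ->]; move: hN; rewrite mem_iota => /andP[le _].
  have [p' [r' [nr' ef' /esym/eqP e0]]] := h N le.
  rewrite mulf_eq0 invr_eq0 (negPf nr') orbF in e0.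
  have nR' := tf_neq0 (horner_neq0 nr').
  have : tofrac (p * r') = tofrac (p' * r) :> ratfun K.
    rewrite !tofracM; apply/eqP; rewrite -(eqr_div _ _ nR nR'); apply/eqP.
    by rewrite -ef -ef'.
  move/eqP; rewrite tofrac_eq => /eqP /(congr1 (fun w => w.[x N])).
  rewrite !hornerM (eqP e0) mul0r => /eqP; rewrite mulf_eq0 (negPf nr') orbF.
  by rewrite rootE.
by have := max_poly_roots np rs us; rewrite size_map size_iota ltnn.
Qed.

(** * Brackets under specialisation of T *)

Section PowerSumInduction.
Variables (K : fieldType) (char0 : [pchar K] =i pred0).

(** In characteristic 0 Newton's identities express the elementary symmetric functions
    through the power sums. *)
Lemma psum_ind (P : symfun K -> Prop) :
    (forall c, P (c *: 1)) -> (forall f g, P f -> P g -> P (f + g)) ->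
    (forall f g, P f -> P g -> P (f * g)) -> (forall k, P (psumS K k)) ->
  forall f, P f.
Proof.
move=> P1 PD PM Pp.
have PZ c f : P f -> P (c *: f) by move=> h; rewrite -[f]mul1r scalerAl; apply/PM.
have P0 : P 0 by rewrite -(scale0r 1); apply: P1.
have P1' : P 1 by rewrite -(scale1r 1); apply: P1.
have Psum I (r : seq I) F : (forall i, P (F i)) -> P (\sum_(i <- r) F i).
  by move=> h; elim/big_ind: _ => // *; apply: h.
have Pe k : P (esym_fun K k).
  elim/ltn_ind: k => -[|k] IHk.
    by rewrite (_ : esym_fun K 0 = 1) //; apply: symfunP => n /=; rewrite mesym0E.
  have nz : k.+1%:R != 0 :> K by move/pcharf0P: char0 => ->.
  rewrite -[esym_fun _ _]scale1r -(mulVf nz) -scalerA newton_fun; apply/PZ.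
  apply/Psum => i; apply/PZ; apply/PM => //; apply: IHk.
  by rewrite ltnS leq_subr.
move=> f; have [d [u ->]] := symfun_esym f; apply/Psum => m; apply/PZ.
elim/big_ind: _ => // i _; elim: (m i) => [|k IHk]; first by rewrite expr0.
by rewrite exprS; apply/PM.
Qed.
End PowerSumInduction.

Section MapSymfun.
Variables (K L : fieldType) (io : {rmorphism K -> L}).

Fact lift_sym (f : symfun K) n : map_mpoly io (sf f n) \is symmetric.
Proof.
apply/issymP => w; apply/mpolyP => m.
by rewrite mcoeff_sym !mcoeff_map_mpoly -mcoeff_sym (issymP _ (sf_sym f n)).
Qed.

Fact lift_restr (f : symfun K) n : mrestr (map_mpoly io (sf f n.+1)) = map_mpoly io (sf f n).
Proof.
apply/mpolyP => m; rewrite mcoeff_mrestr !mcoeff_map_mpoly -mcoeff_mrestr.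
by rewrite sf_restr.
Qed.

Fact lift_bound (f : symfun K) : exists d, forall n, (msize (map_mpoly io (sf f n)) <= d)%N.
Proof.
have [d fd] := sf_bound f; exists d => n; apply: leq_trans (fd n).
rewrite /mmeasure (perm_big _ (msupp_map_mpoly _ _)) //; exact: fmorph_inj.
Qed.

Definition lift_sf (f : symfun K) : symfun L :=
  SymFun (lift_sym f) (lift_restr f) (lift_bound f).

Lemma lift_sfD f g : lift_sf (f + g) = lift_sf f + lift_sf g.
Proof. by apply: symfunP => n /=; rewrite rmorphD. Qed.

Lemma lift_sfM f g : lift_sf (f * g) = lift_sf f * lift_sf g.
Proof. by apply: symfunP => n /=; rewrite rmorphM. Qed.

Lemma lift_sfC c : lift_sf (c *: 1) = io c *: 1.
Proof.
apply: symfunP => n; apply/mpolyP => m.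
by rewrite mcoeff_map_mpoly !mcoeffZ !mcoeff1 /= rmorphM rmorph_nat.
Qed.

Lemma lift_psumS k : lift_sf (psumS K k) = psumS L k.
Proof.
apply: symfunP => n /=; rewrite /psum_poly raddf_sum /=; apply: eq_bigr => i _.
by rewrite rmorphXn /= map_mpolyX.
Qed.

Lemma lift_mono la : lift_sf (mono_fun K la) = mono_fun L la.
Proof.
apply: symfunP => n; apply/mpolyP => m.
by rewrite mcoeff_map_mpoly /= !mcoeff_mono_sym rmorph_nat.
Qed.

End MapSymfun.

Section LiftSymfun.
Variable K : fieldType.
Local Notation L := (ratfun K).

Definition cst_morph : {rmorphism K -> L} := (@tofrac {poly K} \o @polyC K).

(** The functions for which this holds form an algebra that contains the power
    sums. *)
Lemma psum_spec_lift (char0 : [pchar K] =i pred0) (c : K) (a : nat -> L) (a' : nat -> K) :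
    (forall k, ratfun_at c (a k) (a' k)) ->
  forall f, ratfun_at c (psum_spec (pchar_ratfun char0) a (lift_sf cst_morph f)) (psum_spec char0 a' f).
Proof.
move=> ha; apply: psum_ind => // [x|f g hf hg|f g hf hg|k].
- rewrite lift_sfC !linearZ !rmorph1 /=.
  by rewrite -[_ *: _]/(_ * _) -[x *: _]/(_ * _) !mulr1; exact: (ratfun_at_cst c x).
- by rewrite lift_sfD !raddfD; apply: ratfun_atD.
- by rewrite lift_sfM !rmorphM; apply: ratfun_atM.
by rewrite lift_psumS !psum_specE.
Qed.
End LiftSymfun.

Section Bracket.
Variables (K : fieldType) (char0 : [pchar K] =i pred0) (q t s : K).
Hypotheses (nq : q != 0) (nt : t != 0) (ns : s != 0).
Hypothesis tX : forall k, t ^+ k.+1 != 1.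
Implicit Types (la mu : intpart).
Local Notation L := (ratfun K).
Local Notation charL := (pchar_ratfun char0).

Lemma bracket_psum_at (c : K) mu k : c != 0 ->
  ratfun_at c (bracket_psum (cst q) (cst t) (cst s) (var K) mu k.+1)
              (bracket_psum q t s c mu k.+1).
Proof.
move=> nc; have C := ratfun_at_cst c; have V := ratfun_at_var c.
have cX : c ^+ k.+1 != 0 by rewrite expf_neq0.
have sc : s * c != 0 by rewrite mulf_neq0.
have t1 : 1 - t ^+ k.+1 != 0 by rewrite subr_eq0 eq_sym.
have t2 : 1 - 1 / t ^+ k.+1 != 0.
  rewrite subr_eq0; apply/eqP => e; have /eqP := tX k; apply.
  by rewrite -[LHS]mul1r e divfK // expf_neq0.
have tn : t ^+ k.+1 != 0 by rewrite expf_neq0.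
have O := ratfun_at1 c.
have S : ratfun_at c (cst s * var K) (s * c) by apply: ratfun_atM.
rewrite /bracket_psum; apply: ratfun_atD; first apply: ratfun_atD.
- apply: ratfun_at_sum => i _; apply: ratfun_atD; apply: ratfun_atM.
  + apply: ratfun_atM; last exact: ratfun_atXV.
    by apply: ratfun_atB => //; apply: ratfun_atX.
  + exact: ratfun_atX.
  + apply: ratfun_atM; last exact: ratfun_atX.
    by apply: ratfun_atB => //; apply: ratfun_atXV.
  + exact: ratfun_atXV.
- apply: ratfun_atM; first exact: ratfun_atX.
  apply: ratfun_at_div => //; apply: ratfun_atB => //; exact: ratfun_atX.
apply: ratfun_atM; first exact: ratfun_atXV.
apply: ratfun_at_div => //; apply: ratfun_atB => //; apply: ratfun_at_div => //; exact: ratfun_atX.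
Qed.

Lemma sf_bracket_lift c mu f : c != 0 ->
  ratfun_at c (sf_bracket charL (cst q) (cst t) (cst s) (var K) mu (lift_sf (cst_morph K) f))
              (sf_bracket char0 q t s c mu f).
Proof. by move=> nc; apply: psum_spec_lift => k; apply: bracket_psum_at. Qed.

Lemma sf_bracketD (T : K) mu f g :
  sf_bracket char0 q t s T mu (f + g) = sf_bracket char0 q t s T mu f + sf_bracket char0 q t s T mu g.
Proof. exact: raddfD. Qed.

Lemma sf_bracketZ (T : K) mu x f :
  sf_bracket char0 q t s T mu (x *: f) = x * sf_bracket char0 q t s T mu f.
Proof. by rewrite /sf_bracket linearZ. Qed.

Lemma sf_bracket_sum (T : K) mu I (r : seq I) (F : I -> symfun K) :
  sf_bracket char0 q t s T mu (\sum_(i <- r) F i) = \sum_(i <- r) sf_bracket char0 q t s T mu (F i).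
Proof. by rewrite /sf_bracket raddf_sum. Qed.

(** At T = t^n the two fractions are geometric sums, which supply the constant terms
    that the subtraction of 1 removes from the n coordinates. *)
Lemma bracket_psum_tn n mu k : (size mu <= n)%N ->
  bracket_psum q t s (t ^+ n) mu k.+1 =
  \sum_(i < n) ((gpoint q t s mu i) ^+ k.+1 + (gpoint q t s mu i) ^- k.+1).
Proof.
move=> sz; pose m := k.+1.
have t1 : 1 - t ^+ m != 0 by rewrite subr_eq0 eq_sym; exact: tX.
have tn : t ^+ m != 0 by rewrite expf_neq0.
have t2 : 1 - 1 / t ^+ m != 0.
  rewrite subr_eq0; apply/eqP => e; have /eqP := tX k; apply.
  by rewrite -[LHS]mul1r e divfK // expf_neq0.
have geo (y : K) : 1 - y != 0 -> (1 - y ^+ n) / (1 - y) = \sum_(i < n) y ^+ (n - i.+1).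
  move=> ny; apply: (mulIf ny); rewrite divfK // [RHS]mulrC.
  rewrite -[1 - y ^+ n]opprB subrX1 -mulNr opprB; congr (_ * _).
  rewrite [RHS](reindex_inj rev_ord_inj) /=; apply: eq_bigr => i _.
  by rewrite subnSK ?ltn_ord // subKn // ltnW.
rewrite /bracket_psum -/m.
have -> : (1 - t ^+ n ^+ m) / (1 - t ^+ m) = \sum_(i < n) (t ^+ m) ^+ (n - i.+1).
  by rewrite -geo // -!exprM mulnC.
have -> : (1 - 1 / t ^+ n ^+ m) / (1 - 1 / t ^+ m) = \sum_(i < n) (1 / t ^+ m) ^+ (n - i.+1).
  by rewrite -geo // !div1r exprVn -!exprM mulnC.
rewrite big_add1 /= big_mkord.
have -> : \sum_(i < size mu)
   ((q ^+ (m * prow mu i.+1) - 1) * t ^- (m * i.+1) * (s * t ^+ n) ^+ m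
    + (q ^- (m * prow mu i.+1) - 1) * t ^+ (m * i.+1) * (s * t ^+ n) ^- m) =
  \sum_(i < n)
   ((q ^+ (m * prow mu i.+1) - 1) * t ^- (m * i.+1) * (s * t ^+ n) ^+ m
    + (q ^- (m * prow mu i.+1) - 1) * t ^+ (m * i.+1) * (s * t ^+ n) ^- m).
  rewrite (big_ord_widen n (fun i => (q ^+ (m * prow mu i.+1) - 1) * t ^- (m * i.+1) * (s * t ^+ n) ^+ m
    + (q ^- (m * prow mu i.+1) - 1) * t ^+ (m * i.+1) * (s * t ^+ n) ^- m) sz).
  rewrite big_mkcond /=; apply: eq_bigr => i _; case: ltnP => // ge.
  by rewrite /prow nth_default // muln0 expr0 invr1 subrr !mul0r addr0.
rewrite !mulr_sumr -!big_split /=; apply: eq_bigr => i _; rewrite /gpoint.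
have e : (t ^+ n) ^+ m = t ^+ (m * i.+1) * (t ^+ m) ^+ (n - i.+1).
  by rewrite -!exprM -exprD -mulnDr subnKC ?ltn_ord // mulnC.
have e' : (q ^+ prow mu i.+1 * t ^+ (n - i.+1) * s) ^+ m =
    q ^+ (m * prow mu i.+1) * (t ^+ m) ^+ (n - i.+1) * s ^+ m.
  by rewrite !exprMn -!exprM [(prow _ _ * _)%N]mulnC [((n - _) * _)%N]mulnC.
rewrite e' exprMn e div1r exprVn.
have n1 : t ^+ (m * i.+1) != 0 by rewrite expf_neq0.
have n2 : (t ^+ m) ^+ (n - i.+1) != 0 by rewrite !expf_neq0.
have n3 : s ^+ m != 0 by rewrite expf_neq0.
have n4 : q ^+ (m * prow mu i.+1) != 0 by rewrite expf_neq0.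
move: n1 n2 n3 n4; move: (t ^+ (m * _)) ((t ^+ m) ^+ _) (s ^+ m) (q ^+ _) => A B C D n1 n2 n3 n4.
by field; rewrite n1 n2 n3 n4.
Qed.

Lemma sf_bracket_tn n mu f : (size mu <= n)%N ->
    (forall i : 'I_n, gpoint q t s mu i != 0) ->
  sf_bracket char0 q t s (t ^+ n) mu f = laurent_eval id (gpoint q t s mu) (sf_laurent n f).
Proof.
move=> sz ng.
rewrite [RHS](eval_pm_laurent (@idfun K : {rmorphism K -> K}) _ ng).
set v := fun j : 'I_n.*2 => _; change (sf_bracket char0 q t s (t ^+ n) mu f = (sf f n.*2).@[v]).
move: f; apply: (psum_ind char0) => [x|f g hf hg|f g hf hg|k].
- by rewrite sf_bracketZ /sf_bracket rmorph1 sfEZ mevalZ meval1.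
- by rewrite sf_bracketD hf hg sfED mevalD.
- by rewrite /sf_bracket rmorphM sfEM mevalM -hf -hg.
rewrite /sf_bracket psum_specE bracket_psum_tn //= /psum_poly raddf_sum /= big_dord /=.
apply: eq_bigr => i _; rewrite !rmorphXn /= !mevalXU /v.
have E b : Ordinal (half_ord_proof (dord (i, b))) = i by exact: (congr1 fst (dordK (i, b))).
have o b : odd (dord (i, b)) = b by exact: (congr1 snd (dordK (i, b))).
by rewrite !E !o exprVn.
Qed.

End Bracket.

(** * The product formula for the diagonal values *)

Definition hookval (K : fieldType) (q t s T : K) (la : intpart) : K :=
  (q * s * T / t) ^- sumn la * t ^+ nstat la * q ^- (2 * nstat (pconj la))
  * Cminus q t la q * Cplus q t la ((s * T / t) ^+ 2).

Section HookValue.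
Variables (K : fieldType) (q t s : K).
Hypothesis gs : generic q t 1 s.
Implicit Types (la : intpart) (c : K).

Let nq : q != 0. Proof. by case: gs => -[]. Qed.
Let nt : t != 0. Proof. by case: gs => -[]. Qed.
Let ns : s != 0. Proof. by case: gs => -[]. Qed.

(** Values of T at which the lifted functions are regular: [hookval_neq0] shows
    that the values by which their construction divides do not vanish there. *)
Definition admissible c : Prop := c != 0 /\ forall a b : int, q ^ a * t ^ b * (s * c) ^+ 2 != 1.

Lemma admissible_tn n : admissible (t ^+ n).
Proof.
split=> [|a b]; first by rewrite expf_neq0.
have -> : q ^ a * t ^ b * (s * t ^+ n) ^+ 2 = q ^ a * t ^ (b + (n * 2)%:Z) * s ^+ 2.
  by rewrite expfzDr // -exprnP exprM exprMn; ring.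
exact: generic_s gs _ _.
Qed.

Lemma hookval_at c la : admissible c ->
  ratfun_at c (hookval (cst q) (cst t) (cst s) (var K) la) (hookval q t s c la).
Proof.
move=> [nc _]; have C := ratfun_at_cst c; have V := ratfun_at_var c.
have O := ratfun_at1 c.
have n1 : q * s * c / t != 0 by rewrite !mulf_neq0 ?invr_eq0.
have H1 : ratfun_at c (cst q * cst s * var K / cst t) (q * s * c / t).
  by apply: ratfun_at_div => //; apply: ratfun_atM => //; apply: ratfun_atM.
have H2 : ratfun_at c ((cst s * var K / cst t) ^+ 2) ((s * c / t) ^+ 2).
  by apply: ratfun_atX; apply: ratfun_at_div => //; apply: ratfun_atM.
rewrite /hookval; do 4?[apply: ratfun_atM].
- exact: ratfun_atXV.
- exact: ratfun_atX.
- exact: ratfun_atXV.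
- apply: ratfun_at_prod => i _; apply: ratfun_at_prod => j _; apply: ratfun_atB => //.
  by apply: ratfun_atM => //; apply: ratfun_atM; apply: ratfun_atXz.
apply: ratfun_at_prod => i _; apply: ratfun_at_prod => j _; apply: ratfun_atB => //.
by apply: ratfun_atM => //; apply: ratfun_atM; apply: ratfun_atXz.
Qed.

Lemma hookval_neq0 c la : admissible c -> hookval q t s c la != 0.
Proof.
move=> [nc gc]; have n1 : q * s * c / t != 0 by rewrite !mulf_neq0 ?invr_eq0.
rewrite /hookval; do ?apply: mulf_neq0; rewrite ?invr_eq0 ?expf_neq0 //.
  rewrite prodf_seq_neq0; apply/allP => i _; rewrite prodf_seq_neq0; apply/allP => j.
  rewrite mem_index_iota ltnS => /andP[j0 ji] /=; rewrite subr_eq0 eq_sym.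
  apply/eqP => e.
  have : q ^ ((prow la i)%:Z - j%:Z + 1) * t ^ ((prow (pconj la) j)%:Z - i%:Z) = 1.
    by rewrite expfzDr // expr1z -[RHS]e; ring.
  by case/(generic_qt gs); move: ji; move: (prow la i) => m; lia.
rewrite prodf_seq_neq0; apply/allP => i _; rewrite prodf_seq_neq0; apply/allP => j _ /=.
rewrite subr_eq0 eq_sym.
move: ((prow la i)%:Z + _ - _) (2 - _ - _) => a b.
have := gc a (b - 2%:Z); apply: contra_neq => e; rewrite -[RHS]e.
rewrite expfzDr // -invr_expz -exprnP.
by field; rewrite nt.
Qed.

Lemma pconjE la n (j : nat) : (size la <= n)%N -> (j < pfun la 0)%N ->
  prow (pconj la) j.+1 = colsize n (pfun la) j.
Proof.
move=> sz lt; have h0 : head 0%N la = pfun la 0 by rewrite -nth0.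
rewrite /prow /pconj /= (nth_map 0%N) ?size_iota ?h0 // nth_iota ?h0 //.
rewrite -sum1_count /colsize (big_nth 0%N) big_mkord big_mkcond /= add1n.
rewrite [RHS](@sum_trunc (fun i => (j < pfun la i) : nat) _ _ sz) => [|i ge].
  by apply: eq_bigr => i _; rewrite -/(pfun la i); case: ltnP.
by rewrite /pfun nth_default.
Qed.

Lemma nstatE la n : (size la <= n)%N -> nstat la = (\sum_(i < n) i * pfun la i)%N.
Proof.
move=> sz; rewrite /nstat big_add1 /= big_mkord.
rewrite [RHS](@sum_trunc (fun i => i * pfun la i)%N _ _ sz) => [|i ge].
  by apply: eq_bigr => i _; rewrite subn1 /= prowE.
by rewrite /pfun nth_default ?muln0.
Qed.

Lemma pfun_le0 la i : (pfun la i <= pfun la 0)%N.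
Proof. exact: ispart_le (pfun_ispart (leqnn _)) (leq0n i). Qed.

(** A row of length m contributes 0 + 1 + ... + (m - 1) to the statistic of the
    conjugate, and twice this plus m is the square of m. *)
Lemma nstat_pconjE la n : (size la <= n)%N ->
  (2 * nstat (pconj la) + sumn la = \sum_(i < n) pfun la i ^ 2)%N.
Proof.
move=> sz; have szc : size (pconj la) = pfun la 0 by rewrite size_map size_iota -nth0.
have -> : nstat (pconj la) = (\sum_(j < pfun la 0) j * colsize n (pfun la) j)%N.
  rewrite /nstat szc big_add1 /= big_mkord; apply: eq_bigr => j _.
  by rewrite subn1 /= (pconjE sz).
have -> : (\sum_(j < pfun la 0) j * colsize n (pfun la) j =
           \sum_(i < n) \sum_(j < pfun la i) j)%N.
  under eq_bigr => j _ do rewrite /colsize big_distrr /=.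
  rewrite exchange_big /=; apply: eq_bigr => i _.
  rewrite (big_ord_widen _ (fun j => j) (pfun_le0 la i)) [RHS]big_mkcond /=.
  by apply: eq_bigr => j _; case: ifP; rewrite ?muln1 ?muln0.
rewrite -(psum_sumn sz) /psum big_distrr -big_split /=; apply: eq_bigr => i _.
elim: (pfun la i) => [|m IHm]; first by rewrite big_ord0.
by rewrite big_ord_recr /= mulnDr; move: IHm; rewrite !expnS !expn0; lia.
Qed.

(** With x the i-th coordinate of the grid point of la, and y the coordinate subtracted
    at box (i, j), the factor x + 1/x - y - 1/y is (1 - x / y) (1 - x y) / x. The first
    two are the factors of C^- and C^+ for this box, and the monomials 1 / x multiply up
    to the remaining power of q, s, T and t. *)
Lemma hookval_tn n la : (size la <= n)%N ->
  hookval q t s (t ^+ n) la = diagval q t 1 n s (pfun la).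
Proof.
move=> sz; set lam := pfun la.
have pla : ispart n lam by apply: pfun_ispart.
pose x (i : nat) := gridx q t n s lam i.
have nx i : x i != 0 by apply: (gridx_neq0 gs).
pose A (i j : nat) := q ^ (lam i)%:Z * q ^ (- j%:Z) * t ^ ((colsize n lam j)%:Z - i.+1%:Z).
pose B (i j : nat) := q ^ (lam i + j)%:Z * t ^ ((n - i.+1)%:Z + (n - colsize n lam j)%:Z) * s ^+ 2.
have E : diagval q t 1 n s lam =
    \prod_(i < n) \prod_(j < lam i) (1 - A i j) *
    \prod_(i < n) \prod_(j < lam i) (1 - B i j) * \prod_(i < n) (x i) ^- lam i.
  rewrite -!big_split /=; apply: eq_bigr => i _.
  have -> : x i ^- lam i = \prod_(j < lam i) (x i)^-1 by rewrite prodr_const card_ord exprVn.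
  rewrite -!big_split /=; apply: eq_bigr => j _.
  set y := q ^+ j * t ^+ (n - colsize n lam j) * s.
  have ny : y != 0 by rewrite !mulf_neq0 ?expf_neq0.
  have -> : A i j = x i / y.
    rewrite /A /x /gridx /y expfzDr // -!invr_expz -!exprnP.
    have eB k : (k <= n)%N -> t ^+ (n - k) = t ^+ n / t ^+ k.
      move=> h; apply: (mulIf (expf_neq0 k nt)).
      by rewrite divfK ?expf_neq0 // -exprD subnK.
    have e1 := eB _ (ltn_ord i); have e2 := eB _ (colsize_le n lam j).
    by rewrite e1 e2; field; rewrite ns !expf_neq0.
  have -> : B i j = x i * y.
    rewrite /B /x /gridx /y expfzDr // -!exprnP exprD; ring.
  rewrite /zpt -/(x i) /zfun; field.
  by rewrite nx ny.
rewrite E /hookval; clear E.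
have lam0 i : (lam i <= lam 0%N)%N by apply: pfun_le0.
have -> : Cminus q t la q = \prod_(i < n) \prod_(j < lam i) (1 - A i j).
  rewrite /Cminus big_add1 /= big_mkord.
  pose F i := \prod_(j < lam i) (1 - A i j).
  rewrite (eq_bigr (fun i : 'I_(size la) => F i)) => [|i _]; last first.
    rewrite /F big_add1 /= big_mkord prowE; apply: eq_bigr => j _; congr (1 - _).
    rewrite (pconjE sz); last exact: leq_trans (ltn_ord j) (lam0 i).
    rewrite /A !expfzDr // -!invr_expz -!exprnP [q ^+ j.+1]exprS -/lam.
    by field; rewrite nq !expf_neq0.
  rewrite (big_ord_widen n F sz) big_mkcond /=; apply: eq_bigr => i _; case: ltnP => // ge.
  by rewrite /lam /pfun nth_default // big_ord0.
have -> : Cplus q t la ((s * t ^+ n / t) ^+ 2) = \prod_(i < n) \prod_(j < lam i) (1 - B i j).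
  rewrite /Cplus big_add1 /= big_mkord.
  pose F i := \prod_(j < lam i) (1 - B i j).
  rewrite (eq_bigr (fun i : 'I_(size la) => F i)) => [|i _]; last first.
    have lt_i : (i < n)%N := leq_trans (ltn_ord i) sz.
    rewrite /F big_add1 /= big_mkord prowE; apply: eq_bigr => j _; congr (1 - _).
    rewrite (pconjE sz); last exact: leq_trans (ltn_ord j) (lam0 i).
    rewrite /B -/lam (_ : (lam i)%:Z + j.+1%:Z - 1 = (lam i + j)%:Z); last by lia.
    have := colsize_le n lam j; move: (colsize n lam j) => m mn.
    have -> : (n - i.+1)%:Z + (n - m)%:Z = (n * 2)%:Z + (- m%:Z - i.+1%:Z) by lia.
    have -> : 2 - m%:Z - i.+1%:Z = 2%:Z + (- m%:Z - i.+1%:Z) :> int by lia.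
    rewrite ![t ^ (_%:Z + _)]expfzDr // -!exprnP exprM.
    by field; rewrite nt.
  rewrite (big_ord_widen n F sz) big_mkcond /=; apply: eq_bigr => i _; case: ltnP => // ge.
  by rewrite /lam /pfun nth_default // big_ord0.
rewrite -[LHS]mulrA [LHS]mulrC; congr (_ * _).
have -> : \prod_(i < n) x i ^- lam i = (\prod_(i < n) x i ^+ lam i)^-1.
  by rewrite prodfV.
have eX : \prod_(i < n) (x i ^+ lam i * t ^+ (i * lam i)) =
    q ^+ (2 * nstat (pconj la) + sumn la) * (s * t ^+ n / t) ^+ sumn la.
  rewrite (nstat_pconjE sz) -(psum_sumn sz) /psum -!prodrXr -big_split /=.
  apply: eq_bigr => i _; rewrite /x /gridx !exprMn -!exprM -/lam.
  have -> : t ^+ (i * lam i) = (t ^+ i) ^+ lam i by rewrite exprM.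
  have -> : (n * lam i = (n - i.+1) * lam i + i * lam i + lam i)%N.
    by have := ltn_ord i; nia.
  rewrite mulnn !exprD !exprM exprVn; field.
  by rewrite !expf_neq0.
have {}eX : \prod_(i < n) x i ^+ lam i =
    q ^+ (2 * nstat (pconj la)) * q ^+ sumn la * (s * t ^+ n / t) ^+ sumn la / t ^+ nstat la.
  rewrite -exprD -eX big_split /= (nstatE sz) prodrXr mulfK // expf_neq0 //.
rewrite eX; have -> : q * s * t ^+ n / t = q * (s * t ^+ n / t) by rewrite !mulrA.
rewrite exprMn.
have u1 : (s * t ^+ n / t) ^+ sumn la != 0.
  by rewrite expf_neq0 // !mulf_neq0 ?invr_eq0 ?expf_neq0.
move: u1; move: ((s * t ^+ n / t) ^+ sumn la) => U u1.
by field; rewrite u1 !expf_neq0.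
Qed.

End HookValue.

(** * The lifted interpolation functions *)

(** Only finitely many partitions are below la. *)
Lemma dom_lt_ind (P : intpart -> Prop) :
  (forall la, (forall mu, dom_lt mu la -> P mu) -> P la) -> forall la, P la.
Proof.
move=> step.
pose below la := sval (cid2 (enum_dom_le la)).
have bU la : uniq (below la) by rewrite /below; case: cid2.
have bP la mu : mu \in below la <-> dom_le mu la by rewrite /below; case: cid2.
have lt la mu : dom_lt mu la -> (size (below mu) < size (below la))%N.
  move=> [le ne]; apply: (@uniq_leq_size _ (la :: below mu)) => [|nu].
    rewrite /= bU andbT; apply/negP => /bP le'; apply: ne; exact: dom_le_anti.
  rewrite inE => /orP[/eqP ->|/bP h]; apply/bP; first exact: dom_le_refl.
  exact: dom_le_trans h le.
have H N : forall la, (size (below la) < N)%N -> P la.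
  elim: N => [//|N IHN] la hN; apply: step => mu /lt h; apply: IHN.
  exact: leq_trans h hN.
by move=> la; apply: (H (size (below la)).+1).
Qed.

Section Lift.
Variables (K : fieldType) (char0 : [pchar K] =i pred0) (q t s : K).
Hypothesis gs : generic q t 1 s.
Implicit Types (la mu nu : intpart) (c : K).
Local Notation L := (ratfun K).
Local Notation charL := (pchar_ratfun char0).
Local Notation br := (sf_bracket charL (cst q) (cst t) (cst s) (var K)).
Local Notation brc := (sf_bracket char0 q t s).
Local Notation Vf := (hookval (cst q) (cst t) (cst s) (var K)).
Local Notation admissible := (admissible q t s).

Let nq : q != 0. Proof. by case: gs => -[]. Qed.
Let nt : t != 0. Proof. by case: gs => -[]. Qed.
Let ns : s != 0. Proof. by case: gs => -[]. Qed.

Let tX k : t ^+ k.+1 != 1.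
Proof.
by apply/eqP => e; have := @generic_qt _ _ _ _ _ gs 0 k.+1%:Z; rewrite expr0z mul1r => /(_ e) [].
Qed.

Let t_inj : injective (fun n => t ^+ n).
Proof.
have key m k : t ^+ m = t ^+ (m + k) -> k = 0%N.
  case: k => // k; rewrite exprD -{1}[t ^+ m]mulr1 => /(mulfI (expf_neq0 m nt)) /esym e.
  by have := tX k; rewrite e eqxx.
move=> m k /= e; have [le|/ltnW le] := leqP m k.
  by have := key m (k - m)%N; rewrite subnKC // => /(_ e); lia.
by have := key k (m - k)%N; rewrite subnKC // => /(_ (esym e)); lia.
Qed.

Definition regular (x : L) : Prop := forall c, admissible c -> exists v, ratfun_at c x v.

Definition triang la (r : seq (L * intpart)) : symfun L :=
  mono_fun L la + \sum_(x <- r) x.1 *: mono_fun L x.2.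

Definition triang_ok la (r : seq (L * intpart)) : Prop :=
  forall x, x \in r -> dom_lt x.2 la /\ regular x.1.

Definition interp_ok la (P : symfun L) : Prop :=
  [/\ exists2 r, triang_ok la r & P = triang la r,
      forall mu, ~ part_sub la mu -> br mu P = 0
    & br la P = Vf la].

Lemma regularM x y : regular x -> regular y -> regular (x * y).
Proof. by move=> h h' c gc; have [u ?] := h c gc; have [v ?] := h' c gc; exists (u * v); apply: ratfun_atM. Qed.
Lemma regularN x : regular x -> regular (- x).
Proof. by move=> h c gc; have [u ?] := h c gc; exists (- u); apply: ratfun_atN. Qed.

Lemma regular_Vf la : regular (Vf la)^-1.
Proof.
move=> c gc; exists (hookval q t s c la)^-1; apply: ratfun_atV.
  exact: hookval_neq0.
exact: hookval_at.
Qed.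

Lemma Vf_neq0 la : Vf la != 0.
Proof.
have g1 := admissible_tn gs 0; exact: ratfun_at_neq0 (hookval_at gs la g1) (hookval_neq0 gs la g1).
Qed.

Lemma br_mono_at c mu la : admissible c -> ratfun_at c (br mu (mono_fun L la)) (brc c mu (mono_fun K la)).
Proof.
by move=> [nc _]; rewrite -(lift_mono (cst_morph K)); apply: sf_bracket_lift.
Qed.

(** Regular coefficients can be specialised at c, and the brackets with them, since the
    brackets of the monomial functions are regular. *)
Lemma triang_spec c la r : admissible c -> triang_ok la r ->
  exists2 r' : seq (K * intpart), forall x, x \in r' -> dom_lt x.2 la &
    let g := mono_fun K la + \sum_(x <- r') x.1 *: mono_fun K x.2 in
    sf_at c (triang la r) g /\ forall mu, ratfun_at c (br mu (triang la r)) (brc c mu g).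
Proof.
move=> gc ok; pose v (x : L) : K := if pselect (exists u, ratfun_at c x u) is left h then sval (cid h) else 0.
have vP x : x \in r -> ratfun_at c x.1 (v x.1).
  move=> /ok [_ /(_ c gc) ex]; rewrite /v; case: pselect => // h; exact: (svalP (cid h)).
exists [seq (v x.1, x.2) | x <- r] => [x /mapP[y /ok[lt _] ->]//|].
rewrite big_map /=; split=> [n m|mu].
  have E (F : fieldType) : forall (y : F) nu, (sf (y *: mono_fun F nu) n)@_m =
      y * (perm_eq [seq k <- m | k != 0%N] nu)%:R.
    by move=> y nu; rewrite sfEZ mcoeffZ /= mcoeff_mono_sym.
  have B (b : bool) : ratfun_at c (b%:R : L) b%:R.
    by case: b; [exact: ratfun_at1|exact: ratfun_at0].
  rewrite !sfED !mcoeffD /= !mcoeff_mono_sym; apply: ratfun_atD => //.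
  rewrite !sf_sum !raddf_sum /=; apply: ratfun_at_sum => x xr.
  rewrite !mcoeffZ !mcoeff_mono_sym; apply: ratfun_atM => //; exact: vP.
rewrite /triang !sf_bracketD !sf_bracket_sum; apply: ratfun_atD; first exact: br_mono_at.
apply: ratfun_at_sum => x xr; rewrite !sf_bracketZ; apply: ratfun_atM; first exact: vP.
exact: br_mono_at.
Qed.

Lemma regular_br la r mu : triang_ok la r -> regular (br mu (triang la r)).
Proof.
move=> ok c gc; have [r' _ [_ h]] := triang_spec gc ok; eexists; exact: h.
Qed.

Lemma bracket_gpoint n mu (f : symfun K) : (size mu <= n)%N ->
  brc (t ^+ n) mu f = laurent_eval id (gpoint q t s mu) (sf_laurent n f).
Proof. by move=> sz; apply: sf_bracket_tn => // i; apply: gpoint_neq0. Qed.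

(** At T = t^n the bracket at mu is the value at a grid point in n variables. There
    [bc_extra] and [bc_value] apply for every large n, and a rational function of T which
    vanishes at infinitely many powers of t is 0. *)
Lemma triang_extra la r : triang_ok la r ->
    (forall mu, dom_lt mu la -> br mu (triang la r) = 0) ->
  interp_ok la (triang la r).
Proof.
move=> ok van.
have key n : (size la <= n)%N -> exists g : symfun K,
    [/\ forall mu, ratfun_at (t ^+ n) (br mu (triang la r)) (brc (t ^+ n) mu g),
        exp_dom la (sf_laurent n g), coeff (part_exp n la) (sf_laurent n g) = 1
      & vanish_below q t s la (sf_laurent n g)].
  move=> sz; have [r' lt' [_ at_g]] := triang_spec (admissible_tn gs n) ok.
  eexists; split; [exact: at_g|exact: sf_laurent_bounded|exact: coeff_sf_laurent|].
  move=> mu lt szm; rewrite -bracket_gpoint //; apply: ratfun_at_uniq (at_g mu) _.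
  by rewrite van //; exact: ratfun_at0.
split; first by exists r.
  move=> mu nsub; apply: (ratfun_eq0 (N0 := maxn (size la) (size mu)) t_inj) => n.
  rewrite geq_max => /andP[sz szm]; have [g [at_g bg cg vg]] := key n sz.
  rewrite (_ : 0 = brc (t ^+ n) mu g) //; rewrite bracket_gpoint //.
  by rewrite (bc_extra char0 gs (@sf_laurent_sym _ _ g) bg sz vg szm nsub).
apply/eqP; rewrite -subr_eq0; apply/eqP.
apply: (ratfun_eq0 (N0 := size la) t_inj) => n sz; have [g [at_g bg cg vg]] := key n sz.
rewrite (_ : 0 = brc (t ^+ n) la g - hookval q t s (t ^+ n) la); last first.
  rewrite bracket_gpoint // (bc_value char0 gs (@sf_laurent_sym _ _ g) bg sz vg) cg mul1r.
  by rewrite hookval_tn // subrr.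
by apply: ratfun_atB => //; apply: hookval_at => //; exact: admissible_tn.
Qed.

(** Starting from m_la, the brackets at the partitions mu < la are annihilated one
    after the other by adding multiples of P_mu. The coefficients divide by the bracket
    of P_mu at mu, the explicit nonzero value Vf mu, so they are regular at all
    admissible T; this is what lets [triang_extra] be applied to the result and keeps the
    recursion going. *)
Lemma interp_exists la : exists P, interp_ok la P.
Proof.
elim/dom_lt_ind: la => la IH.
have exP mu : exists Q, dom_lt mu la -> interp_ok mu Q.
  have [lt|nlt] := pselect (dom_lt mu la); last by exists 0.
  by have [Q hQ] := IH mu lt; exists Q.
have [P PP] := choice exP.
have [s0 us0 s0P] := enum_dom_le la.
(* by increasing size: adding a multiple of P mu then does not disturb the vanishing at the
   previous partitions, as these do not contain mu *)
pose ks := sort (relpre (fun mu : intpart => sumn mu) leq) [seq mu <- s0 | mu != la].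
have kt : transitive (relpre (fun mu : intpart => sumn mu) leq).
  by move=> x y z; apply: leq_trans.
have sks : pairwise (relpre (fun mu : intpart => sumn mu) leq) ks.
  by rewrite -(sorted_pairwise kt); apply: sort_sorted => x y; exact: leq_total.
have uks : uniq ks by rewrite sort_uniq filter_uniq.
have ksP mu : mu \in ks <-> dom_lt mu la.
  rewrite mem_sort mem_filter; split=> [/andP[/eqP ne /s0P le]//|[le /eqP ne]].
  by rewrite ne; apply/s0P.
suff [r ok van] : exists2 r, triang_ok la r & forall mu, mu \in ks -> br mu (triang la r) = 0.
  by exists (triang la r); apply: triang_extra => // mu /ksP; apply: van.
have {ksP} kslt mu : mu \in ks -> dom_lt mu la by move/ksP.
elim/last_ind: ks sks uks kslt => [|ks mu IHks] sks uks kslt.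
  by exists [::] => // x; rewrite in_nil.
have lt : dom_lt mu la by apply: kslt; rewrite mem_rcons mem_head.
have [|||r ok van] := IHks.
- by move: sks; rewrite pairwise_rcons => /andP[].
- by move: uks; rewrite rcons_uniq => /andP[].
- by move=> nu h; apply: kslt; rewrite mem_rcons inE h orbT.
have [[r1 ok1 eP] ex val] := PP mu lt.
pose a := - (br mu (triang la r) / Vf mu).
exists (r ++ (a, mu) :: [seq (a * x.1, x.2) | x <- r1]).
  have ra : regular a by apply: regularN; apply: regularM; [exact: regular_br|exact: regular_Vf].
  move=> x; rewrite mem_cat inE => /or3P[/ok //|/eqP -> //|/mapP[y /ok1[lt1 reg1] ->]].
  by split; [exact: dom_lt_trans lt1 lt|exact: regularM].
have -> : triang la (r ++ (a, mu) :: [seq (a * x.1, x.2) | x <- r1]) = triang la r + a *: P mu.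
  have -> : a *: P mu = a *: mono_fun L mu + \sum_(x <- r1) (a * x.1) *: mono_fun L x.2.
    rewrite eP /triang scalerDr scaler_sumr; congr (_ + _).
    by apply: eq_bigr => x _; rewrite scalerA.
  by rewrite /triang big_cat big_cons big_map /= -!addrA.
move=> nu; rewrite mem_rcons inE sf_bracketD sf_bracketZ => /predU1P[->|nuk].
  by rewrite val /a mulNr divfK ?Vf_neq0 // subrr.
rewrite van // add0r ex ?mulr0 // => sub.
have le : (sumn nu <= sumn mu)%N.
  by move: sks; rewrite pairwise_rcons => /andP[/allP/(_ nu nuk)].
have ne : mu <> nu.
  by move=> e; move: uks; rewrite rcons_uniq e nuk.
by have := part_sub_sumn sub ne; rewrite ltnNge le.
Qed.

Section Uniqueness.
Variable P : intpart -> symfun L.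
Hypothesis PP : forall la, interp_ok la (P la).

(** The expansion of P_mu is unitriangular for dominance, hence can be inverted. *)
Lemma mono_span la mu : dom_le mu la ->
  exists2 a : seq (L * intpart), forall x, x \in a -> dom_le x.2 mu
    & mono_fun L mu = \sum_(x <- a) x.1 *: P x.2.
Proof.
move=> _; elim/dom_lt_ind: mu => mu IH.
have [[r ok eP] _ _] := PP mu.
have [a ha ea] : exists2 a : seq (L * intpart), forall x, x \in a -> dom_le x.2 mu
    & \sum_(x <- r) x.1 *: mono_fun L x.2 = \sum_(x <- a) x.1 *: P x.2.
  have {}ok x : x \in r -> dom_lt x.2 mu by move/ok => [].
  elim: r ok {eP} => [|x r IHr] ok; first by exists [::]; rewrite ?big_nil.
  have [a1 h1 e1] := IHr (fun y yr => ok y (mem_behead (s := x :: r) yr)).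
  have [a2 h2 e2] := IH x.2 (ok x (mem_head _ _)).
  exists ([seq (x.1 * y.1, y.2) | y <- a2] ++ a1) => [y|].
    rewrite mem_cat => /orP[/mapP[z /h2 le ->]|/h1 //] /=.
    by apply: dom_le_trans le _; have [] := ok x (mem_head _ _).
  rewrite big_cons e1 e2 big_cat big_map scaler_sumr /=; congr (_ + _).
  by apply: eq_bigr => y _; rewrite scalerA.
exists ((1, mu) :: [seq (- x.1, x.2) | x <- a]) => [x|].
  rewrite inE => /predU1P[->|/mapP[y /ha le ->] //]; exact: dom_le_refl.
rewrite big_cons scale1r big_map /= eP /triang ea -addrA -big_split /=.
by rewrite big1 ?addr0 // => x _; rewrite -scalerDl subrr scale0r.
Qed.

(** Write the difference of two candidates as a combination of the P_mu, mu < la. The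
    bracket of P_nu at mu is 0 unless nu is contained in mu, and nonzero for nu = mu: this
    triangular system, in which all left-hand sides are 0, has only the zero solution. *)
Lemma interp_determined la (r r' : seq (L * intpart)) :
    (forall x, x \in r -> dom_lt x.2 la) -> (forall x, x \in r' -> dom_lt x.2 la) ->
    (forall mu, dom_lt mu la -> br mu (triang la r) = 0) ->
    (forall mu, dom_lt mu la -> br mu (triang la r') = 0) ->
  triang la r = triang la r'.
Proof.
move=> hr hr' v v'; apply/eqP; rewrite -subr_eq0; apply/eqP.
have [a ha ea] : exists2 a : seq (L * intpart), forall x, x \in a -> dom_lt x.2 la
    & triang la r - triang la r' = \sum_(x <- a) x.1 *: P x.2.
  have H (r0 : seq (L * intpart)) : (forall x, x \in r0 -> dom_lt x.2 la) ->
    exists2 a : seq (L * intpart), forall x, x \in a -> dom_lt x.2 la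
      & \sum_(x <- r0) x.1 *: mono_fun L x.2 = \sum_(x <- a) x.1 *: P x.2.
    elim: r0 => [|x r0 IHr] ok; first by exists [::]; rewrite ?big_nil.
    have [a1 h1 e1] := IHr (fun y yr => ok y (mem_behead (s := x :: r0) yr)).
    have [le ne] := ok x (mem_head _ _).
    have [a2 h2 e2] := mono_span le.
    exists ([seq (x.1 * y.1, y.2) | y <- a2] ++ a1) => [y|].
      rewrite mem_cat => /orP[/mapP[z /h2 le' ->]|/h1 //] /=.
      split; first exact: dom_le_trans le.
      by move=> e; apply: ne; apply: dom_le_anti => //; rewrite -e.
    rewrite big_cons e1 e2 big_cat big_map scaler_sumr /=; congr (_ + _).
    by apply: eq_bigr => y _; rewrite scalerA.
  have [a1 h1 e1] := H r hr; have [a2 h2 e2] := H r' hr'.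
  exists (a1 ++ [seq (- x.1, x.2) | x <- a2]) => [x|].
    by rewrite mem_cat => /orP[/h1|/mapP[y /h2 ? ->]].
  rewrite /triang e1 e2 opprD addrACA subrr add0r big_cat big_map -sumrN /=.
  by congr (_ + _); apply: eq_bigr => x _; rewrite scaleNr.
pose ks := undup [seq x.2 | x <- a].
pose b (mu : intpart) := \sum_(x <- a | x.2 == mu) x.1.
have eb : triang la r - triang la r' = \sum_(mu <- ks) b mu *: P mu.
  rewrite ea /b; under [RHS]eq_bigr => mu _ do rewrite scaler_suml.
  rewrite (exchange_big_dep xpredT) //= big_seq [RHS]big_seq; apply: eq_bigr => x xa.
  have xk : x.2 \in ks by rewrite mem_undup; apply/mapP; exists x.
  rewrite big_mkcond (bigD1_seq x.2) ?undup_uniq //= eqxx.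
  by rewrite big1 ?addr0 // => mu; rewrite eq_sym => /negPf ->.
have kslt mu : mu \in ks -> dom_lt mu la by rewrite mem_undup => /mapP[x /ha lt ->].
have van mu : mu \in ks -> br mu (triang la r - triang la r') = 0.
  by move=> /kslt lt; rewrite -scaleN1r sf_bracketD sf_bracketZ v // v' // mulr0 addr0.
(* induction on the size of mu, whose smaller coefficients are already known to be 0 *)
have b0 N : forall mu, mu \in ks -> (sumn mu < N)%N -> b mu = 0.
  elim: N => [//|N IHN] mu muk; rewrite ltnS => szm.
  have := van mu muk; rewrite eb sf_bracket_sum (bigD1_seq mu) ?undup_uniq //=.
  rewrite big_seq_cond big1 ?addr0 => [|nu /andP[nuk /eqP ne]].
    have [_ _ val] := PP mu; rewrite sf_bracketZ val => /eqP.
    by rewrite mulf_eq0 (negPf (Vf_neq0 mu)) orbF => /eqP.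
  rewrite sf_bracketZ; have [sub|nsub] := pselect (part_sub nu mu); last first.
    by have [_ ex _] := PP nu; rewrite ex // mulr0.
  by rewrite IHN ?mul0r // (leq_trans (part_sub_sumn sub ne)).
by rewrite eb big_seq big1 // => mu muk; rewrite (b0 _ mu muk (ltnSn _)) scale0r.
Qed.
End Uniqueness.

Lemma varX_neq0 n (i : 'I_n) : varX K i != 0.
Proof. by rewrite /varX tofrac_eq0 -msupp_eq0 msuppX. Qed.

Definition cstX_morph n : {rmorphism K -> ratfunX K n} :=
  (@tofrac {mpoly K[n]} \o @mpolyC n K).

Lemma sf_pmE n (g : symfun K) :
  sf_pm n g = laurent_eval (@cstX K n) (@varX K n) (sf_laurent n g).
Proof.
rewrite /sf_laurent -[@cstX K n]/(cstX_morph n : K -> ratfunX K n).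
by rewrite (eval_pm_laurent (cstX_morph n) _ (@varX_neq0 n)).
Qed.

(** At T = t^n the function specialises to a Laurent polynomial in n variables with the
    leading term and the zeros that characterise the interpolation polynomial. If la has
    more than n parts, the leading term disappears and only 0 has these zeros. *)
Lemma interp_restrict la (P : symfun L) n : interp_ok la P ->
  exists2 g : symfun K, sf_at (t ^+ n) P g &
    if (size la <= n)%N then
      exists2 h : laurent K n, unique (fun h' : laurent K n => bc_interp q t s la h') h
        & sf_pm n g = laurent_eval (@cstX K n) (@varX K n) h
    else sf_pm n g = 0.
Proof.
move=> [[r ok ->] ex _].
have [r' lt' [at_g br_g]] := triang_spec (admissible_tn gs n) ok.
set g := mono_fun K la + _ in at_g br_g; exists g => //.
have sg : bc_symmetric (sf_laurent n g) by exact: sf_laurent_sym.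
have bg : exp_dom la (sf_laurent n g) by exact: sf_laurent_bounded.
have vg : vanish_below q t s la (sf_laurent n g).
  move=> mu lt szm; rewrite -bracket_gpoint //; apply: ratfun_at_uniq (br_g mu) _.
  by rewrite ex; [exact: ratfun_at0|exact: dom_lt_nsub].
case: leqP => sz; last first.
  have g0 : sf_laurent n g = 0.
    by apply: (bc_unique char0 gs sg bg _ vg); rewrite leqNgt sz.
  by rewrite sf_pmE g0 /laurent_eval dom0 big_nil.
exists (sf_laurent n g); last exact: sf_pmE.
have h : bc_interp q t s la (sf_laurent n g).
  split=> //; by apply: bc_decomp => //; exact: coeff_sf_laurent.
by split=> // h' hh'; exact: (bc_interp_unique char0 gs h hh' sz).
Qed.

Theorem lifted_interp_family :
  exists P : intpart -> symfun L,
    [/\ unique (fun P' : intpart -> symfun L =>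
          forall la, lifted_interp charL (cst q) (cst t) (cst s) (var K) la (P' la)) P,
        forall (n : nat) (la : intpart), (0 < n)%N ->
          exists2 g : symfun K,
            sf_at (t ^+ n) (P la) g
          & if (size la <= n)%N then
              exists2 h : laurent K n,
                unique (fun h' : laurent K n => bc_interp q t s la h') h
              & sf_pm n g = laurent_eval (@cstX K n) (@varX K n) h
            else sf_pm n g = 0,
        forall la mu : intpart, ~ part_sub la mu -> br mu (P la) = 0
      & forall la : intpart, br la (P la) = Vf la].
Proof.
have [P PP] := choice interp_exists.
exists P; split.
- split=> [la|P' hP'].
    have [[r ok eP] ex _] := PP la; split.
      by exists r => // x /ok[].
    by move=> mu lt; apply: ex; apply: dom_lt_nsub.
  apply: funext => la; have [[r ok eP] ex _] := PP la.
  have [[r' ok' eP'] van'] := hP' la; rewrite eP eP'.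
  apply: (interp_determined PP) => //.
  + by move=> x /ok[].
  + by move=> mu lt; rewrite -eP; apply: ex; apply: dom_lt_nsub.
  by move=> mu lt; rewrite -[triang la r']eP'; apply: van'.
- by move=> n la _; apply: interp_restrict.
- by move=> la mu nsub; have [_ ex _] := PP la; apply: ex.
by move=> la; have [_ _ val] := PP la.
Qed.

End Lift.

(** * Genericity of the indeterminates *)

Lemma ratfun_monom (K : fieldType) (u : K) (e : int) :
  u != 0 -> cst u * var K ^ e = 1 -> u = 1 /\ e = 0.
Proof.
move=> nu; have key (v : K) (k : nat) : v != 0 -> cst v * var K ^+ k = 1 -> v = 1 /\ k = 0%N.
  move=> nv; rewrite /cst /var -tofracXn -tofracM -tofrac1 => /eqP.
  rewrite tofrac_eq mul_polyC => /eqP e1.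
  have k0 : k = 0%N.
    have := congr1 (fun p : {poly K} => size p) e1.
    by rewrite size_scale // size_polyXn size_poly1 => -[].
  move: e1; rewrite k0 expr0 alg_polyC => /polyC_inj.
  by split.
case: e => k; first by rewrite -exprnP => /(key u k nu) [-> ->].
rewrite NegzE -exprnN => e1.
have nv : var K != 0 by rewrite /var tofrac_eq0 polyX_eq0.
have [] := key u^-1 k.+1 => //; first by rewrite invr_eq0.
have -> : cst u^-1 = (cst u)^-1 :> ratfun K by exact: (fmorphV (cst_morph K)).
by rewrite -[RHS]invr1 -e1 invfM invrK.
Qed.

(** Apart from nonvanishing, the conditions say that a monomial in the indeterminates
    q, t, s with a nonzero exponent is not 1: s occurs squared in the last one. *)
Lemma generic_Fs : generic q1 t1 1 s1.
Proof.
have nv (F : fieldType) : var F != 0 by rewrite /var tofrac_eq0 polyX_eq0.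
have nc (F : fieldType) (x : F) : x != 0 -> cst x != 0.
  by move=> nx; rewrite /cst tofrac_eq0 polyC_eq0.
have qt (a b : int) : q0 ^ a * t0 ^ b = 1 -> a = 0 /\ b = 0.
  rewrite /q0 /t0 -[X in X ^ a]/(cst_morph _ (var rat)) -fmorphXz.
  have nqa : var rat ^ a != 0 by rewrite expfz_eq0 (negPf (nv _)) andbF.
  move=> /(ratfun_monom nqa) [e ->]; split=> //.
  have e1 : cst 1 * var rat ^ a = 1.
    by rewrite -[cst 1]/(cst_morph _ 1) rmorph1 mul1r e.
  exact: (ratfun_monom (oner_neq0 rat) e1).2.
have mon (a b : int) : q1 ^ a * t1 ^ b = cst (q0 ^ a * t0 ^ b).
  transitivity (cst_morph Fqt (q0 ^ a * t0 ^ b)); last by [].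
  by rewrite rmorphM (fmorphXz (cst_morph Fqt) a) (fmorphXz (cst_morph Fqt) b).
have nq0 : q0 != 0 by apply: nc.
have nt0 : t0 != 0 by exact: nv.
have nab (F : fieldType) (x y : F) (a b : int) : x != 0 -> y != 0 -> x ^ a * y ^ b != 0.
  by move=> nx ny; apply: mulf_neq0; apply: expfz_neq0.
split; first by split; [exact: nc|exact: nc|exact: nv|exact: oner_neq0].
split=> [a b|a b]; rewrite mon.
  rewrite -[RHS](rmorph1 (cst_morph Fqt)) => /(fmorph_inj (cst_morph Fqt)); exact: qt.
by apply/eqP => /(@ratfun_monom _ _ 2%:Z (nab _ _ _ a b nq0 nt0)) [].
Qed.

Theorem theorem6p1 :
  exists P : intpart -> symfun FsT,
    [/\ unique (fun P' : intpart -> symfun FsT =>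
          forall la, lifted_interp pchar_FsT q2 t2 s2 T2 la (P' la)) P,
        forall (n : nat) (la : intpart), (0 < n)%N ->
          exists2 g : symfun Fs,
            sf_at (t1 ^+ n) (P la) g
          & if (size la <= n)%N then
              exists2 h : laurent Fs n,
                unique (fun h' : laurent Fs n => bc_interp q1 t1 s1 la h') h
              & sf_pm n g = laurent_eval (@cstX Fs n) (@varX Fs n) h
            else sf_pm n g = 0,
        forall la mu : intpart, ~ part_sub la mu ->
          sf_bracket pchar_FsT q2 t2 s2 T2 mu (P la) = 0
      & forall la : intpart,
          sf_bracket pchar_FsT q2 t2 s2 T2 la (P la)
          = (q2 * s2 * T2 / t2) ^- sumn la * t2 ^+ nstat la
            * q2 ^- (2 * nstat (pconj la))
            * Cminus q2 t2 la q2 * Cplus q2 t2 la ((s2 * T2 / t2) ^+ 2)].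
Proof.
have charFs : [pchar Fs] =i pred0.
  by do 3!apply: pchar_ratfun; exact: pchar_num.
(* the homomorphism behind the bracket is chosen from a proof of characteristic 0, so two
   such proofs have to be identified *)
rewrite (Prop_irrelevance pchar_FsT (pchar_ratfun charFs)).
exact: (lifted_interp_family charFs generic_Fs).
Qed.
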